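(* Let $\mathbb{k}$ be an algebraically closed field with $\mathrm{char}(\mathbb{k})=0$, and let $\mathfrak{g}=\mathfrak{sl}_2^c(\mathbb{k})$, with $U(\mathfrak{g})$, $H$, $\mathbb{k}_\phi$, $\mathcal{H}(\cdot)$, induced modules, torsion and the types of line modules as defined in the context. For each $k\in\{1,2,3\}$, the $a_k$-torsion (left) line modules over $H$, on which $a_4$ acts without torsion, are homogenizations of induced modules. More precisely, the following hold. (a) There exists a one-to-one correspondence between all pairs $(\mathfrak{h},\phi)$ such that $\mathfrak{h}=\mathbb{k}a_i\oplus\mathbb{k}(a_j+\mu a_k)$, $\{i,j,k\}=\{1,2,3\}$, $\mu=\pm1\in\mathbb{k}$, and $\phi\in\mathfrak{h}^*$ with $\phi(a_j+\mu a_k)=0$, and the line modules over $H$ of types 1(a)--3(b) on which $a_4$ acts without torsion; this correspondence is given by $$\mathcal{H}\big(U(\mathfrak{g})\otimes_{U(\mathfrak{h})}\mathbb{k}_\phi\big)\ \cong\ \frac{H}{H(a_i-\phi(a_i)a_4)+H(a_j+\mu a_k)}.$$ (b) There exists a one-to-one correspondence between all pairs $(\mathfrak{h},\phi)$ such that $\mathfrak{h}=\mathbb{k}a_i\oplus\mathbb{k}(a_j+\mu a_k)$, $\{i,j,k\}=\{1,2,3\}$, $\mu=\pm1\in\mathbb{k}$, and $\phi\in\mathfrak{h}^*$ with $\phi(a_i)=\mu/2$, and the line modules over $H$ of types 4(a)--6(b) on which $a_4$ acts without torsion; this correspondence is given by $$\mathcal{H}\big(U(\mathfrak{g})\otimes_{U(\mathfrak{h})}\mathbb{k}_\phi\big)\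 \cong\ \frac{H}{H(a_4-2\mu a_i)+H(a_j+\mu a_k-\phi(a_j+\mu a_k)a_4)}.$$
   Context: Color Lie algebra: $\mathfrak{g}=\mathfrak{sl}_2^c(\mathbb{k})$ has basis $\{a_1,a_2,a_3\}$ and bilinear color-Lie bracket $\langle a_1,a_2\rangle=\langle a_2,a_1\rangle=a_3$, $\langle a_2,a_3\rangle=\langle a_3,a_2\rangle=a_1$, $\langle a_3,a_1\rangle=\langle a_1,a_3\rangle=a_2$, $\langle a_i,a_i\rangle=0$ for all $i$. A subalgebra of $\mathfrak{g}$ is a subspace closed under this bracket. Algebras: $U(\mathfrak{g})=\mathbb{k}\langle a_1,a_2,a_3\rangle/\langle a_1a_2+a_2a_1-a_3,\ a_2a_3+a_3a_2-a_1,\ a_3a_1+a_1a_3-a_2\rangle$. For a subalgebra $\mathfrak{h}$, $U(\mathfrak{h})$ is the subalgebra of $U(\mathfrak{g})$ generated by $\mathfrak{h}$. The homogenization $H$ of $U(\mathfrak{g})$ is $\mathbb{k}\langle a_1,a_2,a_3,a_4\rangle$ modulo the relations $a_1a_2+a_2a_1=a_3a_4$, $a_2a_3+a_3a_2=a_1a_4$, $a_3a_1+a_1a_3=a_2a_4$, and $a_ia_4=a_4a_i$ for $i=1,2,3$, graded with each $a_i$ in degree $1$. Modules: modules are left modules, and line modules are considered up to isomorphism. A line module over $H$ is a graded cyclic $H$-module with Hilbert series $1/(1-x)^2$. The element $a_4$ acts without torsion on a module if it annihilates no nonzero element; a module is called $a_k$-torsion if $a_k$ acts on it with torsion, i.e.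 annihilates some nonzero element. For $\phi\in\mathfrak{h}^*$ such that setting $a\cdot y=\phi(a)y$ ($a\in\mathfrak{h}$, $y\in\mathbb{k}$) defines a module over $\mathfrak{h}$ (equivalently, over $U(\mathfrak{h})$), $\mathbb{k}_\phi$ denotes this $1$-dimensional module; this is the case for all $\phi$ occurring in (a) and (b). An induced module is a $U(\mathfrak{g})$-module $U(\mathfrak{g})\otimes_{U(\mathfrak{h})}\mathbb{k}_\phi$ with $\mathfrak{h}$ a $2$-dimensional subalgebra of $\mathfrak{g}$ and $\mathbb{k}_\phi$ such a $1$-dimensional module. Homogenization: filter $U(\mathfrak{g})$ by $U(\mathfrak{g})_0=\mathbb{k}$, $U(\mathfrak{g})_i=U(\mathfrak{g})_{i-1}+\mathfrak{g}^i$ for $i\ge1$, and filter $M=U(\mathfrak{g})\otimes_{U(\mathfrak{h})}\mathbb{k}_\phi$ by $M_i=\{x\otimes1:x\in U(\mathfrak{g})_i\}$. The homogenization of $M$ is $\mathcal{H}(M)=\bigoplus_{i\ge0}M_ia_4^i$, the graded $H$-module with $a_4\cdot(m a_4^i)=m a_4^{i+1}$ and $x\cdot(m a_4^i)=(xm)a_4^{i+1}$ for $m\in M_i$ and $x\in\mathbb{k}a_1\oplus\mathbb{k}a_2\oplus\mathbb{k}a_3$. Lines: $\mathbb{P}^3$ is identified with $\mathbb{P}((\mathbb{k}a_1\oplus\cdots\oplus\mathbb{k}a_4)^* )$, and $\mathcal{V}(\cdot)$ denotes zero locus. The line module given by a line $\mathcal{V}(u,v)$ ($u,v\in H_1$ linearly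 independent) is $H/(Hu+Hv)$. It is known that the line modules over $H$ are given by exactly the following types of lines, and conversely each such line gives a line module: 1(a) lines in $\mathcal{V}(a_1+a_2)$ through $(1,-1,0,0)$; 1(b) lines in $\mathcal{V}(a_1-a_2)$ through $(1,1,0,0)$; 2(a) lines in $\mathcal{V}(a_1+a_3)$ through $(1,0,-1,0)$; 2(b) lines in $\mathcal{V}(a_1-a_3)$ through $(1,0,1,0)$; 3(a) lines in $\mathcal{V}(a_2+a_3)$ through $(0,1,-1,0)$; 3(b) lines in $\mathcal{V}(a_2-a_3)$ through $(0,1,1,0)$; 4(a) lines in $\mathcal{V}(a_4-2a_3)$ through $(1,-1,0,0)$; 4(b) lines in $\mathcal{V}(a_4+2a_3)$ through $(1,1,0,0)$; 5(a) lines in $\mathcal{V}(a_4-2a_2)$ through $(1,0,-1,0)$; 5(b) lines in $\mathcal{V}(a_4+2a_2)$ through $(1,0,1,0)$; 6(a) lines in $\mathcal{V}(a_4-2a_1)$ through $(0,1,-1,0)$; 6(b) lines in $\mathcal{V}(a_4+2a_1)$ through $(0,1,1,0)$; 7 all lines in $\mathcal{V}(a_4)$. *)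

(* Defs.v *)
From HB Require Import structures.
From mathcomp Require Import all_boot all_order all_algebra.
From mathcomp Require Import generic_quotient ring_quotient.
From mathcomp Require Import finmap boolp functions monalg.

Set Implicit Arguments.
Unset Strict Implicit.
Unset Printing Implicit Defensive.

Import GRing.Theory.
Local Open Scope ring_scope.

Section SubmoduleGen.
Variables (R : pzRingType) (M : lmodType R) (P : M -> Prop).

Definition submod_gen : {pred M} := fun x =>
  `[< forall S : {pred M}, GRing.submod_closed S ->
        (forall y, P y -> y \in S) -> x \in S >].

Lemma submod_gen_closed : GRing.submod_closed submod_gen.
Proof.
split=> [|a x y /asboolP Hx /asboolP Hy]; apply/asboolP => S SS PS.
  by case: SS.
by case: (SS) => _; apply; [apply: Hx | apply: Hy].
Qed.

Lemma mem_submod_gen x : P x -> x \in submod_gen.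
Proof. by move=> Px; apply/asboolP => S _; apply. Qed.
End SubmoduleGen.

Section QuotientModule.
Variables (R : pzRingType) (M : lmodType R).

Definition submod_pred (S : {pred M}) of GRing.submod_closed S : {pred M} := S.

HB.instance Definition _ (S : {pred M}) (SS : GRing.submod_closed S) :=
  GRing.isSubmodClosed.Build R M (submod_pred SS) SS.

Variables (S : {pred M}) (SS : GRing.submod_closed S).

Definition quotmod := Quotient.quot (submod_pred SS).

HB.instance Definition _ := GRing.Zmodule.on quotmod.

Definition qpi (x : M) : quotmod := (\pi_(Quotient.quot (submod_pred SS)) x)%qT.

Lemma qpi_eq x y : (qpi x = qpi y) <-> (x - y \in S).
Proof.
change (x - y \in S) with (x - y \in submod_pred SS).
by rewrite Quotient.idealrBE; split=> /eqP.
Qed.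

Lemma qpi_surj (q : quotmod) : exists x, q = qpi x.
Proof. by exists (repr q); rewrite /qpi reprK. Qed.

Lemma qpiD : {morph qpi : x y / x + y}.
Proof. by move=> x y; rewrite /qpi; exact: (raddfD (\pi_(Quotient.quot (submod_pred SS)))%qT). Qed.

(* The operations below are locked so that unification does not unfold them. *)
Definition qscale : R -> quotmod -> quotmod :=
  locked (fun a q => qpi (a *: repr q)).

Lemma qscaleE a x : qscale a (qpi x) = qpi (a *: x).
Proof.
rewrite /qscale -lock; apply/qpi_eq; rewrite -scalerBr -[_ *: _]addr0.
have [S0 SL] := SS; apply: SL => //.
by apply/qpi_eq; rewrite /qpi reprK.
Qed.

Fact qscaleA a b q : qscale a (qscale b q) = qscale (a * b) q.
Proof. by have [x ->] := qpi_surj q; rewrite !qscaleE scalerA. Qed.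
Fact qscale1 : left_id 1 qscale.
Proof. by move=> q; have [x ->] := qpi_surj q; rewrite !qscaleE scale1r. Qed.
Fact qscaleDr : right_distributive qscale +%R.
Proof.
move=> a p q; have [x ->] := qpi_surj p; have [y ->] := qpi_surj q.
by rewrite -qpiD !qscaleE scalerDr qpiD.
Qed.
Fact qscaleDl q : {morph qscale^~ q : a b / a + b}.
Proof.
by move=> a b; have [x ->] := qpi_surj q; rewrite !qscaleE scalerDl qpiD.
Qed.

HB.instance Definition _ := GRing.Zmodule_isLmodule.Build R quotmod
  qscaleA qscale1 qscaleDr qscaleDl.

Lemma qpi_linear : linear qpi.
Proof. by move=> a x y; rewrite qpiD -qscaleE. Qed.

HB.instance Definition _ := GRing.isLinear.Build R M quotmod _ qpi qpi_linear.
End QuotientModule.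

(* A (x)_B N along f : B -> A, presented as the left A-module on the symbols
   1 (x) n, n \in N, with the relations of additivity in n and
   1 (x) (b n) = f b (x) n.  The lemmas below show that (a, n) |-> a (x) n is
   the universal B-balanced biadditive map. *)
Section ScalarExtension.
Variables (B A : nzRingType) (f : {rmorphism B -> A}) (N : lmodType B).

Inductive tens_rel : {malg A[N]} -> Prop :=
| TensAdd n n' : tens_rel (<< n + n' >> - << n >> - << n' >>)
| TensBal b n : tens_rel (<< b *: n >> - << f b *g n >>).

Definition tensor := quotmod (submod_gen_closed tens_rel).

HB.instance Definition _ := GRing.Lmodule.on tensor.

Definition tens (a : A) (n : N) : tensor :=
  qpi (submod_gen_closed tens_rel) << a *g n >>.

Lemma malgUZ (a c : A) (n : N) :
  a *: << c *g n >> = << a * c *g n >> :> {malg A[N]}.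
Proof. by apply/malgP => m; rewrite mcoeffZ !mcoeffU; case: eqP; rewrite ?mulr1n ?mulr0n ?mulr0. Qed.

Lemma malgUD (a c : A) (n : N) :
  << a + c *g n >> = << a *g n >> + << c *g n >> :> {malg A[N]}.
Proof. by apply/malgP => m; rewrite mcoeffD !mcoeffU mulrnDl. Qed.

Lemma tensZ a c n : a *: tens c n = tens (a * c) n.
Proof. by rewrite /tens -linearZ_LR /= malgUZ. Qed.

Lemma tensDl a c n : tens (a + c) n = tens a n + tens c n.
Proof. by rewrite /tens malgUD raddfD. Qed.

Lemma tensDr a n n' : tens a (n + n') = tens a n + tens a n'.
Proof.
rewrite -(mulr1 a) -!tensZ -scalerDr; congr (_ *: _).
rewrite /tens -raddfD; apply/qpi_eq; rewrite opprD addrA.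
exact/mem_submod_gen/TensAdd.
Qed.

Lemma tens_bal a b n : tens a (b *: n) = tens (a * f b) n.
Proof.
rewrite -{1}(mulr1 a) -!tensZ; congr (_ *: _).
by apply/qpi_eq; apply/mem_submod_gen/TensBal.
Qed.

Section Universal.
Variables (V : zmodType) (g : A -> N -> V).
Hypothesis gDl : forall a c n, g (a + c) n = g a n + g c n.
Hypothesis gDr : forall a n n', g a (n + n') = g a n + g a n'.
Hypothesis gB : forall a b n, g a (b *: n) = g (a * f b) n.

Let G (F : {malg A[N]}) := \sum_(n <- msupp F) g F@_n n.

Let g0 n : g 0 n = 0.
Proof. by apply: (addrI (g 0 n)); rewrite -gDl !addr0. Qed.

Let GE (d : {fset N}) F : (msupp F `<=` d)%fset ->
  G F = \sum_(n <- d) g F@_n n.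
Proof.
move=> le; rewrite /G (big_fset_incl _ le) //= => x _ /mcoeff_outdom ->.
exact: g0.
Qed.

Let GD F F' : G (F + F') = G F + G F'.
Proof.
rewrite (GE (msuppD_le F F')) (GE (fsubsetUl (msupp F) (msupp F'))).
rewrite (GE (fsubsetUr (msupp F) (msupp F'))) -big_split /=.
by apply: eq_bigr => n _; rewrite mcoeffD gDl.
Qed.

Let GU a n : G << a *g n >> = g a n.
Proof. by rewrite (GE msuppU_le) big_seq_fset1 mcoeffUU. Qed.

Let G0 : G 0 = 0. Proof. by rewrite /G msupp0 big_seq_fset0. Qed.

Let GN F : G (- F) = - G F.
Proof. by apply: (addrI (G F)); rewrite -GD !subrr G0. Qed.

Let G_rel F : F \in submod_gen tens_rel -> G F = 0.
Proof.
move=> /asboolP /(_ (fun F => `[< forall a, G (a *: F) = 0 >])) H.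
suff /asboolP/(_ 1) : F \in (fun F => `[< forall a, G (a *: F) = 0 >]).
  by rewrite scale1r.
apply: H => [|E [n n'|b n]].
- split; first by apply/asboolP => a; rewrite scaler0.
  move=> c x y /asboolP Hx /asboolP Hy; apply/asboolP => a.
  by rewrite scalerDr scalerA GD Hx Hy addr0.
- apply/asboolP => a; rewrite !scalerBr !malgUZ !GD !GN !GU !mulr1 gDr.
  by rewrite -addrA -opprD subrr.
apply/asboolP => a; rewrite scalerBr !malgUZ GD GN !GU mulr1 gB.
by rewrite subrr.
Qed.

Lemma tens_univ : exists! h : tensor -> V,
  (forall x y, h (x + y) = h x + h y) /\ (forall a n, h (tens a n) = g a n).
Proof.
pose h (q : tensor) := G (repr q).
have hE F : h (qpi (submod_gen_closed tens_rel) F) = G F.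
  apply/eqP; rewrite -subr_eq0 -GN -GD; apply/eqP/G_rel.
  by apply/(qpi_eq (submod_gen_closed tens_rel)); rewrite /qpi reprK.
exists h; split.
  split=> [x y|a n]; last by rewrite hE GU.
  have [u ->] := qpi_surj x; have [v ->] := qpi_surj y.
  by rewrite -qpiD !hE GD.
move=> h' [h'D h'E]; apply: funext => x; have [F ->] := qpi_surj x.
rewrite hE /G [in RHS](monalgE F).
have h'0 : h' 0 = 0 by apply: (addrI (h' 0)); rewrite -h'D !addr0.
rewrite raddf_sum /= (big_morph h' h'D h'0).
by apply: eq_bigr => n _; rewrite -h'E.
Qed.
End Universal.
End ScalarExtension.

Notation freealg k n := {malg k[{fmonom 'I_n}]}.

Section FreeAlgebra.
Variables (k : fieldType) (n : nat).
Local Notation F := (freealg k n).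

Fact freealg_scalerAr (c : k) (p q : F) : c *: (p * q) = p * (c *: q).
Proof.
rewrite (malgME p q) (malgMEw (fsubset_refl _) (msuppZ_le c q)) scaler_sumr.
apply: eq_bigr => u _; rewrite scaler_sumr; apply: eq_bigr => v _.
apply/malgP => w; rewrite mcoeffZ [in LHS]mcoeffU [in RHS]mcoeffU mcoeffZ.
by rewrite mulrnAr mulrCA.
Qed.

Definition var : 'I_n -> F := locked (fun i => << fmu i >>).

Lemma varE i : var i = << fmu i >>.
Proof. by rewrite /var -lock. Qed.

Definition homogeneous (d : nat) (p : F) : Prop :=
  forall w, w \in msupp p -> fdeg w = d.

Definition const_coef (p : F) : k := mcoeff (mone : {fmonom 'I_n}) p.

Lemma const_coefD p q : const_coef (p + q) = const_coef p + const_coef q.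
Proof. exact: mcoeffD. Qed.
Lemma const_coefB p q : const_coef (p - q) = const_coef p - const_coef q.
Proof. exact: mcoeffB. Qed.
Lemma const_coefZ c p : const_coef (c *: p) = c * const_coef p.
Proof. exact: mcoeffZ. Qed.
Lemma const_coefM p q : const_coef (p * q) = const_coef p * const_coef q.
Proof. exact: (mcoeff1g_is_multiplicative _ _).1. Qed.
End FreeAlgebra.

Arguments var {k n} i.

Section PresentedAlgebra.
Variables (k : fieldType) (n : nat).
Local Notation F := (freealg k n).

(* Relations without constant term, so that the quotient is nontrivial. *)
Record presentation := Presentation {
  rels :> seq F;
  rels_const : all (fun r => const_coef r == 0) rels
}.

Definition ideal_closed (S : {pred F}) : Prop :=
  GRing.submod_closed S /\
  forall x y, y \in S -> x * y \in S /\ y * x \in S.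

Variable P : presentation.

Definition ideal_gen : {pred F} := fun x =>
  `[< forall S : {pred F}, ideal_closed S ->
        (forall r, r \in rels P -> r \in S) -> x \in S >].

Lemma ideal_gen_submod : GRing.submod_closed ideal_gen.
Proof.
split=> [|a x y /asboolP Hx /asboolP Hy]; apply/asboolP => S SI PS.
  by case: SI => -[].
by case: (SI) => -[_ SL] _; apply: SL; [apply: Hx | apply: Hy].
Qed.

Lemma ideal_genMl x y : y \in ideal_gen -> x * y \in ideal_gen.
Proof.
move=> /asboolP H; apply/asboolP => S SI PS.
exact: (SI.2 x y (H S SI PS)).1.
Qed.

Lemma ideal_genMr x y : y \in ideal_gen -> y * x \in ideal_gen.
Proof.
move=> /asboolP H; apply/asboolP => S SI PS.
exact: (SI.2 x y (H S SI PS)).2.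
Qed.

Lemma mem_ideal_gen r : r \in rels P -> r \in ideal_gen.
Proof. by move=> rP; apply/asboolP => S _; apply. Qed.

Lemma ideal_gen_const x : x \in ideal_gen -> const_coef x = 0.
Proof.
move=> /asboolP /(_ (fun p => const_coef p == 0)) H; apply/eqP/H; last first.
  exact/allP/rels_const.
split; first split.
- by apply/eqP; exact: raddf0.
- move=> c p q /eqP p0 /eqP q0; apply/eqP.
  by rewrite const_coefD const_coefZ p0 q0 mulr0 addr0.
move=> p q /eqP q0; split; apply/eqP; rewrite const_coefM q0.
  by rewrite mulr0.
by rewrite mul0r.
Qed.

Definition presalg := quotmod ideal_gen_submod.

HB.instance Definition _ := GRing.Lmodule.on presalg.

Definition pia : F -> presalg := qpi ideal_gen_submod.

HB.instance Definition _ := GRing.Linear.on pia.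

Lemma pia_eq x y : (pia x = pia y) <-> (x - y \in ideal_gen).
Proof. exact: qpi_eq. Qed.

Lemma pia_surj (q : presalg) : exists x, q = pia x.
Proof. exact: qpi_surj. Qed.

Lemma pia_repr (q : presalg) : pia (repr q) = q.
Proof. by rewrite /pia /qpi reprK. Qed.

Definition pmul : presalg -> presalg -> presalg :=
  locked (fun p q => pia (repr p * repr q)).

Lemma pmulE x y : pmul (pia x) (pia y) = pia (x * y).
Proof.
rewrite /pmul -lock; apply/pia_eq; set x' := repr _; set y' := repr _.
have -> : x' * y' - x * y = x' * (y' - y) + (x' - x) * y.
  by rewrite mulrBr mulrBl addrA subrK.
have [_ L] := ideal_gen_submod; rewrite -[x' * _]scale1r; apply: L.
  by apply: ideal_genMl; apply/pia_eq; rewrite pia_repr.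
by apply: ideal_genMr; apply/pia_eq; rewrite pia_repr.
Qed.

Fact pmulA : associative pmul.
Proof.
move=> p q r; have [x ->] := pia_surj p; have [y ->] := pia_surj q.
by have [z ->] := pia_surj r; rewrite !pmulE mulrA.
Qed.
Fact pmul1l : left_id (pia 1) pmul.
Proof. by move=> p; have [x ->] := pia_surj p; rewrite pmulE mul1r. Qed.
Fact pmul1r : right_id (pia 1) pmul.
Proof. by move=> p; have [x ->] := pia_surj p; rewrite pmulE mulr1. Qed.
Fact pmulDl : left_distributive pmul +%R.
Proof.
move=> p q r; have [x ->] := pia_surj p; have [y ->] := pia_surj q.
by have [z ->] := pia_surj r; rewrite -raddfD !pmulE mulrDl raddfD.
Qed.
Fact pmulDr : right_distributive pmul +%R.
Proof.
move=> p q r; have [x ->] := pia_surj p; have [y ->] := pia_surj q.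
by have [z ->] := pia_surj r; rewrite -raddfD !pmulE mulrDr raddfD.
Qed.
Fact pone_neq0 : pia 1 != 0.
Proof.
apply/eqP; rewrite -(raddf0 pia) => /pia_eq; rewrite subr0 => /ideal_gen_const.
by rewrite /const_coef rmorph1 => /eqP; rewrite oner_eq0.
Qed.

HB.instance Definition _ := GRing.Zmodule_isNzRing.Build presalg
  pmulA pmul1l pmul1r pmulDl pmulDr pone_neq0.

Lemma piaM : {morph pia : x y / x * y}.
Proof. by move=> x y; rewrite -pmulE. Qed.

Fact pscaleAl (c : k) (p q : presalg) : c *: (p * q) = c *: p * q.
Proof.
have [x ->] := pia_surj p; have [y ->] := pia_surj q.
by rewrite -piaM -!linearZ -piaM /= scalerAl.
Qed.

HB.instance Definition _ := GRing.Lmodule_isLalgebra.Build k presalg pscaleAl.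

Fact pscaleAr (c : k) (p q : presalg) : c *: (p * q) = p * (c *: q).
Proof.
have [x ->] := pia_surj p; have [y ->] := pia_surj q.
by rewrite -piaM -!linearZ -piaM /= freealg_scalerAr.
Qed.

HB.instance Definition _ := GRing.Lalgebra_isAlgebra.Build k presalg pscaleAr.

HB.instance Definition _ :=
  GRing.isMonoidMorphism.Build F presalg pia (conj erefl piaM).

Definition pgen (i : 'I_n) : presalg := pia (var i).
End PresentedAlgebra.

Section Action.
Variables (k : fieldType) (n : nat) (V : lmodType k).
Variable f : 'I_n -> {linear V -> V}.

Definition fact (p : freealg k n) (v : V) : V :=
  \sum_(w <- msupp p) p@_w *: foldr (fun i => f i) v w.

Lemma factEw (d : {fset {fmonom 'I_n}}) p v : (msupp p `<=` d)%fset ->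
  fact p v = \sum_(w <- d) p@_w *: foldr (fun i => f i) v w.
Proof.
move=> le; rewrite /fact (big_fset_incl _ le) //= => x _ /mcoeff_outdom ->.
by rewrite scale0r.
Qed.

Lemma factU c w v : fact << c *g w >> v = c *: foldr (fun i => f i) v w.
Proof. by rewrite (factEw _ msuppU_le) big_seq_fset1 mcoeffUU. Qed.

Lemma factDl p q v : fact (p + q) v = fact p v + fact q v.
Proof.
rewrite (factEw _ (msuppD_le p q)) (factEw _ (fsubsetUl (msupp p) (msupp q))).
rewrite (factEw _ (fsubsetUr (msupp p) (msupp q))) -big_split /=.
by apply: eq_bigr => w _; rewrite mcoeffD scalerDl.
Qed.

Lemma fact0l v : fact 0 v = 0.
Proof. by rewrite /fact msupp0 big_seq_fset0. Qed.

Lemma factNl p v : fact (- p) v = - fact p v.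
Proof. by apply: (addrI (fact p v)); rewrite -factDl !subrr fact0l. Qed.

Lemma factZl c p v : fact (c *: p) v = c *: fact p v.
Proof.
rewrite (factEw _ (msuppZ_le c p)) /fact scaler_sumr.
by apply: eq_bigr => w _; rewrite mcoeffZ scalerA.
Qed.

Lemma word_linear (w : seq 'I_n) : linear (fun v => foldr (fun i => f i) v w).
Proof. by move=> c u v; elim: w => //= i w ->; rewrite linearP. Qed.

Lemma fact_linear p : linear (fact p).
Proof.
move=> c u v; rewrite /fact scaler_sumr -big_split /=.
apply: eq_bigr => w _; rewrite word_linear scalerDr !scalerA.
by rewrite [c * _]mulrC.
Qed.

Lemma fact1 v : fact 1 v = v.
Proof. by rewrite [LHS](factU 1 mone) scale1r fm1. Qed.

Lemma fact_var i v : fact (var i) v = f i v.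
Proof. by rewrite varE factU scale1r fmU. Qed.

Lemma fact_sum (I : Type) (r : seq I) (F : I -> freealg k n) v :
  fact (\sum_(i <- r) F i) v = \sum_(i <- r) fact (F i) v.
Proof.
by apply: (big_morph (fun p => fact p v)) => [p q|]; rewrite ?factDl ?fact0l.
Qed.

Lemma factM p q v : fact (p * q) v = fact p (fact q v).
Proof.
rewrite malgME fact_sum /fact; apply: eq_bigr => u _.
rewrite -/(fact _ v) fact_sum.
pose g x := p@_u *: foldr (fun i => f i) x u.
have gD x y : g (x + y) = g x + g y.
  by rewrite /g -[x]scale1r word_linear !scale1r scalerDr.
have g0 : g 0 = 0 by apply: (addrI (g 0)); rewrite -gD !addr0.
rewrite -/(g (fact q v)) /fact (big_morph g gD g0).
apply: eq_bigr => w _; rewrite -/(fact _ v) factU fmM foldr_cat /g.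
have := word_linear u (q@_w) (foldr (fun i => f i) v w) 0.
rewrite !addr0 => ->.
have E0 : foldr (fun i => f i) 0 u = 0.
  by elim: (u : seq 'I_n) => //= i s ->; rewrite raddf0.
by rewrite E0 addr0 scalerA.
Qed.

Lemma fact_var2 i j v : fact (var i * var j) v = f i (f j v).
Proof. by rewrite factM !fact_var. Qed.

Lemma fact_comm i j v :
  fact (var i * var j - var j * var i) v = f i (f j v) - f j (f i v).
Proof.
rewrite factDl factNl.
exact: (f_equal2 (fun a b => a - b) (fact_var2 i j v) (fact_var2 j i v)).
Qed.

Lemma fact_anticomm i j l m v :
  fact (var i * var j + var j * var i - var l * var m) v =
  f i (f j v) + f j (f i v) - f l (f m v).
Proof.
rewrite 2!factDl factNl.
exact: (f_equal2 (fun a b => a - b)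
  (f_equal2 +%R (fact_var2 i j v) (fact_var2 j i v)) (fact_var2 l m v)).
Qed.

Variable P : presentation k n.
Hypothesis fP : forall r v, r \in rels P -> fact r v = 0.

Lemma fact_ideal p v : p \in ideal_gen P -> fact p v = 0.
Proof.
move=> /asboolP /(_ (fun p => `[< forall v, fact p v = 0 >])) H.
suff /asboolP : p \in (fun p => `[< forall v, fact p v = 0 >]) by [].
apply: H => [|r rP]; last by apply/asboolP => u; apply: fP.
split; first split.
- by apply/asboolP => u; rewrite fact0l.
- move=> c x y /asboolP Hx /asboolP Hy; apply/asboolP => u.
  by rewrite factDl factZl Hx Hy scaler0 addr0.
move=> x y /asboolP Hy; split; apply/asboolP => u; rewrite factM Hy //.
rewrite /fact big1 // => w _.
suff -> : foldr (fun i => f i) 0 w = 0 by rewrite scaler0.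
by elim: (w : seq 'I_n) => //= i s ->; rewrite raddf0.
Qed.

Definition actmod of (forall r v, r \in rels P -> fact r v = 0) : Type := V.
Local Notation W := (actmod fP).

HB.instance Definition _ := GRing.Zmodule.on W.

Definition pact : presalg P -> W -> W := locked (fun q v => fact (repr q) v).

Lemma pactE p v : pact (pia P p) v = fact p v.
Proof.
rewrite /pact -lock.
apply/eqP; rewrite -subr_eq0 -factNl -factDl; apply/eqP/fact_ideal.
by apply/pia_eq; rewrite pia_repr.
Qed.

Fact pactA a b v : pact a (pact b v) = pact (a * b) v.
Proof.
have [x ->] := pia_surj a; have [y ->] := pia_surj b.
by rewrite -piaM !pactE factM.
Qed.
Fact pact1 : left_id 1 pact.
Proof. by move=> v; rewrite -[1]/(pia P 1) pactE fact1. Qed.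
Fact pactDr : right_distributive pact +%R.
Proof.
by move=> a u v; rewrite /pact -lock; have := fact_linear (repr a) 1 u v;
  rewrite !scale1r.
Qed.
Fact pactDl v : {morph pact^~ v : a b / a + b}.
Proof.
move=> a b; have [x ->] := pia_surj a; have [y ->] := pia_surj b.
by rewrite -raddfD !pactE factDl.
Qed.

HB.instance Definition _ := GRing.Zmodule_isLmodule.Build (presalg P) W
  pactA pact1 pactDr pactDl.
End Action.

Section RestrictScalars.
Variables (k : fieldType) (A : algType k) (M : lmodType A).

Definition restrict_scalars : Type := M.
Local Notation V := restrict_scalars.

HB.instance Definition _ := GRing.Zmodule.on V.

Definition rscale (c : k) (m : V) : V := (c%:A : A) *: (m : M).

Fact rscaleA a b m : rscale a (rscale b m) = rscale (a * b) m.
Proof. by rewrite /rscale scalerA mulr_algl scalerA. Qed.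
Fact rscale1 : left_id 1 rscale.
Proof. by move=> m; rewrite /rscale scale1r scale1r. Qed.
Fact rscaleDr : right_distributive rscale +%R.
Proof. by move=> c u v; rewrite /rscale scalerDr. Qed.
Fact rscaleDl m : {morph rscale^~ m : a b / a + b}.
Proof. by move=> a b; rewrite /rscale !scalerDl. Qed.

HB.instance Definition _ := GRing.Zmodule_isLmodule.Build k V
  rscaleA rscale1 rscaleDr rscaleDl.
End RestrictScalars.

Definition o1 : 'I_3 := @Ordinal 3 0 isT.
Definition o2 : 'I_3 := @Ordinal 3 1 isT.
Definition o3 : 'I_3 := @Ordinal 3 2 isT.

(* The generators of H are indexed by 'I_4; a_4 has index ord_max. *)
Definition emb (i : 'I_3) : 'I_4 := lift ord_max i.

Section ColorLie.
Variable k : fieldType.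

Definition sl2c : Type := 'rV[k]_3.
HB.instance Definition _ := Vector.on sl2c.

Definition ga (i : 'I_3) : sl2c := delta_mx 0 i.

Definition bracket (x y : sl2c) : sl2c :=
  let c (i : 'I_3) := x 0 i in let d (i : 'I_3) := y 0 i in
  (c o1 * d o2 + c o2 * d o1) *: ga o3 +
  (c o2 * d o3 + c o3 * d o2) *: ga o1 +
  (c o3 * d o1 + c o1 * d o3) *: ga o2.

Definition is_subalgebra (h : {vspace sl2c}) : Prop :=
  forall x y, x \in h -> y \in h -> bracket x y \in h.

Lemma const_var n i : const_coef (var i : freealg k n) = 0.
Proof. by rewrite varE /const_coef mcoeffU fmP fmU fm1. Qed.

Lemma const_varM n (i j : 'I_n) : const_coef (var i * var j : freealg k n) = 0.
Proof. by rewrite const_coefM const_var mul0r. Qed.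

Lemma const_add2 n (p q : freealg k n) :
  const_coef p = 0 -> const_coef q = 0 -> const_coef (p - q) == 0.
Proof. by move=> p0 q0; rewrite const_coefB p0 q0 subr0. Qed.

Lemma const_add3 n (p q r : freealg k n) : const_coef p = 0 ->
  const_coef q = 0 -> const_coef r = 0 -> const_coef (p + q - r) == 0.
Proof. by move=> p0 q0 r0; rewrite const_coefB const_coefD p0 q0 r0 addr0 subr0. Qed.

Definition relsU : seq (freealg k 3) :=
  [:: var o1 * var o2 + var o2 * var o1 - var o3;
      var o2 * var o3 + var o3 * var o2 - var o1;
      var o3 * var o1 + var o1 * var o3 - var o2].

Fact relsU_const : all (fun r => const_coef r == 0) relsU.
Proof.
by apply/and4P; split=> //; apply: const_add3; solve [exact: const_varM | exact: const_var].
Qed.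

Definition presU := Presentation relsU_const.

Local Notation U := (presalg presU).

Definition ua (i : 'I_3) : U := pgen presU i.

Lemma ua12 : ua o1 * ua o2 + ua o2 * ua o1 = ua o3.
Proof.
rewrite -!piaM -raddfD; apply/pia_eq/mem_ideal_gen.
exact: mem_head.
Qed.

Lemma ua23 : ua o2 * ua o3 + ua o3 * ua o2 = ua o1.
Proof.
rewrite -!piaM -raddfD; apply/pia_eq/mem_ideal_gen.
exact/mem_behead/mem_head.
Qed.

Lemma ua31 : ua o3 * ua o1 + ua o1 * ua o3 = ua o2.
Proof.
rewrite -!piaM -raddfD; apply/pia_eq/mem_ideal_gen.
exact/mem_behead/mem_behead/mem_head.
Qed.

Definition relsH : seq (freealg k 4) :=
  let a1 := var (emb o1) in let a2 := var (emb o2) in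
  let a3 := var (emb o3) in let a4 := var ord_max in
  [:: a1 * a2 + a2 * a1 - a3 * a4;
      a2 * a3 + a3 * a2 - a1 * a4;
      a3 * a1 + a1 * a3 - a2 * a4;
      a1 * a4 - a4 * a1;
      a2 * a4 - a4 * a2;
      a3 * a4 - a4 * a3].

Fact relsH_const : all (fun r => const_coef r == 0) relsH.
Proof.
do 3! [apply/andP; split; first by apply: const_add3; exact: const_varM].
by do 3! [apply/andP; split; first by apply: const_add2; exact: const_varM].
Qed.

Definition presH := Presentation relsH_const.

Local Notation H := (presalg presH).

Definition ha (i : 'I_4) : H := pgen presH i.

Definition Hdeg (d : nat) (x : H) : Prop :=
  exists2 p : freealg k 4, homogeneous d p & x = pia presH p.

Definition iota (x : sl2c) : U := \sum_i x 0 i *: ua i.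

Section Induced.
Variable h : {vspace sl2c}.

Definition Uh_pred : {pred U} := fun u =>
  `[< forall S : {pred U}, GRing.subalg_closed S ->
        (forall x, x \in h -> iota x \in S) -> u \in S >].

Lemma Uh_pred_closed : GRing.subalg_closed Uh_pred.
Proof.
split=> [|a x y /asboolP Hx /asboolP Hy|x y /asboolP Hx /asboolP Hy];
  apply/asboolP => S SS hS; case: (SS) => // S1 SL SM.
  by apply: SL; [apply: Hx | apply: Hy].
by apply: SM; [apply: Hx | apply: Hy].
Qed.

Lemma iota_Uh x : x \in h -> iota x \in Uh_pred.
Proof. by move=> xh; apply/asboolP => S _; apply. Qed.

Record Uh := MkUh { Uh_val :> U; _ : Uh_val \in Uh_pred }.
HB.instance Definition _ := [isSub for Uh_val].
HB.instance Definition _ := [Choice of Uh by <:].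
HB.instance Definition _ :=
  GRing.SubChoice_isSubAlgebra.Build k U Uh_pred Uh Uh_pred_closed.

Definition iota_h (x : subvs_of h) : Uh := MkUh (iota_Uh (subvsP x)).

(* A U(h)-module structure on k is an algebra morphism chi : U(h) -> k. *)
Definition kmod of {lrmorphism Uh -> k^o} : Type := k.

Section KMod.
Variable chi : {lrmorphism Uh -> k^o}.

HB.instance Definition _ := GRing.Zmodule.on (kmod chi).

Definition kscale (b : Uh) (y : kmod chi) : kmod chi := (chi b : k) * (y : k).

Fact kscaleA a b y : kscale a (kscale b y) = kscale (a * b) y.
Proof. by rewrite /kscale rmorphM mulrA. Qed.
Fact kscale1 : left_id 1 kscale.
Proof. by move=> y; rewrite /kscale rmorph1 mul1r. Qed.
Fact kscaleDr : right_distributive kscale +%R.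
Proof. by move=> a x y; rewrite /kscale mulrDr. Qed.
Fact kscaleDl y : {morph kscale^~ y : a b / a + b}.
Proof. by move=> a b; rewrite /kscale rmorphD mulrDl. Qed.

HB.instance Definition _ := GRing.Zmodule_isLmodule.Build Uh (kmod chi)
  kscaleA kscale1 kscaleDr kscaleDl.
End KMod.

Variable phi : 'Hom(subvs_of h, k^o).

Definition defines_module : Prop :=
  exists chi : {lrmorphism Uh -> k^o}, forall x, chi (iota_h x) = phi x.

Definition kphi (D : defines_module) : Type := kmod (projT1 (cid D)).
HB.instance Definition _ (D : defines_module) := GRing.Lmodule.on (kphi D).

End Induced.
End ColorLie.

Notation Ug k := (presalg (presU k)).
Notation Hg k := (presalg (presH k)).

Notation induced D := (tensor (val : Uh _ -> Ug _) (kphi D)).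

Section Homogenization.
Variable k : fieldType.
Local Notation U := (Ug k).
Local Notation H := (Hg k).

Definition gpow (i : nat) (u : U) : Prop :=
  exists s : seq (k * i.-tuple (sl2c k)),
    u = \sum_(t <- s) t.1 *: \prod_(y <- t.2) iota y.

Fixpoint Ufilt (i : nat) : U -> Prop :=
  if i is j.+1 then fun u => exists x y, [/\ Ufilt j x, gpow j.+1 y & u = x + y]
  else fun u => exists c : k, u = c%:A.

Lemma gpow0 i : gpow i 0.
Proof. by exists [::]; rewrite big_nil. Qed.

Lemma gpowZD i c x y : gpow i x -> gpow i y -> gpow i (c *: x + y).
Proof.
move=> [s ->] [t ->]; exists ([seq (c * u.1, u.2) | u <- s] ++ t).
rewrite big_cat big_map scaler_sumr; congr (_ + _).
by apply: eq_bigr => u _; rewrite scalerA.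
Qed.

Lemma gpowMl i a x : gpow i x -> gpow i.+1 (iota a * x).
Proof.
move=> [s ->]; exists [seq (u.1, cons_tuple a u.2) | u <- s].
rewrite big_map mulr_sumr; apply: eq_bigr => u _ /=.
by rewrite big_cons scalerAr.
Qed.

Lemma Ufilt_linear i c x y : Ufilt i x -> Ufilt i y -> Ufilt i (c *: x + y).
Proof.
elim: i x y => [|i IH] x y.
  by move=> [a ->] [b ->]; exists (c * a + b); rewrite scalerDl scalerA.
move=> [x1 [x2 [Hx1 Hx2 ->]]] [y1 [y2 [Hy1 Hy2 ->]]].
exists (c *: x1 + y1), (c *: x2 + y2); split; [exact: IH|exact: gpowZD|].
by rewrite scalerDr addrACA.
Qed.

Lemma Ufilt0 i : Ufilt i 0.
Proof.
elim: i => [|i IH]; first by exists 0; rewrite scale0r.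
by exists 0, 0; split; rewrite ?addr0 //; exact: gpow0.
Qed.

Lemma UfiltS i x : Ufilt i x -> Ufilt i.+1 x.
Proof. by move=> Hx; exists x, 0; rewrite addr0; split=> //; exact: gpow0. Qed.

Lemma UfiltMl i a x : Ufilt i x -> Ufilt i.+1 (iota a * x).
Proof.
elim: i x => [|i IH] x.
  move=> [c ->]; exists 0, (c *: iota a); split; first exact: Ufilt0.
    exists [:: (c, [tuple a])]; by rewrite big_seq1 /= big_seq1.
  by rewrite add0r mulr_algr.
move=> [x1 [x2 [Hx1 Hx2 ->]]]; exists (iota a * x1), (iota a * x2).
by split; [exact: IH|exact: gpowMl|rewrite mulrDr].
Qed.

Lemma iota_ga i : iota (ga k i) = ua k i.
Proof.
rewrite /iota (bigD1 i) //= big1 ?addr0 => [|j ji].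
  by rewrite /ga mxE !eqxx scale1r.
by rewrite /ga mxE (negPf ji) scale0r.
Qed.

(* A sequence F in M stands for the formal sum of the (F i) a_4^i; hop is the
   action of the generators of H on such sums. *)
Section Sequences.
Variable M : lmodType U.
Local Notation V := (nat -> restrict_scalars M).

Definition hop (t : 'I_4) (F : V) : V := fun i =>
  if i is j.+1 then
    if unlift ord_max t is Some s then (ua k s : U) *: (F j : M) else F j
  else 0.

Fact hop_linear t : linear (hop t).
Proof.
move=> c F G; apply: funext => -[|i] /=; first by rewrite !fctE /= scaler0 addr0.
rewrite !fctE /=; case: (unlift ord_max t) => // s.
rewrite scalerDr; congr (_ + _).
by rewrite [LHS]scalerA [RHS]scalerA mulr_algr mulr_algl.
Qed.

HB.instance Definition _ t := GRing.isLinear.Build k V V _ (hop t) (hop_linear t).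

Definition hopl (t : 'I_4) : {linear V -> V} := hop t.

Lemma hop0 t F : hopl t F 0%N = 0. Proof. by []. Qed.

Lemma hop_emb s (F : V) i : hopl (emb s) F i.+1 = (ua k s : U) *: (F i : M).
Proof. by rewrite /hopl /= /hop /emb liftK. Qed.

Lemma hop_max (F : V) i : hopl ord_max F i.+1 = F i.
Proof. by rewrite /hopl /= /hop unlift_none. Qed.

Let hop_comm (s : 'I_3) (F : V) :
  fact hopl (var (emb s) * var ord_max - var ord_max * var (emb s)) F
  = 0.
Proof.
rewrite fact_comm; apply/eqP; rewrite subr_eq0; apply/eqP.
apply: funext => -[|[|i]] //; first by rewrite hop_emb hop_max !hop0 scaler0.
by rewrite hop_emb !hop_max hop_emb.
Qed.

Let hop_anti (r s t : 'I_3) (F : V) : ua k r * ua k s + ua k s * ua k r = ua k t ->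
  fact hopl (var (emb r) * var (emb s) + var (emb s) * var (emb r)
    - var (emb t) * var ord_max) F = 0.
Proof.
move=> E; rewrite fact_anticomm.
apply/eqP; rewrite subr_eq0; apply/eqP; apply: funext => -[|[|i]].
- exact: addr0.
- change (hopl (emb r) (hopl (emb s) F) 1%N + hopl (emb s) (hopl (emb r) F) 1%N
    = hopl (emb t) (hopl ord_max F) 1%N).
  by rewrite !hop_emb !hop0 !scaler0 addr0.
change (hopl (emb r) (hopl (emb s) F) i.+2 + hopl (emb s) (hopl (emb r) F) i.+2
  = hopl (emb t) (hopl ord_max F) i.+2).
by rewrite !hop_emb hop_max -E scalerDl !scalerA.
Qed.

Fact hop_rel r (F : V) : r \in rels (presH k) -> fact hopl r F = 0.
Proof.
rewrite !inE => /orP[/eqP->|/orP[/eqP->|/orP[/eqP->|/orP[/eqP->|/orP[/eqP->|/eqP->]]]]].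
- exact/hop_anti/ua12.
- exact/hop_anti/ua23.
- exact/hop_anti/ua31.
- exact: hop_comm.
- exact: hop_comm.
exact: hop_comm.
Qed.

Definition seqmod := actmod hop_rel.
HB.instance Definition _ := GRing.Lmodule.on seqmod.

Lemma ha_seqmod t (F : seqmod) : ha k t *: F = hop t F.
Proof. by rewrite [LHS]pactE fact_var. Qed.

Lemma seqmod_stable (P : V -> Prop) :
  P 0 -> (forall c F G, P F -> P G -> P (c *: F + G)) ->
  (forall t F, P F -> P (hop t F)) ->
  forall (x : H) (F : seqmod), P F -> P (x *: F).
Proof.
move=> P0 PL Ph x F PF; have [p ->] := pia_surj x.
rewrite [_ *: _]pactE /fact; apply: big_ind => // [f g Pf Pg|w _].
  by rewrite -[f]scale1r; apply: PL.
rewrite -[_ *: _]addr0; apply: PL => //.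
by elim: (w : seq 'I_4) => //= i s; apply: Ph.
Qed.
End Sequences.

Section HM.
Variables (h : {vspace sl2c k}) (phi : 'Hom(subvs_of h, k^o)).
Variable D : defines_module phi.
Local Notation M := (induced D).

Definition Mfilt (i : nat) (m : M) : Prop :=
  exists2 u : U, Ufilt i u & m = tens (val : Uh h -> U) u ((1 : k) : kphi D).

Lemma Mfilt_linear i (c : k) m m' :
  Mfilt i m -> Mfilt i m' -> Mfilt i ((c%:A : U) *: m + m').
Proof.
move=> [u Hu ->] [v Hv ->]; exists (c *: u + v); first exact: Ufilt_linear.
by rewrite tensDl tensZ mulr_algl.
Qed.

Lemma tens0l (y : kphi D) : tens (val : Uh h -> U) 0 y = 0.
Proof.
apply: (addrI (tens (val : Uh h -> U) 0 y)).
by rewrite -tensDl !addr0.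
Qed.

Lemma Mfilt0 i : Mfilt i 0.
Proof. by exists 0; rewrite ?tens0l //; exact: Ufilt0. Qed.

Lemma MfiltS i m : Mfilt i m -> Mfilt i.+1 m.
Proof. by move=> [u Hu ->]; exists u => //; exact: UfiltS. Qed.

Lemma MfiltM i t m : Mfilt i m -> Mfilt i.+1 (ua k t *: m).
Proof.
move=> [u Hu ->]; exists (ua k t * u); last by rewrite tensZ.
by rewrite -iota_ga; exact: UfiltMl.
Qed.

(* F stands for the sum of the (F i) a_4^i, so this is the sum of the M_i a_4^i. *)
Definition HM_prop (F : nat -> M) : Prop :=
  (forall i, Mfilt i (F i)) /\ (exists N, forall i, (N <= i)%N -> F i = 0).

Definition HM_pred : {pred seqmod M} := fun F => `[< HM_prop F >].

Lemma HM_pred_closed : GRing.submod_closed HM_pred.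
Proof.
have P0 : HM_prop 0 by split=> [i|]; [exact: Mfilt0 | exists 0%N].
have PL (c : k) (F G : nat -> restrict_scalars M) :
    HM_prop F -> HM_prop G -> HM_prop (c *: F + G).
  move=> [FM [m F0]] [GM [n G0]]; split=> [i|].
    exact: (@Mfilt_linear i c (F i) (G i)).
  exists (maxn m n) => i; rewrite geq_max => /andP[mi ni].
  transitivity (c *: F i + G i) => //.
  by rewrite F0 // G0 // addr0 scaler0.
have Ph t F : HM_prop F -> HM_prop (hop t F).
  move=> [FM [m F0]]; split=> [[|i]|]; first exact: Mfilt0.
    rewrite /hop; case: (unlift _ _) => [s|]; [exact: MfiltM | exact: MfiltS].
  exists m.+1 => -[|i] // mi; rewrite /hop; case: (unlift _ _) => [s|].
    by rewrite F0 // scaler0.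
  by rewrite F0.
split=> [|x F G /asboolP HF /asboolP HG]; apply/asboolP => //.
have := PL 1 _ _ (seqmod_stable P0 PL Ph x HF) HG.
by rewrite scale1r.
Qed.

Record HM := MkHM { HM_val :> seqmod M; _ : HM_val \in HM_pred }.
HB.instance Definition _ := [isSub for HM_val].
HB.instance Definition _ := [Choice of HM by <:].
HB.instance Definition _ :=
  GRing.SubChoice_isSubLmodule.Build H (seqmod M) HM_pred HM HM_pred_closed.
End HM.

Record grmod := GrMod {
  gr_sort :> lmodType H;
  gr_comp : nat -> gr_sort -> Prop
}.

Definition is_graded (N : grmod) : Prop :=
  [/\ (forall d, gr_comp d (0 : N) /\
         forall x y : N, gr_comp d x -> gr_comp d y -> gr_comp d (x - y)),
      (forall i j (a : H) (x : N), Hdeg i a -> gr_comp j x ->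
         gr_comp (i + j) (a *: x)),
      (forall x : N, exists n (f : 'I_n -> N),
         (forall i : 'I_n, gr_comp i (f i)) /\ x = \sum_i f i) &
      (forall n (f : 'I_n -> N), (forall i : 'I_n, gr_comp i (f i)) ->
         \sum_i f i = 0 -> forall i, f i = 0)].

Definition gr_iso (N N' : grmod) : Prop :=
  exists f : {linear N -> N'},
    bijective f /\ forall d x, gr_comp d x <-> gr_comp d (f x).

Definition gr_cyclic (N : grmod) : Prop :=
  exists d (v : N), gr_comp d v /\ forall x, exists a : H, x = a *: v.

Definition has_dim (N : lmodType H) (P : N -> Prop) (d : nat) : Prop :=
  exists b : 'I_d -> N, (forall i, P (b i)) /\
    forall x, P x -> exists! c : 'rV[k]_d, x = \sum_i ((c 0 i)%:A : H) *: b i.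

Definition hilbert_series (N : grmod) (s : nat -> nat) : Prop :=
  forall d, has_dim (@gr_comp N d) (s d).

(* s is the coefficient sequence of 1/(1-x)^2 as a formal power series *)
Definition inv_1mX_sq (s : nat -> nat) : Prop :=
  forall n, \sum_(i < n.+1) (((1 - 'X) ^+ 2 : {poly int})`_i * (s (n - i)%N)%:Z)
    = (n == 0)%:Z.

Definition line_module (N : grmod) : Prop :=
  [/\ is_graded N, gr_cyclic N &
      exists2 s, inv_1mX_sq s & hilbert_series N s].

Definition torsion (t : 'I_4) (N : lmodType H) : Prop :=
  exists2 x : N, x != 0 & ha k t *: x = 0.

Section LineQuotient.
Variables u v : H.

Definition left_ideal2 : {pred H^o} := fun x =>
  `[< exists a b : H, x = a * u + b * v >].

Lemma left_ideal2_closed : GRing.submod_closed left_ideal2.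
Proof.
split=> [|c x y /asboolP[a [b ->]] /asboolP[a' [b' ->]]]; apply/asboolP.
  by exists 0, 0; rewrite !mul0r addr0.
exists (c * a + a'), (c * b + b').
by rewrite [_ *: _]mulrDr !mulrA addrACA -!mulrDl.
Qed.

Definition line_quotient : grmod := @GrMod (quotmod left_ideal2_closed)
  (fun d q => exists2 x : H, Hdeg d x & q = qpi left_ideal2_closed x).
End LineQuotient.

Definition homogenization (h : {vspace sl2c k}) (phi : 'Hom(subvs_of h, k^o))
    (D : defines_module phi) : grmod :=
  @GrMod (HM D) (fun d F => forall i, i != d -> HM_val F i = 0).

(* Linear forms (elements of H_1) and points are given by coordinates with
   respect to a_1, ..., a_4 and the dual basis. *)
Definition vec4 (c1 c2 c3 c4 : k) : 'rV[k]_4 :=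
  \row_(i < 4) [:: c1; c2; c3; c4]`_i.

Definition form (u : 'rV[k]_4) : H := \sum_i u 0 i *: ha k i.

Definition vanishes (u p : 'rV[k]_4) : Prop := \sum_i u 0 i * p 0 i = 0.

(* The line V(u, v) lies in the plane V(w) and passes through the point p. *)
Definition line_through (u v w p : 'rV[k]_4) : Prop :=
  (forall q, vanishes u q -> vanishes v q -> vanishes w q) /\
  (vanishes u p /\ vanishes v p).

Definition lines1_3 : seq ('rV[k]_4 * 'rV[k]_4) :=
  [:: (vec4 1 1 0 0, vec4 1 (-1) 0 0);
      (vec4 1 (-1) 0 0, vec4 1 1 0 0);
      (vec4 1 0 1 0, vec4 1 0 (-1) 0);
      (vec4 1 0 (-1) 0, vec4 1 0 1 0);
      (vec4 0 1 1 0, vec4 0 1 (-1) 0);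
      (vec4 0 1 (-1) 0, vec4 0 1 1 0)].

Definition lines4_6 : seq ('rV[k]_4 * 'rV[k]_4) :=
  [:: (vec4 0 0 (- 2%:R) 1, vec4 1 (-1) 0 0);
      (vec4 0 0 2%:R 1, vec4 1 1 0 0);
      (vec4 0 (- 2%:R) 0 1, vec4 1 0 (-1) 0);
      (vec4 0 2%:R 0 1, vec4 1 0 1 0);
      (vec4 (- 2%:R) 0 0 1, vec4 0 1 (-1) 0);
      (vec4 2%:R 0 0 1, vec4 0 1 1 0)].

Definition line_module_of_type (T : seq ('rV[k]_4 * 'rV[k]_4)) (N : grmod) :
    Prop :=
  line_module N /\
  exists u v : 'rV[k]_4, [/\ free [:: u; v],
    exists2 t, t \in T & line_through u v t.1 t.2 &
    gr_iso N (line_quotient (form u) (form v))].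

Definition hpair := {h : {vspace sl2c k} & 'Hom(subvs_of h, k^o)}.

Definition hspace (i j l : 'I_3) (mu : k) : {vspace sl2c k} :=
  (<[ga k i]> + <[ga k j + mu *: ga k l]>)%VS.

(* vsproj is the identity on h *)
Definition ev (p : hpair) (x : sl2c k) : k := projT2 p (vsproj (projT1 p) x).

Definition pair_shape (i j l : 'I_3) (mu : k) (p : hpair) : Prop :=
  [/\ uniq [:: i; j; l], mu = 1 \/ mu = -1 & projT1 p = hspace i j l mu].

Definition pair_a (i j l : 'I_3) (mu : k) (p : hpair) : Prop :=
  pair_shape i j l mu p /\ ev p (ga k j + mu *: ga k l) = 0.

Definition pair_b (i j l : 'I_3) (mu : k) (p : hpair) : Prop :=
  pair_shape i j l mu p /\ ev p (ga k i) = mu / 2%:R.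

Definition inducing (p : hpair) : Prop :=
  [/\ is_subalgebra (projT1 p), \dim (projT1 p) = 2 & defines_module (projT2 p)].

Definition is_homogenization_of_induced (N : grmod) : Prop :=
  exists (p : hpair) (D : defines_module (projT2 p)),
    inducing p /\ gr_iso N (homogenization D).

(* (h, phi) |-> H(U(g) (x)_{U(h)} k_phi) is a one-to-one correspondence between
   the pairs satisfying P and the isomorphism classes of the graded modules
   satisfying Q. *)
Definition one_to_one (P : hpair -> Prop) (Q : grmod -> Prop) : Prop :=
  [/\ forall p, P p -> inducing p,
      forall p (D : defines_module (projT2 p)), P p -> Q (homogenization D),
      forall p p' (D : defines_module (projT2 p))
          (D' : defines_module (projT2 p')),
        P p -> P p' -> gr_iso (homogenization D) (homogenization D') -> p = p' &
      forall N, Q N -> exists p (D : defines_module (projT2 p)),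
        P p /\ gr_iso N (homogenization D)].
End Homogenization.

(* Main.v *)
From HB Require Import structures.
Require Import Defs.
From mathcomp Require Import all_boot all_order all_algebra.
From mathcomp Require Import boolp functions monalg finmap.
From mathcomp Require Import ring zify.

Set Implicit Arguments.
Unset Strict Implicit.
Unset Printing Implicit Defensive.

Import GRing.Theory.
Local Open Scope ring_scope.

(* Sequences and sesquilinear forms come with constants of the same names. *)
Local Notation iota := Defs.iota.
Local Notation form := Defs.form.

(** Let N be a graded H-module, generated by an element e of degree 0, on which
    a_4 acts without torsion and whose components have dimensions 1, 2, 3, ...
    Two independent linear forms kill e.  Modulo a_4 the generators of H
    anticommute, and dim N_2 = 3 then forces one of a_1, a_2, a_3 to act on e as
    a multiple of a_4.  So the two relations can be written
      a_i e = c a_4 e,   a_j e = gam a_4 e - mu a_l e   (line_rel),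
    and a_i a_j + a_j a_i = a_l a_4, applied to e, gives mu^2 = 1 and
    gam (2 c - mu) = 0 (line_rel_exists).  The solutions with gam = 0 are the
    lines of types 1(a)-3(b), those with c = mu / 2 the lines of types
    4(a)-6(b); in both cases (c, gam) are the values of phi on a_i and
    a_j + mu a_l.

    Line modules, quotients H / (H u + H v) and homogenizations are all of the
    form H / ann(e), so comparing them means comparing annihilators
    (generates_iso).  These are computed once, in a model of the induced module:
    polmod is k[X] with a_l acting as multiplication by X, so that X^n stands
    for a_l^n (x) 1, and with a_i + a_j and a_i - a_j acting as f(X) |-> f(1 - X)
    and f(X) |-> f(-1 - X) followed by multiplication by a linear polynomial.
    The condition gam (2 c - mu) = 0 is what makes this a U(g)-module.

    If e satisfies line_rel, an element x of degree d acts on e as the form of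
    degree d in a_l and a_4 read off from the polynomial x 1 (dehom_hspan).
    Hence whatever kills 1 in the model kills e (ann_pol1).  For the converse,
    the forms u and v kill 1 in the case of a quotient; a line module has too
    large components for further relations (line_ann); and the induced module
    maps to the model by 1 (x) 1 |-> 1 (theta_exists, hom1_ann).  That U(h)
    acts on 1 by scalars also shows that phi defines a module
    (pair_defines_module).

    The pair (h, phi) is recovered from the linear forms that kill the generator
    (hom_lin_ann), which gives injectivity; surjectivity onto the given types
    holds because the ideal of a line is spanned by the equation of the plane
    and one more form, which vanishes at the given point (type_forms). *)

(** * Dimension counts *)

Section Dimension.
Variables (k : fieldType) (V : lmodType k) (P : V -> Prop) (d : nat).

Definition spans m (g : 'I_m -> V) : Prop :=
  forall x, P x -> exists r : 'rV[k]_m, x = \sum_i r 0 i *: g i.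

Definition independent m (g : 'I_m -> V) : Prop :=
  forall r : 'rV[k]_m, \sum_i r 0 i *: g i = 0 -> r = 0.

Hypothesis Pdim : exists b : 'I_d -> V, (forall i, P (b i)) /\
  forall x, P x -> exists! c : 'rV[k]_d, x = \sum_i c 0 i *: b i.

Lemma coord_mx m (g : 'I_m -> V) n (b : 'I_n -> V) (r : 'rV[k]_m) (C : 'M_(m, n)) :
  (forall i, g i = \sum_j C i j *: b j) ->
  \sum_i r 0 i *: g i = \sum_j (r *m C) 0 j *: b j.
Proof.
move=> gE; under eq_bigr do rewrite gE scaler_sumr.
rewrite exchange_big; apply: eq_bigr => j _; rewrite mxE scaler_suml.
by apply: eq_bigr => i _; rewrite scalerA.
Qed.

Lemma spans_mx m n (g : 'I_m -> V) (b : 'I_n -> V) :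
  spans g -> (forall i, P (b i)) ->
  exists C : 'M_(n, m), forall i, b i = \sum_j C i j *: g j.
Proof.
move=> gP bP; exists (\matrix_i sval (cid (gP _ (bP i)))) => i.
rewrite {1}(svalP (cid (gP _ (bP i)))); apply: eq_bigr => j _.
by rewrite mxE.
Qed.

(** D C = 1 because the coordinates of b with respect to itself are unique;
    all dimension bounds below come from this identity. *)
Lemma spans_inv m (g : 'I_m -> V) : (forall i, P (g i)) -> spans g ->
  exists (b : 'I_d -> V) (C : 'M_(m, d)) (D : 'M_(d, m)),
    [/\ forall x, P x -> exists! c : 'rV[k]_d, x = \sum_i c 0 i *: b i,
        forall i, g i = \sum_j C i j *: b j & D *m C = 1%:M].
Proof.
move=> gP gS; have [b [bP bU]] := Pdim.
have bS : spans b by move=> x /bU[c [-> _]]; exists c.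
have [C CE] := spans_mx bS gP; have [D DE] := spans_mx gS bP.
exists b, C, D; split=> //; apply/row_matrixP => i.
have [c [_ cU]] := bU _ (bP i).
have b1 : b i = \sum_j (row i (1%:M : 'M[k]_d)) 0 j *: b j.
  rewrite (bigD1 i) //= big1 ?addr0 => [|j ji]; rewrite !mxE ?eqxx ?scale1r //.
  by rewrite eq_sym (negPf ji) scale0r.
rewrite -(cU _ b1); apply/esym/cU; rewrite row_mul -(coord_mx _ CE) DE.
by apply: eq_bigr => j _; rewrite mxE.
Qed.

Lemma spans_dim m (g : 'I_m -> V) : (forall i, P (g i)) -> spans g -> (d <= m)%N.
Proof.
move=> gP gS; have [b [C [D [_ _ DC]]]] := spans_inv gP gS.
exact: mulmx1_min DC.
Qed.

Lemma spans_independent (g : 'I_d -> V) :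
  P 0 -> (forall i, P (g i)) -> spans g -> independent g.
Proof.
move=> P0 gP gS r; have [b [C [D [bU CE DC]]]] := spans_inv gP gS.
rewrite (coord_mx _ CE) => r0; have [c [_ cU]] := bU _ P0.
have rC : r *m C = 0.
  rewrite -(cU _ (esym r0)); apply: cU; rewrite big1 // => j _.
  by rewrite mxE scale0r.
by rewrite -[r]mulmx1 -(mulmx1C DC) mulmxA rC mul0mx.
Qed.

Lemma independent_spans (g : 'I_d -> V) :
  (forall i, P (g i)) -> independent g -> spans g.
Proof.
move=> gP gI; have [b [bP bU]] := Pdim.
have bS : spans b by move=> x /bU[c [-> _]]; exists c.
have [C CE] := spans_mx bS gP.
have Cu : C \in unitmx.
  rewrite -row_free_unit -kermx_eq0; apply/eqP/row_matrixP => i; rewrite row0.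
  apply: gI; rewrite (coord_mx _ CE) -row_mul mulmx_ker big1 // => j _.
  by rewrite !mxE scale0r.
move=> x /bS[r ->]; exists (r *m invmx C).
by rewrite (coord_mx _ CE) mulmxKV.
Qed.
End Dimension.

(** * The grading of H *)

Section Words.
Variables (k : fieldType) (n : nat) (P : presentation k n).
Local Notation A := (presalg P).
Implicit Types (w : seq 'I_n) (x y : A).

Lemma algZ (N : lmodType A) (c : k) x (y : N) : (c *: x) *: y = (c%:A : A) *: (x *: y).
Proof. by rewrite scalerA mulr_algl. Qed.

Lemma algC (N : lmodType A) (c : k) x (y : N) :
  (c%:A : A) *: (x *: y) = x *: ((c%:A : A) *: y).
Proof. by rewrite !scalerA mulr_algl mulr_algr. Qed.

Definition word w : A := \prod_(i <- w) pgen P i.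

Lemma pia_word (u : {fmonom 'I_n}) : pia P << u >> = word u.
Proof.
have E w : pia P << FMonom w >> = word w.
  rewrite /word; elim: w => [|i w IH].
    rewrite big_nil -(rmorph1 (pia P)); congr (pia P << _ >>).
    by apply/val_inj; rewrite /= fm1.
  rewrite big_cons -IH /pgen -piaM varE malgM_def fgmulUU mulr1.
  by congr (pia P << _ >>); apply/val_inj; rewrite /= fmM fmU.
by case: u => w; rewrite E.
Qed.

Lemma piaE (p : freealg k n) : pia P p = \sum_(u <- msupp p) p@_u *: word u.
Proof.
rewrite [in LHS](monalgE p) raddf_sum; apply: eq_bigr => u _.
rewrite -pia_word -linearZ_LR; congr (pia P _).
by apply/malgP => v; rewrite mcoeffZ !mcoeffU; case: eqP; rewrite ?mulr1n ?mulr0n ?mulr1 ?mulr0.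
Qed.

End Words.

Section Degree.
Variable k : fieldType.
Local Notation H := (Hg k).
Local Notation hword := (@word k 4 (presH k)).
Local Notation z := (ha k ord_max).

Lemma Hdeg0 d : Hdeg d (0 : H).
Proof. by exists 0; rewrite ?raddf0 // => w; rewrite msupp0 in_fset0. Qed.

Lemma HdegZD d c (x y : H) : Hdeg d x -> Hdeg d y -> Hdeg d (c *: x + y).
Proof.
move=> [p Hp ->] [q Hq ->]; exists (c *: p + q); last by rewrite linearP.
move=> w /(fsubsetP (msuppD_le _ _)); rewrite in_fsetU => /orP[|/Hq//].
by move=> /(fsubsetP (msuppZ_le _ _))/Hp.
Qed.

Lemma HdegZ d c (x : H) : Hdeg d x -> Hdeg d (c *: x).
Proof. by move=> Hx; rewrite -[_ *: _]addr0; apply: HdegZD => //; exact: Hdeg0. Qed.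

Lemma HdegD d (x y : H) : Hdeg d x -> Hdeg d y -> Hdeg d (x + y).
Proof. by move=> Hx Hy; rewrite -[x]scale1r; exact: HdegZD. Qed.

Lemma Hdeg_sum d (I : Type) (r : seq I) (F : I -> H) :
  (forall i, Hdeg d (F i)) -> Hdeg d (\sum_(i <- r) F i).
Proof.
by move=> HF; apply: big_ind => [|x y|i _]; [exact: Hdeg0 | exact: HdegD |].
Qed.

Lemma HdegM d e (x y : H) : Hdeg d x -> Hdeg e y -> Hdeg (d + e) (x * y).
Proof.
move=> [p Hp ->] [q Hq ->]; exists (p * q); last by rewrite piaM.
move=> w /msuppM_le[u [v [/Hp <- /Hq <- ->]]]; exact: fdegM.
Qed.

Lemma Hdeg1 : Hdeg 0 (1 : H).
Proof.
exists 1; last by rewrite rmorph1.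
by move=> w; rewrite msuppU1 in_fset1 => /eqP->; exact: fdeg1.
Qed.

Lemma Hdeg_ha t : Hdeg 1 (ha k t).
Proof.
exists (var t) => // w; rewrite varE msuppU1 in_fset1 => /eqP->; exact: fdegU.
Qed.

Lemma Hdeg_word w : Hdeg (size w) (hword w).
Proof.
elim: w => [|t w IH]; rewrite /word ?big_nil ?big_cons; first exact: Hdeg1.
exact: (HdegM (Hdeg_ha t) IH).
Qed.

Lemma HdegX d e (x : H) : Hdeg e x -> Hdeg (e * d) (x ^+ d).
Proof.
move=> Hx; elim: d => [|d IH]; first by rewrite muln0; exact: Hdeg1.
by rewrite exprS mulnS; exact: HdegM.
Qed.

Lemma Hdeg_ind d (Q : H -> Prop) :
  Q 0 -> (forall c x y, Q x -> Q y -> Q (c *: x + y)) ->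
  (forall w, size w = d -> Q (hword w)) -> forall x, Hdeg d x -> Q x.
Proof.
move=> Q0 QL Qw x [p Hp ->]; rewrite piaE big_seq_cond.
apply: big_ind => // [y w Qy Qz|u]; first by rewrite -[y]scale1r; exact: QL.
rewrite andbT => /Hp up; rewrite -[_ *: _]addr0; apply: QL => //.
exact: Qw.
Qed.

Lemma Hdeg_decomp (x : H) : exists n (f : 'I_n -> H),
  (forall i : 'I_n, Hdeg i (f i)) /\ x = \sum_i f i.
Proof.
have [p ->] := pia_surj x.
pose n := (\max_(u <- msupp p) fdeg u).+1.
exists n, (fun i : 'I_n => \sum_(u <- msupp p | fdeg u == i :> nat) p@_u *: hword u); split.
  move=> i; rewrite -big_filter big_seq_cond.
  apply: big_ind => [|y z|u]; [exact: Hdeg0|exact: HdegD|].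
  rewrite mem_filter andbT => /andP[/eqP <- _]; apply: HdegZ; exact: Hdeg_word.
rewrite piaE; under [RHS]eq_bigr do rewrite big_mkcond.
rewrite exchange_big big_seq_cond [RHS]big_seq_cond; apply: eq_bigr => u.
rewrite andbT => up.
have un : (fdeg u < n)%N.
  rewrite ltnS; exact: (@leq_bigmax_seq _ _ xpredT (fun u : {fmonom 'I_4} => fdeg u)).
rewrite (bigD1 (Ordinal un)) //= eqxx big1 ?addr0 // => i /negPf iu.
by rewrite -val_eqE /= eq_sym in iu; rewrite iu.
Qed.
End Degree.

(** * Setting a_4 to 1 *)

Section Dehomogenization.
Variable k : fieldType.
Local Notation U := (Ug k).
Local Notation H := (Hg k).
Local Notation hword := (@word k 4 (presH k)).

Definition dehom_gen (t : 'I_4) : U :=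
  if unlift ord_max t is Some s then ua k s else 1.

(** The element m a_4^0 of the module of formal sums of the m_i a_4^i. *)
Definition at0 (M : lmodType U) (m : M) : seqmod M :=
  fun i => if i is 0%N then m else 0.

Section At0.
Variable M : lmodType U.
Implicit Types (F G : seqmod M) (m : M).

Lemma seqmodD F G d : (F + G) d = F d + G d :> M.
Proof. by []. Qed.

Lemma seqmodZ (c : k) F d : ((c%:A : H) *: F) d = (c%:A : U) *: (F d : M).
Proof.
have -> : c%:A = pia (presH k) (c *: 1) by rewrite linearZ_LR /= rmorph1.
by rewrite [_ *: F]pactE factZl fact1.
Qed.

Lemma seqmod_gen t F d :
  (ha k t *: F) d.+1 = dehom_gen t *: (F d : M).
Proof.
rewrite ha_seqmod /= /dehom_gen; case: (unlift _ _) => // .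
by rewrite scale1r.
Qed.

Lemma seqmod_gen0 t F : (ha k t *: F) 0%N = 0 :> M.
Proof. by rewrite ha_seqmod. Qed.

Lemma word_at0 w m d : (hword w *: at0 m) d =
  (if d == size w then \prod_(t <- w) dehom_gen t else 0) *: m.
Proof.
elim: w d => [|t w IH] d.
  rewrite /word !big_nil scale1r; case: d => [|d] /=; by rewrite ?scale1r ?scale0r.
rewrite /word big_cons -scalerA; case: d => [|d].
  by rewrite [LHS]seqmod_gen0 scale0r.
rewrite [LHS]seqmod_gen IH /= eqSS; case: eqP => _; last by rewrite !scale0r scaler0.
by rewrite big_cons scalerA.
Qed.
End At0.

(** The image in U(g) of the degree d part of x under a_4 |-> 1, read off from
    the action of x on 1 a_4^0. *)
Definition dehom (d : nat) (x : H) : U := (x *: at0 (1 : U^o)) d.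

Lemma dehomD d x y : dehom d (x + y) = dehom d x + dehom d y.
Proof. by rewrite /dehom scalerDl. Qed.

Lemma dehom0 d : dehom d 0 = 0.
Proof. by rewrite /dehom scale0r. Qed.

Lemma dehom_sum d (I : Type) (r : seq I) (P : pred I) F :
  dehom d (\sum_(i <- r | P i) F i) = \sum_(i <- r | P i) dehom d (F i).
Proof. exact: (big_morph _ (dehomD d) (dehom0 d)). Qed.

Lemma dehomZ d c x : dehom d (c *: x) = c *: dehom d x.
Proof. by rewrite /dehom algZ [LHS]seqmodZ [LHS]mulr_algl. Qed.

(** The coefficients of x (m a_4^0) depend on m only through u |-> u m, so those
    for M = U(g) and m = 1 determine all of them. *)
Lemma dehomE (M : lmodType U) (m : M) d x : (x *: at0 m) d = dehom d x *: m.
Proof.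
have [p ->] := pia_surj x; rewrite piaE.
elim/big_rec: _ => [|u y _ IH].
by rewrite /dehom !scale0r.
rewrite dehomD dehomZ scalerDl seqmodD IH [RHS]scalerDl; congr (_ + _).
rewrite algZ [LHS]seqmodZ word_at0 /dehom [X in _ *: X *: m]word_at0.
by rewrite [X in _ = _ *: X *: _]mulr1 [RHS]algZ.
Qed.

Lemma dehom_word d w :
  dehom d (hword w) = if d == size w then \prod_(t <- w) dehom_gen t else 0.
Proof. by rewrite /dehom word_at0 [LHS]mulr1. Qed.

Lemma dehom_off d e x : Hdeg e x -> d != e -> dehom d x = 0.
Proof.
move=> Hx de; apply: (Hdeg_ind (Q := fun x => dehom d x = 0) _ _ _ Hx).
- exact: dehom0.
- by move=> c y y' IH IH'; rewrite dehomD dehomZ IH IH' scaler0 addr0.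
by move=> w sw; rewrite dehom_word sw (negPf de).
Qed.

Lemma dehom_gen_emb s : dehom_gen (emb s) = ua k s.
Proof. by rewrite /dehom_gen /emb liftK. Qed.

Lemma dehom_gen_max : dehom_gen ord_max = 1.
Proof. by rewrite /dehom_gen unlift_none. Qed.

Lemma dehomS d t x : dehom d.+1 (ha k t * x) = dehom_gen t * dehom d x.
Proof. by rewrite /dehom -scalerA seqmod_gen. Qed.

Lemma dehom1 : dehom 0 1 = 1.
Proof. by rewrite /dehom scale1r. Qed.

(** A product of fewer than d elements of g is homogenized by powers of a_4. *)
Lemma Ufilt_dehom d u : Ufilt d u -> exists2 x, Hdeg d x & dehom d x = u.
Proof.
elim: d u => [|d IH] u.
  move=> [c ->]; exists (c *: 1); first exact/HdegZ/Hdeg1.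
  by rewrite dehomZ dehom1.
move=> [_ [_ [/IH[x Hx <-] [s ->] ->]]].
exists (ha k ord_max * x + \sum_(t <- s) t.1 *:
          \prod_(y <- t.2) \sum_i y 0 i *: ha k (emb i)).
  apply: HdegD; first exact: (HdegM (Hdeg_ha _ _) Hx).
  apply: Hdeg_sum => -[c t]; apply: HdegZ => /=.
  rewrite -[X in Hdeg X](size_tuple t); elim: (tval t) => [|y r IHr].
    rewrite big_nil; exact: Hdeg1.
  rewrite big_cons; apply: (HdegM (d := 1)) => //.
  by apply: Hdeg_sum => i; exact/HdegZ/Hdeg_ha.
rewrite dehomD dehomS dehom_gen_max mul1r; congr (_ + _).
rewrite dehom_sum; apply: eq_bigr => -[c t] _ /=.
rewrite dehomZ; congr (_ *: _).
rewrite -[X in dehom X](size_tuple t); elim: (tval t) => [|y r IHr].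
  by rewrite !big_nil dehom1.
rewrite !big_cons mulr_suml /Defs.iota mulr_suml -IHr.
rewrite dehom_sum; apply: eq_bigr => i _.
by rewrite -!scalerAl dehomZ dehomS dehom_gen_emb.
Qed.

End Dehomogenization.

(** * The polynomial model of an induced module *)

Lemma ord3_ind (Q : 'I_3 -> Prop) : Q o1 -> Q o2 -> Q o3 -> forall t, Q t.
Proof.
move=> Q1 Q2 Q3 [[|[|[|//]]] lt_t].
- by rewrite (_ : Ordinal _ = o1) //; apply/val_inj.
- by rewrite (_ : Ordinal _ = o2) //; apply/val_inj.
by rewrite (_ : Ordinal _ = o3) //; apply/val_inj.
Qed.

Lemma third_index (i j l : 'I_3) : uniq [:: i; j; l] ->
  forall t, [|| t == i, t == j | t == l].
Proof. by elim/ord3_ind: i; elim/ord3_ind: j; elim/ord3_ind: l => // _; elim/ord3_ind. Qed.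

Section Relations.
Variable k : fieldType.

Lemma ha_anticomm (r s t : 'I_3) : uniq [:: r; s; t] ->
  ha k (emb r) * ha k (emb s) + ha k (emb s) * ha k (emb r)
    = ha k (emb t) * ha k ord_max.
Proof.
have rel (p q : 'I_3) e : var (emb p) * var (emb q) + var (emb q) * var (emb p)
    - var (emb e) * var ord_max \in relsH k ->
    ha k (emb p) * ha k (emb q) + ha k (emb q) * ha k (emb p)
      = ha k (emb e) * ha k ord_max.
  by move=> eR; rewrite -!piaM -raddfD; apply/pia_eq/mem_ideal_gen.
have R12 := rel o1 o2 o3 (mem_nth 0 (isT : (0 < size (relsH k))%N)).
have R23 := rel o2 o3 o1 (mem_nth 0 (isT : (1 < size (relsH k))%N)).
have R31 := rel o3 o1 o2 (mem_nth 0 (isT : (2 < size (relsH k))%N)).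
elim/ord3_ind: r; elim/ord3_ind: s; elim/ord3_ind: t => // _;
  by rewrite ?R12 ?R23 ?R31 // addrC ?R12 ?R23 ?R31.
Qed.

Lemma ha_central (s : 'I_3) :
  ha k (emb s) * ha k ord_max = ha k ord_max * ha k (emb s).
Proof.
have rel (p : 'I_3) : var (emb p) * var ord_max - var ord_max * var (emb p)
    \in relsH k -> ha k (emb p) * ha k ord_max = ha k ord_max * ha k (emb p).
  by move=> eR; rewrite -!piaM; apply/pia_eq/mem_ideal_gen.
elim/ord3_ind: s; apply: rel.
- exact: (mem_nth 0 (isT : (3 < size (relsH k))%N)).
- exact: (mem_nth 0 (isT : (4 < size (relsH k))%N)).
exact: (mem_nth 0 (isT : (5 < size (relsH k))%N)).
Qed.
End Relations.

Section PolynomialModule.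
Variables (k : fieldType) (i j l : 'I_3) (c mu gam : k).
Hypothesis two_neq0 : 2%:R != 0 :> k.
Hypothesis ijl : uniq [:: i; j; l].
Hypothesis mu2 : mu ^+ 2 = 1.
Hypothesis compat : gam * (2%:R * c - mu) = 0.
Local Notation V := {poly k}.
Local Notation U := (Ug k).

(** The action of a_i + a_j: since (a_i + a_j) a_l = (1 - a_l) (a_i + a_j), it is
    determined by (a_i + a_j) 1 = c + gam - mu X. *)
Definition refl_plus (f : V) : V := (f \Po (1 - 'X)) * ((c + gam)%:P - mu%:P * 'X).
(** The action of a_i - a_j: since (a_i - a_j) a_l = - (1 + a_l) (a_i - a_j), it is
    determined by (a_i - a_j) 1 = c - gam + mu X. *)
Definition refl_minus (f : V) : V := (f \Po (-1 - 'X)) * ((c - gam)%:P + mu%:P * 'X).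

Definition pol_i (f : V) : V := 2%:R^-1 *: (refl_plus f + refl_minus f).
Definition pol_j (f : V) : V := 2%:R^-1 *: (refl_plus f - refl_minus f).
Definition pol_l (f : V) : V := 'X * f.

Definition pol_gen (t : 'I_3) : V -> V :=
  if t == l then pol_l else if t == i then pol_i else pol_j.

Lemma pol_gen_linear t : linear (pol_gen t).
Proof.
move=> a f g; rewrite /pol_gen; case: ifP => _.
  by rewrite /pol_l mulrDr scalerAr.
case: ifP => _; rewrite /pol_i /pol_j /refl_plus /refl_minus !comp_polyD !comp_polyZ;
  rewrite -!mul_polyC; ring.
Qed.

HB.instance Definition _ t := GRing.isLinear.Build k V V _ (pol_gen t) (pol_gen_linear t).

Definition pol_op (t : 'I_3) : {linear V -> V} := pol_gen t.

Lemma refl_plusK f : refl_plus (refl_plus f) =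
  (((c + gam) ^+ 2 - (c + gam) * mu)%:P + 'X - 'X ^+ 2) * f.
Proof.
have m2 : mu%:P ^+ 2 = 1 :> V by rewrite -polyC_exp mu2.
have C1 (q : V) : 1 \Po q = 1 by rewrite -polyC1 comp_polyC.
rewrite /refl_plus comp_polyM -comp_polyA !(comp_polyB, comp_polyM, comp_polyC, comp_polyX, C1).
have -> : 1 - (1 - 'X) = 'X :> V by ring.
rewrite comp_polyXr !(polyCB, polyCD, polyCM).
ring: m2.
Qed.

Lemma refl_minusK f : refl_minus (refl_minus f) =
  (((c - gam) ^+ 2 - (c - gam) * mu)%:P - 'X - 'X ^+ 2) * f.
Proof.
have m2 : mu%:P ^+ 2 = 1 :> V by rewrite -polyC_exp mu2.
have C1 (q : V) : -1 \Po q = -1 by rewrite -polyC1 -polyCN comp_polyC.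
rewrite /refl_minus comp_polyM -comp_polyA.
rewrite !(comp_polyB, comp_polyD, comp_polyM, comp_polyC, comp_polyX, C1).
have -> : -1 - (-1 - 'X) = 'X :> V by ring.
rewrite comp_polyXr !(polyCB, polyCD, polyCM).
ring: m2.
Qed.

Lemma pol_gen_il f : pol_i (pol_l f) + pol_l (pol_i f) = pol_j f.
Proof.
rewrite /pol_i /pol_j /pol_l /refl_plus /refl_minus !comp_polyM !comp_polyX -!mul_polyC.
ring.
Qed.

Lemma pol_gen_jl f : pol_j (pol_l f) + pol_l (pol_j f) = pol_i f.
Proof.
rewrite /pol_i /pol_j /pol_l /refl_plus /refl_minus !comp_polyM !comp_polyX -!mul_polyC.
ring.
Qed.

Lemma refl_plusZD a f g : refl_plus (a *: f + g) = a *: refl_plus f + refl_plus g.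
Proof. by rewrite /refl_plus comp_polyD comp_polyZ mulrDl scalerAl. Qed.

Lemma refl_minusZD a f g : refl_minus (a *: f + g) = a *: refl_minus f + refl_minus g.
Proof. by rewrite /refl_minus comp_polyD comp_polyZ mulrDl scalerAl. Qed.

(** a_i a_j + a_j a_i is half the difference of the squares of a_i + a_j and
    a_i - a_j.  Both squares are multiplications by polynomials, and half their
    difference is X + gam (2 c - mu). *)
Lemma pol_gen_ij f : pol_i (pol_j f) + pol_j (pol_i f) = pol_l f.
Proof.
have p0 : refl_plus 0 = 0 by rewrite /refl_plus comp_poly0 mul0r.
have m0 : refl_minus 0 = 0 by rewrite /refl_minus comp_poly0 mul0r.
have pE a g h : refl_plus (a *: (g + h)) = a *: (refl_plus g + refl_plus h).
  by rewrite -[a *: _]addr0 refl_plusZD p0 addr0 -[g]scale1r refl_plusZD !scale1r.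
have mE a g h : refl_minus (a *: (g + h)) = a *: (refl_minus g + refl_minus h).
  by rewrite -[a *: _]addr0 refl_minusZD m0 addr0 -[g]scale1r refl_minusZD !scale1r.
have pN g : refl_plus (- g) = - refl_plus g.
  by rewrite -[- g]addr0 -scaleN1r refl_plusZD p0 addr0 scaleN1r.
have mN g : refl_minus (- g) = - refl_minus g.
  by rewrite -[- g]addr0 -scaleN1r refl_minusZD m0 addr0 scaleN1r.
have -> : pol_i (pol_j f) + pol_j (pol_i f) =
  (2%:R^-1 * 2%:R^-1) *: (2%:R *: (refl_plus (refl_plus f) - refl_minus (refl_minus f))).
  rewrite /pol_i /pol_j !pE !mE !pN !mN -!mul_polyC !polyCM; ring.
rewrite refl_plusK refl_minusK /pol_l scalerA -mulrA mulVf // mulr1.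
have -> : (((c + gam) ^+ 2 - (c + gam) * mu)%:P + 'X - 'X ^+ 2) * f -
   (((c - gam) ^+ 2 - (c - gam) * mu)%:P - 'X - 'X ^+ 2) * f
  = (2%:R * (gam * (2%:R * c - mu)))%:P * f + 2%:R * 'X * f.
  rewrite !(polyCB, polyCD, polyCM); ring.
rewrite compat mulr0 polyC0 mul0r add0r -mul_polyC.
have e : (2%:R^-1)%:P * 2%:R = 1 :> V by rewrite -polyC_natr -polyCM mulVf.
transitivity ((2%:R^-1)%:P * 2%:R * ('X * f)); first by ring.
by rewrite e mul1r.
Qed.

Lemma pol_op_anticomm r s t f : uniq [:: r; s; t] ->
  pol_op r (pol_op s f) + pol_op s (pol_op r f) = pol_op t f.
Proof.
have [nij nil njl] : [/\ i != j, i != l & j != l].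
  by move: ijl; rewrite /= !inE negb_or => /andP[/andP[-> ->] /andP[->]].
have E : ((pol_op i = pol_i :> (V -> V)) * (pol_op j = pol_j :> (V -> V)) *
         (pol_op l = pol_l :> (V -> V)))%type.
  rewrite /pol_op /= /pol_gen !eqxx (negPf nil) (negPf njl).
  by rewrite eq_sym (negPf nij).
have := third_index ijl.
move=> tI; move: (tI r) (tI s) (tI t).
do 3! (case/or3P => /eqP->); rewrite /= !inE ?eqxx ?orbT ?andbF //= => _; rewrite !E;
  by rewrite ?pol_gen_ij ?pol_gen_il ?pol_gen_jl // addrC ?pol_gen_ij ?pol_gen_il ?pol_gen_jl.
Qed.

Fact pol_op_rel r f : r \in rels (presU k) -> fact pol_op r f = 0.
Proof.
have R p q s : uniq [:: p; q; s] ->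
    fact pol_op (var p * var q + var q * var p - var s) f = 0.
  move=> pqs; rewrite 2!factDl factNl.
  apply/eqP; rewrite subr_eq0; apply/eqP; rewrite [RHS]fact_var.
  by rewrite -(pol_op_anticomm f pqs); congr (_ + _); exact: fact_var2.
rewrite !inE => /orP[/eqP->|/orP[/eqP->|/eqP->]]; exact: R.
Qed.

(** A model of the induced module on the basis X^n = a_l^n (x) 1. *)
Definition polmod := actmod pol_op_rel.
HB.instance Definition _ := GRing.Lmodule.on polmod.

Lemma ua_polmod t (f : polmod) : ua k t *: f = pol_op t f.
Proof. by rewrite [LHS]pactE fact_var. Qed.

Lemma polmodZ a (f : polmod) : (a%:A : U) *: f = a *: (f : V).
Proof.
have -> : a%:A = pia (presU k) (a *: 1) by rewrite linearZ_LR /= rmorph1.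
by rewrite [LHS]pactE factZl fact1.
Qed.

End PolynomialModule.

(** * Normal forms in cyclic modules *)

(** The linear relations of the generator of the line module given by the line
    V(a_i - c a_4, a_j + mu a_l - gam a_4). *)
Definition line_rel (k : fieldType) (i j l : 'I_3) (c mu gam : k)
    (N : lmodType (Hg k)) (e : N) : Prop :=
  ha k (emb i) *: e = (c%:A : Hg k) *: (ha k ord_max *: e) /\
  ha k (emb j) *: e = (gam%:A : Hg k) *: (ha k ord_max *: e)
    - (mu%:A : Hg k) *: (ha k (emb l) *: e).

Section NormalForm.
Variables (k : fieldType) (i j l : 'I_3) (c mu gam : k).
Hypothesis two_neq0 : 2%:R != 0 :> k.
Hypothesis ijl : uniq [:: i; j; l].
Hypothesis mu2 : mu ^+ 2 = 1.
Hypothesis compat : gam * (2%:R * c - mu) = 0.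
Local Notation V := {poly k}.
Local Notation U := (Ug k).
Local Notation H := (Hg k).
Local Notation hword := (@word k 4 (presH k)).
Local Notation z := (ha k ord_max).
Local Notation a_ t := (ha k (emb t)).
Local Notation L := (polmod two_neq0 ijl mu2 compat).
Local Notation op := (pol_op i l c mu gam).

Definition pol1 : L := (1 : V).

Lemma op_i : (op i = pol_i c mu gam :> (V -> V)).
Proof.
have nil : i != l by move: ijl; rewrite /= !inE negb_or => /andP[/andP[_ ->]].
by rewrite /pol_op /= /pol_gen (negPf nil) eqxx.
Qed.
Lemma op_j : (op j = pol_j c mu gam :> (V -> V)).
Proof.
have [nij njl] : i != j /\ j != l.
  by move: ijl; rewrite /= !inE negb_or => /andP[/andP[-> _] /andP[->]].
by rewrite /pol_op /= /pol_gen (negPf njl) eq_sym (negPf nij).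
Qed.
Lemma op_l : (op l = @pol_l k :> (V -> V)).
Proof. by rewrite /pol_op /= /pol_gen eqxx. Qed.

Lemma size_comp_affine (p q : V) : (size q <= 2)%N -> (size (p \Po q) <= size p)%N.
Proof.
move=> q2; have [->|p0] := eqVneq p 0; first by rewrite comp_poly0 size_poly0.
apply: leq_trans (size_comp_poly_leq p q) _.
have : ((size q).-1 <= 1)%N by rewrite -subn1 leq_subLR.
rewrite -[in X in _ -> (_ <= X)%N](prednK (n := size p)) ?size_poly_gt0 // ltnS.
by move=> h; rewrite -[leqRHS]muln1 leq_mul.
Qed.

Lemma size_pol_op t (f : V) d : (size f <= d)%N -> (size (op t f) <= d.+1)%N.
Proof.
move=> fd; have S2 (a b : k) : (size (a%:P + b%:P * 'X)%R <= 2)%N.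
  rewrite (leq_trans (size_polyD _ _)) // geq_max (leq_trans (size_polyC_leq1 _)) //=.
  rewrite (leq_trans (size_polyMleq _ _)) // size_polyX addn2 /=.
  by rewrite ltnS size_polyC_leq1.
have SM (a b : k) (g : V) : (size g <= d)%N -> (size (g * (a%:P + b%:P * 'X))%R <= d.+1)%N.
  have [->|g0] := eqVneq g 0; first by rewrite mul0r size_poly0.
  move=> gd; apply: leq_trans (size_polyMleq _ _) _.
  by rewrite -subn1 leq_subLR add1n -addn2 leq_add.
have SP : (size (refl_plus c mu gam f) <= d.+1)%N.
  rewrite /refl_plus -mulNr -polyCN; apply/SM/(leq_trans _ fd)/size_comp_affine.
  by have := S2 1 (-1); rewrite polyC1 polyCN polyC1 mulN1r.
have SQ : (size (refl_minus c mu gam f) <= d.+1)%N.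
  rewrite /refl_minus; apply/SM/(leq_trans _ fd)/size_comp_affine.
  by have := S2 (-1) (-1); rewrite polyCN polyC1 mulN1r.
rewrite /pol_op /= /pol_gen; case: ifP => _.
  by rewrite /pol_l mulrC (leq_trans (size_polyMleq _ _)) // size_polyX addn2.
case: ifP => _; rewrite (leq_trans (size_scale_leq _ _)) //;
  by rewrite (leq_trans (size_polyD _ _)) // ?size_polyN geq_max SP.
Qed.

Definition hmono (d n : nat) : H := a_ l ^+ n * z ^+ (d - n).

(** The form of degree d in a_l and a_4 that becomes f(a_l) when a_4 is set to 1. *)
Definition hspan (d : nat) (f : V) : H := \sum_(n < d.+1) f`_n *: hmono d n.

Lemma hspan_rVpoly (N : lmodType H) (e : N) d (r : 'rV[k]_d.+1) :
  \sum_n ((r 0 n)%:A : H) *: (hmono d n *: e) = hspan d (rVpoly r) *: e.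
Proof.
rewrite /hspan scaler_suml; apply: eq_bigr => n _.
by rewrite coef_rVpoly_ord [in RHS]algZ.
Qed.

Lemma hspanZD d a f g : hspan d (a *: f + g) = a *: hspan d f + hspan d g.
Proof.
rewrite /hspan scaler_sumr -big_split; apply: eq_bigr => n _ /=.
by rewrite coefD coefZ scalerDl scalerA.
Qed.

Lemma hspan0 d : hspan d 0 = 0.
Proof. by rewrite /hspan big1 // => n _; rewrite coef0 scale0r. Qed.

Lemma hspanD d f g : hspan d (f + g) = hspan d f + hspan d g.
Proof. by rewrite -[f]scale1r hspanZD !scale1r. Qed.

Lemma hspanZ d a f : hspan d (a *: f) = a *: hspan d f.
Proof. by rewrite -[a *: f]addr0 hspanZD hspan0 addr0. Qed.

Lemma hspanB d f g : hspan d (f - g) = hspan d f - hspan d g.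
Proof. by rewrite -scaleN1r addrC hspanZD scaleN1r addrC. Qed.

Lemma Hdeg_hmono d (n : 'I_d.+1) : Hdeg d (hmono d n).
Proof.
rewrite -[X in Hdeg X](subnKC (ltnSE (ltn_ord n))).
by apply: HdegM; rewrite -[X in Hdeg X]mul1n; apply: HdegX; exact: Hdeg_ha.
Qed.

Lemma hspan_mulX d (f : V) : hspan d.+1 ('X * f) = a_ l * hspan d f.
Proof.
rewrite /hspan big_ord_recl coefXM eqxx scale0r add0r mulr_sumr.
apply: eq_bigr => n _; rewrite coefXM /hmono /= subSS exprS -mulrA.
by rewrite scalerAr.
Qed.

Lemma hspan_widen d (f : V) : (size f <= d.+1)%N -> hspan d.+1 f = z * hspan d f.
Proof.
move=> fd; rewrite /hspan big_ord_recr /= nth_default // scale0r addr0 mulr_sumr.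
apply: eq_bigr => n _; rewrite /hmono -scalerAr mulrA.
have -> : z * a_ l ^+ n = a_ l ^+ n * z by apply: commrX; exact/esym/ha_central.
by rewrite -mulrA -exprS subSn // -ltnS.
Qed.

Lemma dehom_gen_polmod t (f : L) : dehom_gen k t *: f =
  if unlift ord_max t is Some s then op s f else f.
Proof.
rewrite /dehom_gen; case: (unlift _ _) => [s|]; first exact: ua_polmod.
exact: scale1r.
Qed.

Lemma dehom_hspan_pol1 d (f : V) : (size f <= d.+1)%N ->
  dehom d (hspan d f) *: pol1 = f.
Proof.
have mono n m : dehom (n + m) (a_ l ^+ n * z ^+ m) = ua k l ^+ n.
  elim: n => [|n IH]; rewrite ?mul1r.
    elim: m => [|m IH]; first exact: dehom1.
    by rewrite exprS dehomS IH dehom_gen_max mul1r.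
  by rewrite exprS -mulrA dehomS IH dehom_gen_emb -exprS.
have pow n : ua k l ^+ n *: pol1 = 'X^n.
  elim: n => [|n IH]; first by rewrite scale1r.
  by rewrite exprS -scalerA IH [LHS]ua_polmod op_l exprS.
move=> fd; rewrite /hspan dehom_sum scaler_suml.
transitivity (\poly_(n < d.+1) f`_n).
  rewrite poly_def; apply: eq_bigr => n _.
  rewrite dehomZ algZ [LHS]polmodZ /hmono -[in X in dehom X](subnKC (ltnSE (ltn_ord n))).
  by rewrite [X in _ *: X](_ : _ = 'X^n) // mono pow.
apply/polyP => n; rewrite coef_poly; case: ltnP => // dn.
by rewrite nth_default // (leq_trans fd).
Qed.

Lemma polD2 (p : V) : 2%:R^-1 *: (p + p) = p.
Proof. by rewrite -mulr2n -scaler_nat scalerA mulVf // scale1r. Qed.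

Lemma op_i1 : op i 1 = c%:P.
Proof.
rewrite op_i /pol_i /refl_plus /refl_minus -polyC1 !comp_polyC polyC1 !mul1r -[RHS]polD2.
by congr (_ *: _); rewrite polyCD polyCB; ring.
Qed.

Lemma op_j1 : op j 1 = gam%:P - mu%:P * 'X.
Proof.
rewrite op_j /pol_j /refl_plus /refl_minus -polyC1 !comp_polyC polyC1 !mul1r -[RHS]polD2.
by congr (_ *: _); rewrite polyCD polyCB; ring.
Qed.

Lemma hspan_X : hspan 1 'X = a_ l.
Proof. by rewrite -['X]mulr1 hspan_mulX /hspan /hmono big_ord1 coefC scale1r !mulr1. Qed.

Lemma hspan1C a : hspan 1 a%:P = a *: z.
Proof.
rewrite hspan_widen ?size_polyC_leq1 // /hspan /hmono big_ord1 coefC.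
by rewrite !mulr1 -scalerAr mulr1.
Qed.

Lemma polM1 a : a%:P = a *: 1 :> V.
Proof. by rewrite -mul_polyC mulr1. Qed.

Lemma poly_step (f : V) d : (size f <= d.+2)%N ->
  exists2 g : V, (size g <= d.+1)%N & f = 'X * g + (f`_0)%:P.
Proof.
move=> fd; exists (\poly_(n < d.+1) f`_n.+1); first exact: size_poly.
apply/polyP => -[|n]; rewrite coefD coefXM coefC coef_poly /= ?add0r // addr0.
by case: ltnP => // dn; rewrite nth_default // (leq_trans fd).
Qed.

Section Cyclic.
Variables (N : lmodType H) (e : N).
Hypothesis e_rel : line_rel i j l c mu gam e.

Lemma hspan_base t : a_ t *: e = hspan 1 (op t 1) *: e.
Proof.
have [e_i e_j] := e_rel; have /or3P[] := third_index ijl t; move=> /eqP->.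
- by rewrite op_i1 hspan1C [in RHS]algZ e_i.
- rewrite op_j1 hspanD hspan1C -mulNr -polyCN mul_polyC hspanZ hspan_X.
  by rewrite e_j scalerDl scaleNr scaleNr; congr (_ - _); rewrite [in RHS]algZ.
by rewrite op_l /pol_l mulr1 hspan_X.
Qed.

(** Induction on d, writing f = X g + f(0).  To move a_t past a_l one uses
    a_t a_l = a_t' a_4 - a_l a_t, and the model satisfies the same relation with
    a_4 replaced by 1. *)
Lemma hspan_op d t (f : V) : (size f <= d.+1)%N ->
  a_ t *: (hspan d f *: e) = hspan d.+1 (op t f) *: e.
Proof.
elim: d t f => [|d IH] t f fd.
  rewrite (size1_polyC fd) polM1 linearZ_LR /= !hspanZ algZ -algC.
  by rewrite [in RHS]algZ -hspan_base /hspan /hmono big_ord1 coef1 !mulr1 scale1r scale1r.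
have [->|tl] := eqVneq t l.
  by rewrite scalerA -hspan_mulX op_l.
have [g gd ->] := poly_step fd; set a := f`_0.
rewrite linearD hspanD hspan_mulX (hspan_widen (f := a%:P)) //; last first.
  exact: leq_trans (size_polyC_leq1 a) _.
have aC : (size (a%:P : V) <= d.+1)%N := leq_trans (size_polyC_leq1 a) (ltn0Sn d).
rewrite hspanD (hspan_widen (size_pol_op _ aC)) !scalerDl scalerDr.
congr (_ + _); last first.
  by rewrite -[in RHS]scalerA -IH // !scalerA -ha_central !mulrA.
(* t' is the third index, so that a_t a_l + a_l a_t = a_t' a_4. *)
pose t' := if t == i then j else i.
have tlt' : uniq [:: t; l; t'].
  move: ijl; rewrite /t' /= !inE !negb_or => /andP[/andP[ij il] /andP[jl _]].
  have [->|ti] := eqVneq t i; first by rewrite ij il eq_sym jl.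
  have /or3P[/eqP E|/eqP->|/eqP E] := third_index ijl t.
  - by rewrite E eqxx in ti.
  - by rewrite jl eq_sym ij eq_sym il.
  by rewrite E eqxx in tl.
have Eop : op t ('X * g) = op t' g - 'X * op t g.
  apply/eqP; rewrite eq_sym subr_eq eq_sym; apply/eqP.
  have := pol_op_anticomm two_neq0 ijl mu2 compat g tlt'.
  by rewrite op_l.
have Ea : a_ t * a_ l = z * a_ t' - a_ l * a_ t.
  by rewrite -ha_central -(ha_anticomm k tlt') addrK.
rewrite Eop hspanB hspan_mulX.
rewrite (hspan_widen (size_pol_op _ gd)) !scalerBl -!scalerA -!IH //.
by rewrite scalerA Ea scalerBl -!scalerA.
Qed.

(** Normal form: applied to e, every element of degree d becomes a form in a_l and
    a_4, and the polynomial module tells which one. *)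
Lemma dehom_hspan d x : Hdeg d x ->
  (size (dehom d x *: pol1 : V) <= d.+1)%N /\
  x *: e = hspan d (dehom d x *: pol1) *: e.
Proof.
have word_case w : (size (dehom (size w) (hword w) *: pol1 : V) <= (size w).+1)%N /\
  hword w *: e = hspan (size w) (dehom (size w) (hword w) *: pol1) *: e.
  elim: w => [|t w [IHs IH]].
    rewrite /word big_nil dehom1 scale1r /pol1 size_poly1; split=> //.
    by rewrite /hspan /hmono big_ord1 coef1 !mulr1 !scale1r.
  have -> : hword (t :: w) = ha k t * hword w by rewrite /word big_cons.
  rewrite [size _]/= dehomS -!scalerA !dehom_gen_polmod.
  rewrite IH; case: unliftP => [s ->|->].
    by split; [exact: size_pol_op|exact: hspan_op].
  by split; [exact: leqW|rewrite hspan_widen // scalerA].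
move=> Hx; pose Q x := (size (dehom d x *: pol1 : V) <= d.+1)%N /\
  x *: e = hspan d (dehom d x *: pol1) *: e.
apply: (@Hdeg_ind k d Q _ _ _ x Hx).
- by rewrite /Q dehom0 !scale0r hspan0 size_poly0 scale0r.
- move=> a x1 x2 [S1 E1] [S2 E2]; rewrite /Q.
  have -> : dehom d (a *: x1 + x2) *: pol1 =
      a *: (dehom d x1 *: pol1 : V) + (dehom d x2 *: pol1 : V).
    by rewrite dehomD dehomZ scalerDl algZ [X in X + _]polmodZ.
  split.
    rewrite (leq_trans (size_polyD _ _)) // geq_max S2 andbT.
    exact: leq_trans (size_scale_leq _ _) S1.
  by rewrite hspanZD !scalerDl E2 algZ E1 [in RHS]algZ.
by move=> w sw; rewrite /Q -sw; exact: word_case.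
Qed.

(** So 1 in the model has the smallest annihilator among all elements satisfying
    the relations. *)
Lemma ann_pol1 x : (forall d, dehom d x *: pol1 = 0) -> x *: e = 0.
Proof.
have [n [f [Hf ->]]] := Hdeg_decomp x => E.
rewrite scaler_suml big1 // => d _.
have [_ ->] := dehom_hspan (Hf d).
suff -> : dehom d (f d) *: pol1 = 0 by rewrite hspan0 scale0r.
rewrite -(E d) dehom_sum.
rewrite (bigD1 d) //= big1 ?addr0 // => d' dd'.
by apply: dehom_off (Hf d') _; rewrite eq_sym.
Qed.
End Cyclic.
End NormalForm.

(** * Graded cyclic modules and line modules *)

Section Generated.
Variable k : fieldType.
Local Notation H := (Hg k).

(** Equivalently, N is H / ann(e) as a graded module. *)
Definition generates (N : grmod k) (e : N) : Prop :=
  (forall y, exists x : H, y = x *: e) /\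
  (forall d y, gr_comp d y <-> exists2 x : H, Hdeg d x & y = x *: e).

Section Iso.
Variables (N N' : grmod k) (e : N) (e' : N').
Hypotheses (Ne : generates e) (Ne' : generates e').
Hypothesis ann : forall x : H, x *: e = 0 <-> x *: e' = 0.

Let f (y : N) : N' := sval (cid (Ne.1 y)) *: e'.

Let fE x : f (x *: e) = x *: e'.
Proof.
rewrite /f; case: cid => x' /= /eqP; rewrite -subr_eq0 -scalerBl => /eqP/ann.
by rewrite scalerBl => /eqP; rewrite subr_eq0 eq_sym => /eqP.
Qed.

Let f_linear : linear f.
Proof.
move=> a y y'; have [x ->] := Ne.1 y; have [x' ->] := Ne.1 y'.
by rewrite scalerA -scalerDl !fE scalerDl scalerA.
Qed.

HB.instance Definition _ := GRing.isLinear.Build H N N' _ f f_linear.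

(** x e |-> x e' is well defined and injective because the annihilators agree. *)
Lemma generates_iso : gr_iso N N'.
Proof.
exists (f : {linear N -> N'}); split=> [|d y] /=.
  exists (fun y => sval (cid (Ne'.1 y)) *: e) => y /=.
    have [x ->] := Ne.1 y; rewrite fE; case: cid => x' /= /eqP.
    rewrite -subr_eq0 -scalerBl => /eqP/ann.
    by rewrite scalerBl => /eqP; rewrite subr_eq0 eq_sym => /eqP.
  by case: cid => x /= yE; rewrite fE.
split=> [/Ne.2[x Hx ->]|].
  by apply/Ne'.2; exists x; rewrite ?fE.
have [x ->] := Ne.1 y; rewrite fE => /Ne'.2[x' Hx' xx'].
apply/Ne.2; exists x' => //; move/eqP: xx'.
rewrite -subr_eq0 -scalerBl => /eqP/ann.
by rewrite scalerBl => /eqP; rewrite subr_eq0 => /eqP.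
Qed.
End Iso.

Lemma gr_iso_generates (N N' : grmod k) (e : N) : gr_iso N N' -> generates e ->
  exists2 e' : N', generates e' & forall x : H, x *: e = 0 <-> x *: e' = 0.
Proof.
move=> [f [[g fK gK] fgr]] [eg ec]; exists (f e); first split.
- by move=> y; have [x xE] := eg (g y); exists x; rewrite -linearZ -xE gK.
- move=> d y; rewrite -[y]gK -fgr; split=> [/ec[x Hx ->]|[x Hx]].
    by exists x; rewrite ?linearZ.
  by rewrite -linearZ => /(can_inj fK) ->; apply/ec; exists x.
move=> x; rewrite -linearZ; split=> [->|/eqP]; first exact: raddf0.
by rewrite -(raddf0 f) (inj_eq (can_inj fK)) => /eqP.
Qed.

Lemma gr_iso_sym (N N' : grmod k) : gr_iso N N' -> gr_iso N' N.
Proof.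
move=> [f [[g fK gK] fgr]].
have gL : linear g.
  by move=> a x y; apply: (can_inj fK); rewrite linearP !gK.
pose gl : {linear N' -> N} := HB.pack g (GRing.isLinear.Build H N' N _ g gL).
exists gl; split=> [|d y]; first by exists f.
by rewrite fgr /= gK.
Qed.

Lemma generates_transport (N N' : grmod k) (e' : N') : gr_iso N N' -> generates e' ->
  exists2 e : N, generates e & forall x : H, x *: e = 0 <-> x *: e' = 0.
Proof.
move=> /gr_iso_sym iso ge; have [e eg ann] := gr_iso_generates iso ge.
by exists e => // x; rewrite ann.
Qed.

Lemma generates_comp0 (N : grmod k) (e : N) : generates e -> gr_comp 0 e.
Proof. by move=> [_ ec]; apply/ec; exists 1; rewrite ?scale1r //; exact: Hdeg1. Qed.

Section LineQuotient.
Variables u v : H.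
Local Notation Q := (line_quotient u v).

Definition lq1 : Q := qpi (left_ideal2_closed u v) 1.

Lemma lq1Z x : x *: lq1 = qpi (left_ideal2_closed u v) x.
Proof. by rewrite /lq1 -linearZ_LR /=; congr qpi; exact: mulr1. Qed.

Lemma generates_lq1 : generates lq1.
Proof.
split=> [y|d y].
  by have [x ->] := qpi_surj y; exists x; rewrite lq1Z.
by split=> -[x Hx yE]; exists x => //; rewrite yE lq1Z.
Qed.

Lemma lq1_ann x : x *: lq1 = 0 <-> exists a b, x = a * u + b * v.
Proof.
rewrite lq1Z -(raddf0 (qpi (left_ideal2_closed u v))) qpi_eq subr0.
by split=> [/asboolP|H]; last apply/asboolP.
Qed.
End LineQuotient.
End Generated.

Section LineModules.
Variable k : fieldType.
Local Notation H := (Hg k).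

(** As (1 - X)^2 = 1 - 2 X + X^2, the series satisfies s_n = 2 s_(n-1) - s_(n-2),
    with s_0 = 1 and s_1 = 2. *)
Lemma inv_1mX_sqE s : inv_1mX_sq s <-> forall n, s n = n.+1.
Proof.
have C n : ((1 - 'X) ^+ 2 : {poly int})`_n = [:: 1; - 2%:R; 1]`_n.
  have -> : (1 - 'X) ^+ 2 = 1%:P + (- 2%:R)%:P * 'X + 'X ^+ 2 :> {poly int}.
    rewrite polyCN polyC_natr polyC1; ring.
  rewrite !coefD coefC coefXn coefCM coefX.
  by case: n => [|[|[|n]]] //=; rewrite nth_nil.
pose t n := if n is m.+1 then s m else 0%N.
have R n : \sum_(i < n.+1) (((1 - 'X) ^+ 2 : {poly int})`_i * (s (n - i)%N)%:Z) =
  (s n)%:Z - 2%:R * (t n)%:Z + (t n.-1)%:Z.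
  case: n => [|[|n]]; rewrite !big_ord_recl ?big_ord0 !C /= ?subn0 /bump /= ?add1n ?subSS ?subn0.
  - lia.
  - lia.
  rewrite big1 => [|i _]; first lia.
  by rewrite C /= nth_nil mul0r.
split=> S n; last first.
  by rewrite R; case: n => [|[|n]]; rewrite /t /= ?S //=; lia.
suff [] : s n = n.+1 /\ s n.+1 = n.+2 by [].
elim: n => [|n [IH IH1]].
  by have := S 0%N; have := S 1%N; rewrite !R /t /=; lia.
by split=> //; have := S n.+2; rewrite R /t /= IH IH1; lia.
Qed.

Variable N : grmod k.
Hypothesis Nline : line_module N.

Lemma line_dim d : has_dim (@gr_comp k N d) d.+1.
Proof. by have [_ _ [s /inv_1mX_sqE sE sN]] := Nline; rewrite -sE; exact: sN. Qed.

Lemma line_comp0 d : gr_comp d (0 : N).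
Proof. by have [[/(_ d)[]]] := Nline. Qed.

Lemma line_compB d x y : gr_comp d x -> gr_comp d y -> gr_comp d (x - y : N).
Proof. by have [[/(_ d)[_]] + _ _ _ _ _] := Nline; apply. Qed.

Lemma line_compZ d e (a : H) (x : N) : Hdeg d a -> gr_comp e x -> gr_comp (d + e) (a *: x).
Proof. by have [[_ + _ _ _ _]] := Nline; apply. Qed.

Lemma line_indep n (f : 'I_n -> N) : (forall i : 'I_n, gr_comp i (f i)) ->
   \sum_i f i = 0 -> forall i, f i = 0.
Proof. by have [[_ _ _ +] _ _] := Nline; apply. Qed.

(** The sum of the x_i v, over the homogeneous parts x_i of x, is direct; so only
    the part of degree e - d contributes to y. *)
Lemma line_homog (v : N) d e y : gr_comp d v -> (exists x : H, y = x *: v) -> gr_comp e y ->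
  y = 0 \/ exists i (x : H), [/\ (i + d = e)%N, Hdeg i x & y = x *: v].
Proof.
move=> vd [x yE] ye; have [n [f [Hf xE]]] := Hdeg_decomp x.
pose F i : H := if insub i is Some i' then f i' else 0.
have HF i : Hdeg i (F i).
  by rewrite /F; case: insubP => [i' _ <-|_]; [exact: Hf | exact: Hdeg0].
pose part m : N := if (d <= m)%N then F (m - d)%N *: v else 0.
pose g (m : 'I_(d + (n + e.+1))) : N := part m - (if m == e :> nat then y else 0).
have en : (e < d + (n + e.+1))%N by lia.
have part_comp m : gr_comp m (part m).
  rewrite /part; case: leqP => dm; last exact: line_comp0.
  by rewrite -[X in gr_comp X](subnK dm); exact: line_compZ.
have g_comp (m : 'I_(d + (n + e.+1))) : gr_comp m (g m).
  apply: line_compB; first exact: part_comp.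
  by case: eqP => [->|_] //; exact: line_comp0.
have g0 : \sum_m g m = 0.
  have yS : \sum_(m < d + (n + e.+1)) (if m == e :> nat then y else 0) = y.
    rewrite (bigD1 (Ordinal en)) //= eqxx big1 ?addr0 // => m /negPf.
    by rewrite -val_eqE /= => ->.
  rewrite sumrB yS.
  rewrite big_split_ord /= big1 ?add0r => [|m _]; last first.
    by rewrite /part leqNgt ltn_ord.
  rewrite big_split_ord /= [X in _ + X - _]big1 ?addr0 => [|m _]; last first.
    rewrite /part leq_addr addKn /F insubF ?scale0r //.
    by apply/negbTE; rewrite -leqNgt leq_addr.
  rewrite yE xE scaler_suml; apply/eqP; rewrite subr_eq0; apply/eqP.
  by apply: eq_bigr => m _; rewrite /part leq_addr addKn /F valK.
have := line_indep g_comp g0 (Ordinal en).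
rewrite /g /= eqxx => /eqP; rewrite subr_eq0 => /eqP <-.
rewrite /part; case: leqP => de; last by left.
by right; exists (e - d)%N, (F (e - d)%N); rewrite subnK.
Qed.

(** A generator of positive degree would not reach the component of degree 0,
    which has dimension 1. *)
Lemma line_generates : exists2 e : N, generates e & e != 0.
Proof.
have [_ [d [v [vd vg]]] _] := Nline.
have [b [b0 bU]] := line_dim 0.
have bn0 : b ord0 != 0.
  apply/eqP => b00; have [r [_ rU]] := bU 0 (line_comp0 0).
  have E (a : k) : r = const_mx a.
    by apply: rU; rewrite big_ord1 b00 scaler0.
  have /rowP/(_ ord0) : const_mx 0 = const_mx 1 :> 'rV[k]_1 by rewrite -!E.
  by rewrite !mxE => /eqP; rewrite eq_sym oner_eq0.
have d0 : d = 0%N.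
  have [b00|[i [x [/eqP]]]] := line_homog vd (vg (b ord0)) (b0 ord0).
    by rewrite b00 eqxx in bn0.
  by rewrite addn_eq0 => /andP[_ /eqP].
rewrite {}d0 in vd; exists v; last first.
  apply/eqP => v0; have [x bE] := vg (b ord0).
  by rewrite bE v0 scaler0 eqxx in bn0.
split=> // e y; split=> [ye|[x Hx ->]].
  have [->|[i [x []]]] := line_homog vd (vg y) ye.
    by exists 0; rewrite ?scale0r //; exact: Hdeg0.
  by rewrite addn0 => <- Hx ->; exists x.
by rewrite -[e]addn0; exact: line_compZ.
Qed.

Lemma generates_neq0 (e : N) : generates e -> e != 0.
Proof.
move=> [eg _]; have [e' _ e'n0] := line_generates.
by apply: contraNneq e'n0 => e0; have [x ->] := eg e'; rewrite e0 scaler0.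
Qed.

End LineModules.

(** * Homogenizations of induced modules *)

Section Pairs.
Variables (k : fieldType).
Local Notation U := (Ug k).
Local Notation H := (Hg k).

Lemma iotaZD a (x y : sl2c k) : iota (a *: x + y) = a *: iota x + iota y.
Proof.
rewrite /Defs.iota scaler_sumr -big_split; apply: eq_bigr => t _ /=.
by rewrite !mxE scalerDl scalerA.
Qed.

Lemma iotaD (x y : sl2c k) : iota (x + y) = iota x + iota y.
Proof. by rewrite -[x]scale1r iotaZD !scale1r. Qed.

Lemma iota0 : iota (0 : sl2c k) = 0.
Proof. by rewrite /Defs.iota big1 // => t _; rewrite mxE scale0r. Qed.

Lemma iotaZ a (x : sl2c k) : iota (a *: x) = a *: iota x.
Proof. by rewrite -[_ *: _]addr0 iotaZD iota0 addr0. Qed.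

Lemma hspaceP i j l mu (x : sl2c k) :
  reflect (exists a b, x = a *: ga k i + b *: (ga k j + mu *: ga k l))
    (x \in hspace i j l mu).
Proof.
apply: (iffP memv_addP) => [[_ /vlineP[a ->] [_ /vlineP[b ->] ->]]|[a [b ->]]].
  by exists a, b.
exists (a *: ga k i); first by rewrite memvZ ?memv_line.
by exists (b *: (ga k j + mu *: ga k l)); first by rewrite memvZ ?memv_line.
Qed.

Variables (i j l : 'I_3) (mu : k).
Hypothesis two_neq0 : 2%:R != 0 :> k.
Hypothesis ijl : uniq [:: i; j; l].
Hypothesis mu2 : mu ^+ 2 = 1.
Variable p : hpair k.
Hypothesis pE : projT1 p = hspace i j l mu.
Local Notation h := (projT1 p).
Local Notation phi := (projT2 p).
Local Notation ev := (ev p).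
Local Notation c := (ev (ga k i)).
Local Notation gam := (ev (ga k j + mu *: ga k l)).
Hypothesis compat : gam * (2%:R * c - mu) = 0.
Local Notation V := {poly k}.
Local Notation L := (polmod two_neq0 ijl mu2 compat).
Local Notation pol1 := (pol1 two_neq0 ijl mu2 compat).

Lemma evZD a x y : ev (a *: x + y) = a * ev x + ev y.
Proof. by rewrite /Defs.ev !linearP. Qed.

Lemma mem_gi : ga k i \in hspace i j l mu.
Proof. by apply/hspaceP; exists 1, 0; rewrite scale1r scale0r addr0. Qed.

Lemma mem_gjl : ga k j + mu *: ga k l \in hspace i j l mu.
Proof. by apply/hspaceP; exists 0, 1; rewrite scale1r scale0r add0r. Qed.

Lemma ua_pol1_i : ua k i *: pol1 = (c%:A : U) *: pol1.
Proof.
rewrite [LHS]ua_polmod [RHS]polmodZ.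
by rewrite [LHS](op_i1 c mu gam two_neq0 ijl) -mul_polyC mulr1.
Qed.

Lemma ua_pol1_jl : (ua k j + mu *: ua k l) *: pol1 = (gam%:A : U) *: pol1.
Proof.
pose op := pol_op i l c mu gam.
transitivity (op j 1 + mu *: op l 1 : V).
  rewrite scalerDl algZ; congr (_ + _); first exact: ua_polmod.
  by rewrite ua_polmod; exact: polmodZ.
have -> : op j 1 = gam%:P - mu%:P * 'X by exact: op_j1.
have -> : op l 1 = 'X by rewrite /op op_l /pol_l mulr1.
rewrite [RHS]polmodZ -mul_polyC -[gam *: _]mul_polyC mulr1.
exact: subrK.
Qed.

(** In (a_j + mu a_l) 1 the two terms in X cancel, so 1 is an eigenvector of h. *)
Lemma iota_pol1 (x : sl2c k) : x \in h -> iota x *: pol1 = ((ev x)%:A : U) *: pol1.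
Proof.
move=> xh; have /hspaceP[a [b ->]] : x \in hspace i j l mu by rewrite -pE.
have evb : ev (b *: (ga k j + mu *: ga k l)) = b * gam by rewrite /Defs.ev !linearZ.
rewrite evZD evb iotaZD iotaZ !iotaD iotaZ !iota_ga.
rewrite scalerDl !(algZ _ _ pol1) ua_pol1_i ua_pol1_jl !scalerA -scalerDl.
by rewrite !mulr_algl !scalerA -scalerDl.
Qed.

(** The elements of U(g) that have 1 as an eigenvector form a subalgebra, which
    contains h. *)
Lemma Uh_pol1 (b : Uh h) : exists a : k, (val b : U) *: pol1 = (a%:A : U) *: pol1.
Proof.
pose S : {pred U} := fun u => `[< exists a : k, u *: pol1 = (a%:A : U) *: pol1 >].
have /asboolP [] // : val b \in S; last by move=> a ba; exists a.
have /asboolP := valP b; apply.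
- split; first by apply/asboolP; exists 1; rewrite scale1r.
    move=> a x y /asboolP[b1 xp] /asboolP[b2 yq]; apply/asboolP; exists (a * b1 + b2).
    by rewrite scalerDl algZ xp yq !polmodZ [RHS]scalerDl scalerA.
  move=> x y /asboolP[b1 xp] /asboolP[b2 yq]; apply/asboolP; exists (b1 * b2).
  by rewrite -(scalerA x y) yq -algC xp !polmodZ scalerA mulrC.
by move=> x xh; apply/asboolP; exists (ev x); exact: iota_pol1.
Qed.

Definition pol_char (b : Uh h) : k^o := ((val b : U) *: pol1 : V)`_0.

Lemma pol_charE b : (val b : U) *: pol1 = ((pol_char b : k)%:A : U) *: pol1.
Proof.
have [a ba] := Uh_pol1 b; rewrite /pol_char ba; congr (_%:A *: _).
by rewrite polmodZ coefZ coef1 mulr1.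
Qed.

Lemma pol_char_linear : linear pol_char.
Proof.
move=> a x y; rewrite /pol_char /= scalerDl algZ coefD; congr (_ + _).
by rewrite polmodZ coefZ.
Qed.

Lemma pol_char_monoid : monoid_morphism pol_char.
Proof.
split=> [|x y]; first by rewrite /pol_char /= scale1r coef1.
rewrite {1}/pol_char /= -scalerA pol_charE -algC pol_charE.
by rewrite !polmodZ !coefZ coef1 mulr1 mulrC.
Qed.

HB.instance Definition _ := GRing.isLinear.Build k (Uh h) k^o _ pol_char pol_char_linear.
HB.instance Definition _ := GRing.isMonoidMorphism.Build (Uh h) k^o pol_char pol_char_monoid.

Lemma pair_defines_module : defines_module phi.
Proof.
exists (pol_char : {lrmorphism Uh h -> k^o}) => x.
rewrite /= /pol_char /= iota_pol1 ?subvsP // polmodZ coefZ coef1 mulr1.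
by rewrite /Defs.ev vsvalK.
Qed.

Section Induced.
Variable D : defines_module phi.
Local Notation M := (induced D).
Local Notation chi := (projT1 (cid D)).

(** A character of U(h) is determined by its values on h, so chi is the character
    by which U(h) acts on 1. *)
Lemma chi_pol1 (b : Uh h) : (val b : U) *: pol1 = ((chi b : k)%:A : U) *: pol1.
Proof.
pose S : {pred U} := fun u => `[< exists2 b : Uh h, u = val b &
  u *: pol1 = ((chi b : k)%:A : U) *: pol1 >].
have /asboolP [b' /val_inj <- //] : val b \in S.
have /asboolP := valP b; apply.
- split; first by apply/asboolP; exists 1; rewrite ?rmorph1 ?scale1r.
    move=> a _ _ /asboolP[x -> xp] /asboolP[y -> yq]; apply/asboolP.
    exists (a *: x + y) => //.
    by rewrite scalerDl algZ xp yq linearP !polmodZ [RHS]scalerDl scalerA.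
  move=> _ _ /asboolP[x -> xp] /asboolP[y -> yq]; apply/asboolP; exists (x * y) => //.
  by rewrite -(scalerA (val x)) yq -algC xp rmorphM !polmodZ scalerA mulrC.
move=> x xh; apply/asboolP; exists (iota_h (vsproj h x)); first by rewrite /= vsprojK.
by rewrite (svalP (cid D)) iota_pol1.
Qed.

Definition ind1 : M := tens (val : Uh h -> U) 1 ((1 : k) : kphi D).

Lemma tens_ind1 (u : U) : tens (val : Uh h -> U) u ((1 : k) : kphi D) = u *: ind1.
Proof. by rewrite /ind1 tensZ mulr1. Qed.

Lemma iota_ind1 (x : sl2c k) : x \in h -> iota x *: ind1 = ((ev x)%:A : U) *: ind1.
Proof.
move=> xh; pose b := iota_h (vsproj h x).
have bx : val b = iota x by rewrite /= vsprojK.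
rewrite -!tens_ind1 -[X in tens _ X _ = _]mul1r -bx -(tens_bal (val : {rmorphism Uh h -> U})).
rewrite -[X in _ = tens _ X _]mul1r.
have -> : (ev x)%:A = val ((ev x)%:A : Uh h) by rewrite linearZ rmorph1.
rewrite -(tens_bal (val : {rmorphism Uh h -> U})); congr (tens _ _ _).
have E (b' : Uh h) : b' *: ((1 : k) : kphi D) = chi b' :> k by exact: mulr1.
rewrite [LHS]E [RHS]E linearZ rmorph1 /b.
by rewrite (svalP (cid D)) [RHS]mulr1.
Qed.

(** The map comes from the balanced map (u, y) |-> y (u 1).  To compare annihilators
    only its values on the elements u (x) 1 matter. *)
Lemma theta_exists : exists theta : M -> V, forall u : U, theta (u *: ind1) = u *: pol1.
Proof.
pose g (u : U) (y : kphi D) : V := (y : k) *: (u *: pol1 : V).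
have [] := @tens_univ _ _ (val : {rmorphism Uh h -> U}) (kphi D) V g.
- by move=> a b y; rewrite /g scalerDl scalerDr.
- by move=> a y y'; rewrite /g scalerDl.
- move=> a b y; rewrite /g -(scalerA a) [X in a *: X]chi_pol1 -algC polmodZ.
  rewrite scalerA; congr (_ *: _); exact: mulrC.
move=> theta [[_ thE] _]; exists theta => u.
by rewrite -tens_ind1 thE /g scale1r.
Qed.

Local Notation z := (ha k ord_max).
Local Notation a_ t := (ha k (emb t)).
Local Notation HD := (homogenization D).

Lemma ind1_HM : at0 ind1 \in HM_pred (D := D).
Proof.
apply/asboolP; split=> [[|d]|]; last by exists 1%N => -[].
  by exists 1; [exists 1; rewrite scale1r | rewrite tens_ind1 scale1r].
exact: Mfilt0.
Qed.

Definition hom1 : HD := MkHM ind1_HM.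

Lemma hom1E (x : H) d : HM_val (x *: hom1) d = dehom d x *: ind1.
Proof. exact: dehomE. Qed.

Lemma hom_ext (F G : HD) : (forall d, HM_val F d = HM_val G d) -> F = G.
Proof. by move=> FG; apply/val_inj/funext => d; exact: FG. Qed.

Lemma Mfilt_hom1 d (m : M) : Mfilt (D := D) d m -> exists2 x : H, Hdeg d x & m = dehom d x *: ind1.
Proof. by move=> [_ /Ufilt_dehom[x Hx <-] ->]; exists x; rewrite ?tens_ind1. Qed.

(** The coefficient at a_4^d of an element of the homogenization is u (x) 1 with u
    in U(g)_d, and u is the image of an element of degree d of H. *)
Lemma generates_hom1 : generates hom1.
Proof.
split=> [[F FH]|d y].
  have /asboolP[FM [n F0]] := FH.
  pose x d := s2val (cid2 (Mfilt_hom1 (FM d))).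
  have xH d : Hdeg d (x d) by exact: (s2valP (cid2 (Mfilt_hom1 (FM d)))).
  have xE d : F d = dehom d (x d) *: ind1 by exact: (s2valP' (cid2 (Mfilt_hom1 (FM d)))).
  exists (\sum_(d < n) x d); apply: hom_ext => d; rewrite hom1E dehom_sum [LHS]/=.
  have [dn|nd] := ltnP d n.
    rewrite (bigD1 (Ordinal dn)) //= big1 ?addr0 // => d' dd'.
    by apply: dehom_off (xH d') _; rewrite eq_sym.
  rewrite F0 // big1 ?scale0r // => d' _; apply: dehom_off (xH d') _.
  by rewrite gtn_eqF // (leq_trans (ltn_ord d')).
split=> [yd|[x Hx ->] d' dd']; last first.
  by rewrite hom1E (dehom_off Hx dd') scale0r.
case: y => F FH in yd *; have /asboolP[FM _] := FH; have [x Hx yE] := Mfilt_hom1 (FM d).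
exists x => //; apply: hom_ext => d'; rewrite hom1E.
by have [->//|dd'] := eqVneq d' d; rewrite yd // (dehom_off Hx dd') scale0r.
Qed.

Lemma hom_gen t (F : HD) d : HM_val (ha k t *: F) d.+1 = dehom_gen k t *: (HM_val F d : M).
Proof. exact: seqmod_gen. Qed.

Lemma hom1_lin (x : sl2c k) : x \in h ->
  (\sum_t x 0 t *: a_ t) *: hom1 = ((ev x)%:A : H) *: (z *: hom1).
Proof.
move=> xh; apply: hom_ext => d; rewrite -algZ !hom1E dehom_sum dehomZ.
have -> : \sum_t dehom d (x 0 t *: a_ t) = if d == 1%N then iota x else 0.
  case: eqP => [->|/eqP d1].
    by apply: eq_bigr => t _; rewrite dehomZ -[a_ t]mulr1 dehomS dehom1 mulr1 dehom_gen_emb.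
  by apply: big1 => t _; rewrite dehomZ (dehom_off (Hdeg_ha _ _) d1) scaler0.
case: eqP => [->|/eqP d1]; last by rewrite (dehom_off (Hdeg_ha _ _) d1) scaler0.
by rewrite iota_ind1 // -[z]mulr1 dehomS dehom1 mulr1 dehom_gen_max.
Qed.

Lemma sum_ga t : \sum_s (ga k t) 0 s *: a_ s = a_ t.
Proof.
rewrite (bigD1 t) //= big1 => [|s st]; rewrite mxE eqxx ?eqxx ?scale1r ?addr0 //.
by rewrite (negPf st) scale0r.
Qed.

Lemma hom1_i : a_ i *: hom1 = (c%:A : H) *: (z *: hom1).
Proof. by rewrite -hom1_lin ?pE ?mem_gi // sum_ga. Qed.

Lemma hom1_jl : (a_ j + mu *: a_ l) *: hom1 = (gam%:A : H) *: (z *: hom1).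
Proof.
rewrite -hom1_lin ?pE ?mem_gjl //; congr (_ *: _).
rewrite -!sum_ga scaler_sumr -big_split; apply: eq_bigr => t _ /=.
by rewrite scalerA -scalerDl; congr (_ *: _); rewrite [RHS]mxE; congr (_ + _); rewrite [RHS]mxE.
Qed.

Lemma hom1_rel : line_rel i j l c mu gam hom1.
Proof. by split; [exact: hom1_i | rewrite -hom1_jl scalerDl algZ addrK]. Qed.

(** One inclusion holds for every module with these relations; for the other, theta
    carries the coefficients of x hom1 to the polynomials x 1. *)
Lemma hom1_ann (x : H) : x *: hom1 = 0 <-> forall d, dehom d x *: pol1 = 0.
Proof.
split=> [x0 d|]; last exact: (ann_pol1 hom1_rel).
have [theta thE] := theta_exists.
have t0 : theta 0 = 0 by rewrite -[X in theta X](scale0r ind1) thE scale0r.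
have := hom1E x d; rewrite x0 => E; rewrite -thE -E; exact: t0.
Qed.

(** a_4 acts as the shift of sequences. *)
Lemma hom_torsionfree : ~ torsion ord_max HD.
Proof.
move=> [F Fn0 zF]; move/eqP: Fn0; apply; apply: hom_ext => d.
by have := hom_gen ord_max F d; rewrite zF dehom_gen_max scale1r => <-.
Qed.

Lemma hom_graded : is_graded HD.
Proof.
split=> [d|a b x y Hx|F|n f fH f0 t].
- split=> // x y xd yd t td; transitivity (HM_val x t - HM_val y t) => //.
  by rewrite xd // yd // subr0.
- move=> /generates_hom1.2[x' Hx' ->]; apply/generates_hom1.2.
  by exists (x * x'); rewrite ?scalerA //; exact: HdegM.
- have [x ->] := generates_hom1.1 F; have [n [f [Hf ->]]] := Hdeg_decomp x.
  exists n, (fun t => f t *: hom1); split=> [t|]; last by rewrite scaler_suml.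
  by apply/generates_hom1.2; exists (f t).
apply: hom_ext => d; have [->|td] := eqVneq d t; last by rewrite fH.
have sumE (r : seq 'I_n) : HM_val (\sum_(s <- r) f s) t = \sum_(s <- r) (HM_val (f s) t : M).
  by elim: r => [|s r IH]; rewrite ?big_nil ?big_cons // -IH.
have := sumE (index_enum _); rewrite f0 (bigD1 t) //= big1 ?addr0 => [<- //|s st].
by rewrite fH // eq_sym.
Qed.

(** The component of degree d has the basis a_l^n a_4^(d - n) hom1, n <= d. *)
Lemma hom_line : line_module HD.
Proof.
split; first exact: hom_graded.
  exists 0%N, hom1; split; last exact: generates_hom1.1.
  by move=> [|d].
exists succn; first exact/inv_1mX_sqE.
move=> d; exists (fun n : 'I_d.+1 => hmono k l d n *: hom1).
split=> [n|y /generates_hom1.2[x Hx ->]].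
  by apply/generates_hom1.2; exists (hmono k l d n) => //; exact: Hdeg_hmono.
have [xs ->] := dehom_hspan two_neq0 ijl mu2 compat hom1_rel Hx.
exists (poly_rV (dehom d x *: pol1 : V)); split=> [|r].
  by rewrite hspan_rVpoly poly_rV_K.
rewrite hspan_rVpoly => /eqP; rewrite -subr_eq0 -scalerBl => /eqP/hom1_ann/(_ d).
rewrite -hspanB dehom_hspan_pol1; last first.
  by rewrite (leq_trans (size_polyD _ _)) // geq_max size_polyN size_poly xs.
by move=> /eqP; rewrite subr_eq0 => /eqP ->; rewrite rVpolyK.
Qed.

End Induced.
End Pairs.

(** * Pairs, their homogenizations and line modules *)

Lemma sum3 (V : nmodType) (i j l : 'I_3) (F : 'I_3 -> V) : uniq [:: i; j; l] ->
  \sum_t F t = F i + F j + F l.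
Proof.
move=> ijl; have := ijl; rewrite /= !inE negb_or => /andP[/andP[ij il] /andP[jl _]].
rewrite (bigD1 i) //= (bigD1 j) ?(eq_sym j) //= (bigD1 l) /= ?big1 ?addr0 ?addrA //.
  move=> t /andP[/andP[ti tj] tl]; have := third_index ijl t.
  by rewrite (negPf ti) (negPf tj) (negPf tl).
by rewrite !(eq_sym l) il jl.
Qed.

Section PairModules.
Variable k : fieldType.
Hypothesis two_neq0 : 2%:R != 0 :> k.
Local Notation U := (Ug k).
Local Notation H := (Hg k).
Local Notation z := (ha k ord_max).
Local Notation a_ t := (ha k (emb t)).

Section LineModule.
Variables (i j l : 'I_3) (c mu gam : k).
Hypothesis ijl : uniq [:: i; j; l].
Hypothesis mu2 : mu ^+ 2 = 1.
Hypothesis compat : gam * (2%:R * c - mu) = 0.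
Local Notation V := {poly k}.
Local Notation pol1 := (pol1 two_neq0 ijl mu2 compat).

(** The d + 1 elements a_l^n a_4^(d - n) e span the component of degree d, which has
    dimension d + 1, so the normal form is unique. *)
Lemma line_ann (N : grmod k) (e : N) : line_module N -> generates e ->
  line_rel i j l c mu gam e ->
  forall x : H, x *: e = 0 <-> forall d, dehom d x *: pol1 = 0.
Proof.
move=> Nl [eg ec] er x; split; last exact: (ann_pol1 er).
have ann_homog d y : Hdeg d y -> y *: e = 0 -> dehom d y *: pol1 = 0.
  move=> Hy; have [ys ->] := dehom_hspan two_neq0 ijl mu2 compat er Hy.
  pose g (n : 'I_d.+1) : restrict_scalars N := hmono k l d n *: e.
  have E (r : 'rV[k]_d.+1) : \sum_n r 0 n *: g n = hspan l d (rVpoly r) *: e.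
    exact: hspan_rVpoly.
  have gI : independent g.
    apply: (@spans_independent k (restrict_scalars N) (@gr_comp k N d) d.+1 (line_dim Nl d) g).
    - exact: line_comp0.
    - by move=> n; apply/ec; exists (hmono k l d n) => //; exact: Hdeg_hmono.
    move=> u /ec[t Ht ->]; exists (poly_rV (dehom d t *: pol1 : V)); rewrite E.
    have [ts ->] := dehom_hspan two_neq0 ijl mu2 compat er Ht.
    by rewrite poly_rV_K.
  move=> y0; have := gI (poly_rV (dehom d y *: pol1 : V)).
  rewrite E poly_rV_K // => /(_ y0) p0.
  by rewrite -[LHS](poly_rV_K ys) p0 linear0.
have [n [f [Hf ->]]] := Hdeg_decomp x; rewrite scaler_suml => x0 d.
have fe : forall t : 'I_n, f t *: e = 0.
  apply: (line_indep Nl) => // t; apply/ec; by exists (f t).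
rewrite dehom_sum scaler_suml big1 // => t _.
have [->|dt] := eqVneq d t; first exact: ann_homog.
by rewrite (dehom_off (Hf t) dt) scale0r.
Qed.

(** On h the coordinates i and j are the coefficients of a_i and a_j + mu a_l, so
    phi can be written in terms of them. *)
Lemma pair_exists : exists p : hpair k, [/\ projT1 p = hspace i j l mu,
  ev p (ga k i) = c & ev p (ga k j + mu *: ga k l) = gam].
Proof.
pose h := hspace i j l mu.
pose f (y : subvs_of h) : k^o := c * vsval y 0 i + gam * vsval y 0 j.
have fL : linear f.
  move=> a x y; rewrite /f linearP !mxE.
  rewrite -[RHS]/(a * (c * vsval x 0 i + gam * vsval x 0 j)
    + (c * vsval y 0 i + gam * vsval y 0 j)); ring.
pose fl : {linear subvs_of h -> k^o} := HB.pack f (GRing.isLinear.Build k _ _ _ f fL).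
have := ijl; rewrite /= !inE negb_or => /andP[/andP[ij il] /andP[jl _]].
exists (existT _ h (linfun fl)); split=> //.
  rewrite [LHS](lfunE fl) /= /f vsprojK; last exact: mem_gi.
  by rewrite !mxE !eqxx (eq_sym j) (negPf ij) mulr1 mulr0 addr0.
rewrite [LHS](lfunE fl) /= /f vsprojK; last exact: mem_gjl.
rewrite !mxE !eqxx (negPf ij) (negPf il) (negPf jl).
by rewrite !mulr0 !addr0 mulr0 mulr1 add0r.
Qed.
End LineModule.

Section Pair.
Variables (i j l : 'I_3) (mu : k) (p : hpair k).
Local Notation V := {poly k}.
Local Notation c := (ev p (ga k i)).
Local Notation gam := (ev p (ga k j + mu *: ga k l)).
Hypothesis ijl : uniq [:: i; j; l].
Hypothesis mu2 : mu ^+ 2 = 1.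
Hypothesis pE : projT1 p = hspace i j l mu.
Hypothesis compat : gam * (2%:R * c - mu) = 0.
Local Notation pol1 := (pol1 two_neq0 ijl mu2 compat).

Variable D : defines_module (projT2 p).
Local Notation HD := (homogenization D).
Local Notation e1 := (hom1 D).

Lemma hom_line_iso (N : grmod k) (e : N) : line_module N -> generates e ->
  line_rel i j l c mu gam e -> gr_iso N HD.
Proof.
move=> Nl eg er; apply: (generates_iso eg (generates_hom1 D)) => x.
by rewrite (hom1_ann two_neq0 ijl mu2 pE compat) (line_ann ijl mu2 compat Nl eg er).
Qed.

Lemma hom_lq_iso (u v : H) : u *: (e1 : HD) = 0 -> v *: (e1 : HD) = 0 ->
  line_rel i j l c mu gam (lq1 u v) -> gr_iso HD (line_quotient u v).
Proof.
move=> ue ve er; apply: (generates_iso (generates_hom1 D) (generates_lq1 u v)) => x.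
split=> [/(hom1_ann two_neq0 ijl mu2 pE compat)|/lq1_ann[a [b ->]]]; first exact: (ann_pol1 er).
by rewrite scalerDl -!scalerA ue ve !scaler0 addr0.
Qed.

(** In the model, x maps 1 to a polynomial of degree at most 1, which is constant
    exactly when x lies in h. *)
Lemma hom_lin_ann (x : sl2c k) (s : k) :
  (\sum_t x 0 t *: a_ t - s *: z) *: (e1 : HD) = 0 <-> x \in projT1 p /\ s = ev p x.
Proof.
split=> [/(hom1_ann two_neq0 ijl mu2 pE compat)/(_ 1%N)|[xh ->]]; last first.
  by rewrite scalerBl [X in X - _](hom1_lin D xh) [X in _ - X]algZ subrr.
have d1 t : dehom 1 (ha k t) = dehom_gen k t.
  by rewrite -[ha k t]mulr1 dehomS dehom1 mulr1.
rewrite dehomD -scaleNr dehomZ d1 dehom_gen_max dehom_sum.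
under eq_bigr do rewrite dehomZ d1 dehom_gen_emb.
rewrite -/(Defs.iota x) => E.
pose y := x 0 i *: ga k i + x 0 j *: (ga k j + mu *: ga k l).
pose r := x 0 l - mu * x 0 j.
have xy : x = r *: ga k l + y.
  have := ijl; rewrite /= !inE negb_or => /andP[/andP[ij il] /andP[jl _]].
  apply/rowP => t; rewrite !mxE eqxx /=.
  have /or3P[/eqP->|/eqP->|/eqP->] := third_index ijl t;
    rewrite !eqxx ?(eq_sym j) ?(eq_sym l) ?(negPf ij) ?(negPf il) ?(negPf jl) /r;
    rewrite ?mulr1n ?mulr0n; ring.
have yh : y \in projT1 p by rewrite pE; apply/hspaceP; exists (x 0 i), (x 0 j).
have {E} E : r%:P * 'X + (ev p y - s)%:P = 0 :> V.
  have t1 : (r *: iota (ga k l)) *: pol1 = r *: 'X :> V.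
    rewrite algZ polmodZ iota_ga; congr (_ *: _).
    by rewrite [LHS]ua_polmod op_l /pol_l mulr1.
  have t2 : iota y *: pol1 = ev p y *: 1 :> V.
    by rewrite (iota_pol1 two_neq0 ijl mu2 pE compat yh) polmodZ.
  have t3 : (- s *: (1 : U)) *: pol1 = (- s) *: 1 :> V by rewrite polmodZ.
  rewrite -E [in RHS]xy iotaZD 2!scalerDl t1 t2 t3 -!mul_polyC !mulr1 -addrA.
  by rewrite -polyCD.
have r0 : r = 0.
  have := congr1 (fun q : V => q`_1) E.
  by rewrite coefD coefCM coefX coefC mulr1 addr0 coef0.
have := congr1 (fun q : V => q`_0) E.
rewrite r0 mul0r add0r coefC coef0 => /eqP; rewrite subr_eq0 => /eqP <-.
have xy' : x = y by rewrite [LHS]xy r0 scale0r add0r.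
by rewrite xy'.
Qed.
End Pair.

Lemma Hdeg0_scalar (x : H) : Hdeg 0 x -> exists a : k, x = a%:A.
Proof.
apply: (@Hdeg_ind k 0 (fun x => exists a : k, x = a%:A)) => [|a y y' [b ->] [b' ->]|w /size0nil ->].
- by exists 0; rewrite scale0r.
- by exists (a * b + b'); rewrite scalerDl scalerA.
by exists 1; rewrite /word big_nil scale1r.
Qed.

(** Two generators of degree 0 are multiples of each other. *)
Lemma generators_ann (N : grmod k) (e e' : N) : generates e -> generates e' ->
  forall x : H, x *: e = 0 -> x *: e' = 0.
Proof.
move=> [_ ec] /generates_comp0/ec[y Hy ->] x xe.
by have [a ->] := Hdeg0_scalar Hy; rewrite -algC xe scaler0.
Qed.

(** With b = a_j + mu a_l, the bracket satisfies <a_i, b> = mu b and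
    <b, b> = 2 mu a_i. *)
Lemma pair_inducing (i j l : 'I_3) (mu : k) (p : hpair k) :
  uniq [:: i; j; l] -> mu ^+ 2 = 1 -> projT1 p = hspace i j l mu ->
  ev p (ga k j + mu *: ga k l) * (2%:R * ev p (ga k i) - mu) = 0 -> inducing p.
Proof.
move=> ijl mu2 pE compat; split; last exact: (pair_defines_module two_neq0 ijl mu2 pE compat).
  rewrite pE => x y /hspaceP[a [b ->]] /hspaceP[a' [b' ->]].
  apply/hspaceP; exists (2%:R * mu * (b * b')), (mu * (a * b' + b * a')).
  have key (m2 : mu * mu = 1) t : bracket (a *: ga k i + b *: (ga k j + mu *: ga k l))
    (a' *: ga k i + b' *: (ga k j + mu *: ga k l)) 0 t =
   (2%:R * mu * (b * b') *: ga k i + mu * (a * b' + b * a') *: (ga k j + mu *: ga k l)) 0 t.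
    rewrite /bracket !mxE /=; move: ijl; clear -m2.
    elim/ord3_ind: i; elim/ord3_ind: j; elim/ord3_ind: l => //= _;
    elim/ord3_ind: t; rewrite /= ?mulr1n ?mulr0n; ring: m2.
  by apply/rowP => t; apply: key; rewrite -expr2.
rewrite pE /hspace; set v := ga k j + mu *: ga k l.
have -> : (<[ga k i]> + <[v]>)%VS = <<[:: ga k i; v]>>%VS by rewrite span_cons span_seq1.
apply/eqP; rewrite -[2%N]/(size [:: ga k i; v]) -/(free _).
have := ijl; rewrite /= !inE negb_or => /andP[/andP[ij il] /andP[jl _]].
rewrite free_cons span_seq1 seq1_free /v; apply/andP; split.
  apply/negP => /vlineP[a /rowP/(_ i)]; rewrite !mxE !eqxx (negPf ij) (negPf il).
  by rewrite mulr0 addr0 mulr0 => /eqP; rewrite oner_eq0.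
apply/eqP => /rowP/(_ j); rewrite !mxE !eqxx (negPf jl) mulr0 addr0 => /eqP.
by rewrite oner_eq0.
Qed.

(** An isomorphism preserves the linear forms that kill a generator of degree 0,
    and these forms determine h and phi. *)
Lemma hom_iso_inj (i j l i' j' l' : 'I_3) (mu mu' : k) (p p' : hpair k)
    (D : defines_module (projT2 p)) (D' : defines_module (projT2 p')) :
  uniq [:: i; j; l] -> mu ^+ 2 = 1 -> projT1 p = hspace i j l mu ->
  ev p (ga k j + mu *: ga k l) * (2%:R * ev p (ga k i) - mu) = 0 ->
  uniq [:: i'; j'; l'] -> mu' ^+ 2 = 1 -> projT1 p' = hspace i' j' l' mu' ->
  ev p' (ga k j' + mu' *: ga k l') * (2%:R * ev p' (ga k i') - mu') = 0 ->
  gr_iso (homogenization D) (homogenization D') -> p = p'.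
Proof.
move=> ijl mu2 pE compat ijl' mu2' pE' compat' iso.
have [e' ge' annE] := gr_iso_generates iso (generates_hom1 D).
have ge := generates_hom1 D'.
have ann x : x *: (hom1 D : homogenization D) = 0 <-> x *: (hom1 D' : homogenization D') = 0.
  rewrite annE; split; exact: generators_ann.
have ev_eq x s : (x \in projT1 p /\ s = ev p x) <-> (x \in projT1 p' /\ s = ev p' x).
  by rewrite -(hom_lin_ann ijl mu2 pE compat D) -(hom_lin_ann ijl' mu2' pE' compat' D') ann.
have h_eq : projT1 p = projT1 p'.
  apply/vspaceP => x; apply/idP/idP => xh.
    by have [] := (ev_eq x (ev p x)).1 (conj xh erefl).
  by have [] := (ev_eq x (ev p' x)).2 (conj xh erefl).
case: p p' {D D' iso e' ge' annE ge ann pE compat pE' compat'} h_eq ev_eq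
  => h phi [h' phi'] /= h_eq.
subst h'; rewrite /ev /= => ev_eq; congr existT; apply/lfunP => y.
have [_] := (ev_eq (vsval y) _).1 (conj (subvsP y) erefl).
by rewrite vsvalK.
Qed.

End PairModules.

(** * Line modules on which a_4 acts without torsion *)

Lemma uniq3_perm (i j l : 'I_3) : uniq [:: i; j; l] ->
  [/\ uniq [:: i; l; j], uniq [:: j; l; i] & uniq [:: j; i; l]].
Proof. by elim/ord3_ind: i; elim/ord3_ind: j; elim/ord3_ind: l. Qed.

Section Comb.
Variables (k : fieldType) (V : lmodType k) (p q : V).
(** Written in this form, linear identities between combinations of p and q become
    identities between scalars. *)
Definition comb (a b : k) : V := a *: p + b *: q.
Lemma combD a b a' b' : comb a b + comb a' b' = comb (a + a') (b + b').
Proof. by rewrite /comb addrACA -!scalerDl. Qed.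
Lemma combZ c a b : c *: comb a b = comb (c * a) (c * b).
Proof. by rewrite /comb scalerDr !scalerA. Qed.
Lemma combN a b : - comb a b = comb (- a) (- b).
Proof. by rewrite -scaleN1r combZ !mulN1r. Qed.
End Comb.

Lemma Hdeg1_form (k : fieldType) (x : Hg k) : Hdeg 1 x ->
  exists r : 'I_4 -> k, x = \sum_t r t *: ha k t.
Proof.
apply: (@Hdeg_ind k 1 (fun x => exists r : 'I_4 -> k, x = \sum_t r t *: ha k t)).
- by exists (fun _ => 0); rewrite big1 // => t _; rewrite scale0r.
- move=> a _ _ [r ->] [r' ->]; exists (fun t => a * r t + r' t).
  rewrite scaler_sumr -big_split; apply: eq_bigr => t _ /=.
  by rewrite scalerDl scalerA.
move=> [|t [|]] // _; exists (fun s => (s == t)%:R).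
rewrite /word big_seq1 (bigD1 t) //= eqxx scale1r big1 ?addr0 // => s /negPf ->.
by rewrite scale0r.
Qed.

Section Classification.
Variable k : fieldType.
Hypothesis two_neq0 : 2%:R != 0 :> k.
Local Notation H := (Hg k).
Variables (N : grmod k) (e : N).
Hypothesis Nl : line_module N.
Hypothesis Nt : ~ torsion ord_max N.
Hypothesis ge : generates e.

Local Notation W := (restrict_scalars N).

(** Declared on the underlying vector space, so that k-linearity can be used. *)
Definition gact (t : 'I_4) (y : W) : W := ha k t *: (y : N).

Fact gact_linear t : linear (gact t).
Proof. by move=> a x y; rewrite /gact scalerDr -algC. Qed.
HB.instance Definition _ t := GRing.isLinear.Build k W W _ (gact t) (gact_linear t).

Local Notation Z := (gact ord_max).
Local Notation A t := (gact (emb t)).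

Lemma gact_anticomm r s t (y : W) : uniq [:: r; s; t] ->
  A r (A s y) + A s (A r y) = Z (A t y).
Proof.
move=> rst; pose a t := ha k (emb t).
change (a r *: (a s *: (y : N)) + a s *: (a r *: (y : N)) = ha k ord_max *: (a t *: (y : N))).
by rewrite !scalerA -scalerDl (ha_anticomm k rst) ha_central.
Qed.

Lemma gact_central t (y : W) : gact t (Z y) = Z (gact t y).
Proof.
rewrite /gact !scalerA; case: (unliftP ord_max t) => [s ->|->] //.
by rewrite ha_central.
Qed.

Lemma Z_inj (y : W) : Z y = 0 -> y = 0.
Proof.
move=> zy; apply/eqP/negP => /negP yn0; apply: Nt.
by exists y.
Qed.

Lemma gact_comp d t (y : W) : @gr_comp k N d y -> @gr_comp k N d.+1 (gact t y).
Proof. by move=> yd; apply: (line_compZ Nl (Hdeg_ha k t) yd). Qed.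

Lemma comp1_form (y : W) : @gr_comp k N 1 y -> exists r : 'I_4 -> k, y = \sum_t r t *: gact t e.
Proof.
move=> /ge.2[x /Hdeg1_form[r ->] ->]; exists r; rewrite scaler_suml.
by apply: eq_bigr => t _; rewrite algZ.
Qed.

Lemma ord2E (F : 'I_2 -> W) : \sum_t F t = F ord0 + F ord_max.
Proof. by rewrite big_ord_recl big_ord1; congr (_ + F _); exact/val_inj. Qed.

(** Otherwise a_4 e would span the component of degree 1, which has dimension 2. *)
Lemma exists_free_gen : exists l : 'I_3, forall s : k, A l e <> s *: Z e.
Proof.
have [//|no] := pselect (exists l : 'I_3, forall s : k, A l e <> s *: Z e).
have al l : exists s : k, A l e = s *: Z e.
  have [//|ns] := pselect (exists s : k, A l e = s *: Z e).
  by case: no; exists l => s E; apply: ns; exists s.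
suff : (2 <= 1)%N by [].
apply: (@spans_dim k W (@gr_comp k N 1) 2 (line_dim Nl 1) 1 (fun _ => Z e)).
  by move=> _; exact/gact_comp/generates_comp0.
move=> y /comp1_form[r ->].
have at_ t : exists s : k, gact t e = s *: Z e.
  by case: (unliftP ord_max t) => [s ->|->]; [exact: al | exists 1; rewrite scale1r].
exists (\row__ \sum_t r t * sval (cid (at_ t))).
rewrite big_ord1 mxE scaler_suml; apply: eq_bigr => t _.
by rewrite -scalerA -(svalP (cid (at_ t))).
Qed.

Lemma Ze_neq0 : Z e != 0.
Proof. by apply/eqP => /Z_inj /eqP; rewrite (negPf (generates_neq0 Nl ge)). Qed.

Section Basis.
Variable l : 'I_3.
Hypothesis l_free : forall s : k, A l e <> s *: Z e.

Lemma basis_indep a b : comb (A l e) (Z e) a b = 0 -> a = 0 /\ b = 0.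
Proof.
move=> ab; have a0 : a = 0.
  have [//|an0] := eqVneq a 0; case: (l_free (s := - (a^-1 * b))).
  apply: (scalerI an0); rewrite scalerA mulrN mulrA divff // mul1r scaleNr.
  by apply/eqP; rewrite -addr_eq0; apply/eqP.
split=> //; move: ab; rewrite /comb a0 scale0r add0r => /eqP.
by rewrite scaler_eq0 (negPf Ze_neq0) orbF => /eqP.
Qed.

Lemma basis_span t : exists a b, gact t e = comb (A l e) (Z e) a b.
Proof.
pose g (s : 'I_2) : W := if s == ord0 then A l e else Z e.
have gE (r : 'rV[k]_2) : \sum_s r 0 s *: g s = comb (A l e) (Z e) (r 0 ord0) (r 0 ord_max).
  by rewrite ord2E.
have gS : @spans k W (@gr_comp k N 1) 2 g.
  apply: (@independent_spans k W (@gr_comp k N 1) 2 (line_dim Nl 1)).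
    by move=> s; rewrite /g; case: ifP => _; exact/gact_comp/generates_comp0.
  move=> r; rewrite gE => /basis_indep[r0 r1]; apply/rowP => s; rewrite mxE.
  case: (unliftP ord0 s) => [s' ->|->]; rewrite ?r0 //.
  by rewrite -[RHS]r1 ord1; congr (r _ _); exact/val_inj.
have [r rE] := gS _ (gact_comp t (generates_comp0 ge)).
by exists (r 0 ord0), (r 0 ord_max); rewrite rE gE.
Qed.

(** Apply a_i a_j + a_j a_i = a_l a_4 to e and move a_i and a_j to the right.  What is
    left is a relation between a_4 a_l e and a_4^2 e, which are independent because
    a_4 acts injectively. *)
Lemma two_term_rel i j c y d : uniq [:: i; j; l] ->
  A i e = c *: Z e -> A j e = comb (A l e) (Z e) y d -> y ^+ 2 = 1 /\ d * (2%:R * c + y) = 0.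
Proof.
move=> ijl ai aj.
have [ilj _ _] := uniq3_perm ijl.
pose p := Z (A l e); pose q := Z (Z e).
have ZC a b : Z (comb (A l e) (Z e) a b) = comb p q a b by rewrite linearD !linearZ.
have Ail : A i (A l e) = comb p q (y - c) d.
  have -> : A i (A l e) = Z (A j e) - A l (A i e).
    by rewrite -(gact_anticomm e ilj) addrK.
  rewrite aj ZC ai linearZ /= gact_central -/p.
  have -> : c *: p = comb p q c 0 by rewrite /comb scale0r addr0.
  by rewrite combN combD oppr0 addr0.
have Aij : A i (A j e) = comb p q (y * (y - c)) (y * d + d * c).
  rewrite aj linearD !linearZ /= Ail gact_central ai linearZ /= -/q combZ.
  have -> : d *: (c *: q) = comb p q 0 (d * c) by rewrite /comb scale0r add0r scalerA.
  by rewrite combD addr0.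
have Aji : A j (A i e) = comb p q (c * y) (c * d).
  by rewrite ai linearZ /= gact_central aj ZC combZ.
have pE : p = comb p q 1 0 by rewrite /comb scale0r addr0 scale1r.
have := gact_anticomm e ijl; rewrite Aij Aji combD -/p => E; move/eqP: E.
rewrite [X in _ == X]pE -subr_eq0 combN combD -ZC => /eqP/Z_inj/basis_indep[E1 E2].
split; last by apply: etrans _ E2; ring.
by apply/eqP; rewrite -subr_eq0; apply/eqP; apply: etrans _ E1; ring.
Qed.

(** Modulo a_4 N_1 the generators anticommute.  If x and y were both nonzero, this
    would put a_l^2 e, and then all of N_2, into the span of a_4 a_l e and a_4^2 e,
    whereas dim N_2 = 3. *)
Lemma mixed_gens_dependent i j x y c d : uniq [:: i; j; l] ->
  A i e = comb (A l e) (Z e) x c -> A j e = comb (A l e) (Z e) y d -> x * y = 0.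
Proof.
move=> ijl ai aj; have [//|xy0] := eqVneq (x * y) 0.
have [ilj jli _] := uniq3_perm ijl.
pose p := Z (A l e); pose q := Z (Z e); pose w := A l (A l e).
have ZC a b : Z (comb (A l e) (Z e) a b) = comb p q a b by rewrite linearD !linearZ.
(* S is a_4 N_1. *)
pose S (u : W) := exists a b, u = comb p q a b.
have SL a u v : S u -> S v -> S (a *: u + v).
  by move=> [b [b' ->]] [f [f' ->]]; exists (a * b + f), (a * b' + f'); rewrite combZ combD.
have Sp : S p by exists 1, 0; rewrite /comb scale0r addr0 scale1r.
have S0 : S 0 by exists 0, 0; rewrite /comb !scale0r addr0.
have SD u v : S u -> S v -> S (u + v) by move=> Su Sv; rewrite -[u]scale1r; exact: SL.
have SZ a u : S u -> S (a *: u) by move=> Su; rewrite -[_ *: _]addr0; exact: SL.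
have SB u v : S u -> S v -> S (u - v).
  by move=> Su Sv; rewrite -scaleN1r addrC; exact: SL.
have SA t : S (Z (gact t e)) by have [a [b ->]] := basis_span t; exists a, b; exact: ZC.
have wE s x' c' : uniq [:: s; l; if s == i then j else i] ->
    A s e = comb (A l e) (Z e) x' c' -> S (A s (A l e) + x' *: w).
  move=> slt sE; have := gact_anticomm e slt; rewrite sE linearD !linearZ /= gact_central -/w => E.
  have -> : A s (A l e) + x' *: w = Z (A (if s == i then j else i) e) - c' *: p.
    by rewrite -E addrA addrK.
  exact/SB/SZ/Sp/SA.
have Si : S (A i (A l e) + x *: w) by apply: wE ai; rewrite eqxx.
have Sj : S (A j (A l e) + y *: w).
  apply: wE aj; move: ijl; rewrite /= inE negb_or eq_sym => /andP[/andP[/negPf -> _] _].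
  exact: jli.
have Sw : S w.
  have e1 : A i (A j e) = y *: A i (A l e) + d *: Z (A i e).
    by rewrite aj linearD !linearZ /= gact_central.
  have e2 : A j (A i e) = x *: A j (A l e) + c *: Z (A j e).
    by rewrite [in LHS]ai linearD !linearZ /= gact_central.
  have yx : S (y *: A i (A l e) + x *: A j (A l e)).
    have -> : y *: A i (A l e) + x *: A j (A l e)
        = Z (A l e) - (d *: Z (A i e) + c *: Z (A j e)).
      by rewrite -(gact_anticomm e ijl) e1 e2 addrACA addrK.
    by apply: SB => //; apply: SD; apply: SZ.
  have n0 : 2%:R * (x * y) != 0 by rewrite mulf_neq0.
  have -> : w = (2%:R * (x * y))^-1 *: ((2%:R * (x * y)) *: w).
    by rewrite scalerA mulVf // scale1r.
  apply: (SZ); have -> : (2%:R * (x * y)) *: w = y *: (A i (A l e) + x *: w)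
      + x *: (A j (A l e) + y *: w) - (y *: A i (A l e) + x *: A j (A l e)).
    rewrite !scalerDr !scalerA [X in _ = X - _]addrACA [RHS]addrAC subrr add0r -scalerDl.
    by congr (_ *: _); ring.
  by apply: SB => //; apply: SD; apply: SZ.
have Sal t : S (gact t (A l e)).
  case: (unliftP ord_max t) => [s ->|-> //].
  have /or3P[/eqP->|/eqP->|/eqP-> //] := third_index ijl s.
    by rewrite -[gact _ _](addrK (x *: w)); apply: SB => //; exact: SZ.
  by rewrite -[gact _ _](addrK (y *: w)); apply: SB => //; exact: SZ.
have Stt t s : S (gact t (gact s e)).
  have [a [b ->]] := basis_span s; rewrite linearD !linearZ /= gact_central.
  by apply: SD; apply: SZ.
pose g (s : 'I_2) : W := if s == ord0 then p else q.
suff : (3 <= 2)%N by [].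
apply: (@spans_dim k W (@gr_comp k N 2) 3 (line_dim Nl 2) 2 g).
  by move=> s; rewrite /g; case: ifP => _; apply/gact_comp/gact_comp/generates_comp0.
move=> y' /ge.2[X HX ->].
suff [a [b ->]] : S (X *: e).
  by exists (\row_s if s == ord0 then a else b); rewrite ord2E !mxE.
apply: (@Hdeg_ind k 2 (fun X => S (X *: e)) _ _ _ X HX).
- by rewrite scale0r.
- by move=> a X1 X2 S1 S2; rewrite scalerDl algZ; exact: SL.
by move=> [|t [|s []]] // _; rewrite /word big_cons big_seq1 -scalerA; exact: Stt.
Qed.

Lemma others : exists i j, uniq [:: i; j; l].
Proof. by elim/ord3_ind: l; [exists o2, o3|exists o1, o3|exists o1, o2]. Qed.
End Basis.

Lemma line_rel_exists : exists i j l c mu gam, [/\ uniq [:: i; j; l],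
  mu = 1 \/ mu = -1, gam * (2%:R * c - mu) = 0 & line_rel i j l c mu gam e].
Proof.
have [l lf] := exists_free_gen; have [i [j ijl]] := others l.
have fin i' j' c y d : uniq [:: i'; j'; l] -> A i' e = comb (A l e) (Z e) 0 c ->
    A j' e = comb (A l e) (Z e) y d -> exists i j l c mu gam, [/\ uniq [:: i; j; l],
      mu = 1 \/ mu = -1, gam * (2%:R * c - mu) = 0 & line_rel i j l c mu gam e].
  move=> u; rewrite {1}/comb scale0r add0r => ai aj.
  have [y2 dc] := two_term_rel lf u ai aj.
  exists i', j', l, c, (- y), d; split=> //.
  - move/eqP: y2; rewrite sqrf_eq1 => /orP[]/eqP->; [by right|by left; rewrite opprK].
  - by rewrite opprK.
  split; first exact: ai.
  rewrite scaleNr scaleNr opprK addrC; exact: aj.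
have [x [c ai]] := basis_span lf (emb i); have [y [d aj]] := basis_span lf (emb j).
have /eqP := mixed_gens_dependent lf ijl ai aj.
rewrite mulf_eq0 => /orP[]/eqP E; rewrite E in ai aj.
  exact: fin ai aj.
apply: fin aj ai.
by have [] := uniq3_perm ijl.
Qed.
End Classification.

(** * Lines in projective space *)

Section Coordinates.
Variable k : fieldType.
Local Notation H := (Hg k).
Local Notation z := (ha k ord_max).
Local Notation a_ t := (ha k (emb t)).
Variables i j l : 'I_3.
Hypothesis ijl : uniq [:: i; j; l].

(** The form a a_i + b a_j + c a_l + d a_4, or the point with these coordinates. *)
Definition coordv (a b c d : k) : 'rV[k]_4 :=
  \row_t (if t == emb i then a else if t == emb j then b
          else if t == emb l then c else d).

Lemma emb_inj : injective emb.
Proof. exact: lift_inj. Qed.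

Lemma emb_max s : (ord_max == emb s :> 'I_4) = false.
Proof. exact/negbTE/neq_lift. Qed.

Lemma coordv_i a b c d : coordv a b c d 0 (emb i) = a.
Proof. by rewrite mxE eqxx. Qed.
Lemma coordv_j a b c d : coordv a b c d 0 (emb j) = b.
Proof.
have := ijl; rewrite /= !inE negb_or => /andP[/andP[ij il] /andP[jl _]].
by rewrite mxE !(inj_eq emb_inj) (eq_sym j) (negPf ij) eqxx.
Qed.
Lemma coordv_l a b c d : coordv a b c d 0 (emb l) = c.
Proof.
have := ijl; rewrite /= !inE negb_or => /andP[/andP[ij il] /andP[jl _]].
by rewrite mxE !(inj_eq emb_inj) !(eq_sym l) (negPf il) (negPf jl) eqxx.
Qed.
Lemma coordv_4 a b c d : coordv a b c d 0 ord_max = d.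
Proof. by rewrite mxE !emb_max. Qed.

Definition coordvE := (coordv_i, coordv_j, coordv_l, coordv_4).

Lemma coordvP (u v : 'rV[k]_4) : u 0 (emb i) = v 0 (emb i) -> u 0 (emb j) = v 0 (emb j) ->
  u 0 (emb l) = v 0 (emb l) -> u 0 ord_max = v 0 ord_max -> u = v.
Proof.
move=> ui uj ul u4; apply/rowP => t; case: (unliftP ord_max t) => [s ->|-> //].
by have /or3P[/eqP->|/eqP->|/eqP->] := third_index ijl s.
Qed.

Lemma sum4 (V : nmodType) (F : 'I_4 -> V) :
  \sum_t F t = F ord_max + (F (emb i) + F (emb j) + F (emb l)).
Proof. by rewrite (bigD1_ord ord_max) //= (sum3 (fun s => F (emb s)) ijl). Qed.

Lemma vanishesE (u p : 'rV[k]_4) : vanishes u p <-> u 0 ord_max * p 0 ord_max +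
  (u 0 (emb i) * p 0 (emb i) + u 0 (emb j) * p 0 (emb j) + u 0 (emb l) * p 0 (emb l)) = 0.
Proof. by rewrite /vanishes sum4. Qed.

Lemma formE (u : 'rV[k]_4) : form u = u 0 ord_max *: z + (u 0 (emb i) *: a_ i + u 0 (emb j) *: a_ j
  + u 0 (emb l) *: a_ l).
Proof. by rewrite /Defs.form sum4. Qed.

End Coordinates.

Section Lines.
Variable k : fieldType.
Local Notation H := (Hg k).
Local Notation z := (ha k ord_max).
Local Notation a_ t := (ha k (emb t)).
Local Notation coordv := (@coordv k).

Lemma formZD a (u v : 'rV[k]_4) : form (a *: u + v) = a *: form u + form v.
Proof.
rewrite /Defs.form scaler_sumr -big_split; apply: eq_bigr => t _ /=.
by rewrite !mxE scalerDl scalerA.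
Qed.

(** The columns of the cokernel of the matrix with rows u and v are points of the
    line V(u, v), so w vanishes on them and lies in the row space. *)
Lemma line_through_span (u v w p : 'rV[k]_4) : line_through u v w p ->
  exists a b, w = a *: u + b *: v.
Proof.
move=> [uvw _]; pose M := col_mx u v.
have /submxP[c ->] : (w <= M)%MS.
  rewrite submxE; apply/eqP/rowP => t; rewrite [RHS]mxE.
  have van (u' : 'rV[k]_4) : (u' *m cokermx M) 0 t = \sum_s u' 0 s * (col t (cokermx M))^T 0 s.
    by rewrite mxE; apply: eq_bigr => s _; rewrite !mxE.
  have M0 : M *m cokermx M = 0 by exact: mulmx_coker.
  rewrite mul_col_mx in M0.
  have uM : u *m cokermx M = 0.
    by rewrite -[LHS](col_mxKu _ (v *m cokermx M)) M0 linear0.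
  have vM : v *m cokermx M = 0.
    by rewrite -[LHS](col_mxKd (u *m cokermx M)) M0 linear0.
  rewrite van; apply: uvw; by rewrite /vanishes -van ?uM ?vM mxE.
exists (lsubmx c 0 0), (rsubmx c 0 0).
rewrite -[c in LHS]hsubmxK mul_row_col.
by rewrite [lsubmx c]mx11_scalar [rsubmx c]mx11_scalar !mul_scalar_mx !mxE.
Qed.

Lemma vec4E c1 c2 c3 c4 : vec4 c1 c2 c3 c4 = coordv o1 o2 o3 c1 c2 c3 c4 :> 'rV[k]_4.
Proof. by apply: (@coordvP k o1 o2 o3) => //; rewrite !mxE. Qed.

Lemma coordv_perm1 i j l a b c d : uniq [:: i; j; l] -> coordv i j l a b c d = coordv j l i b c a d.
Proof.
move=> ijl; have [_ jli _] := uniq3_perm ijl.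
by apply: (coordvP ijl); rewrite ?coordvE.
Qed.

(** Since a_j + mu a_l and a_l + mu a_j define the same plane, j < l selects one of
    the two ways to write it. *)
Lemma lines1_3P t : t \in lines1_3 k <-> exists (i j l : 'I_3) (mu : k), [/\ uniq [:: i; j; l],
  mu = 1 \/ mu = -1, (j < l)%N & t = (coordv i j l 0 1 mu 0, coordv i j l 0 1 (- mu) 0)].
Proof.
have r12 a b c d : coordv o1 o2 o3 a b c d = coordv o3 o1 o2 c a b d by rewrite -coordv_perm1.
have r13 a b c d : coordv o1 o2 o3 a b c d = coordv o2 o1 o3 b a c d.
  by apply: (@coordvP k o1 o2 o3) => //; rewrite !mxE.
rewrite /lines1_3 !vec4E !inE; split.
  do 5? [case/orP]; move/eqP->.
  - by exists o3, o1, o2, 1; split=> //; [left|rewrite !r12].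
  - by exists o3, o1, o2, (-1); split=> //; [right|rewrite !r12 opprK].
  - by exists o2, o1, o3, 1; split=> //; [left|rewrite !r13].
  - by exists o2, o1, o3, (-1); split=> //; [right|rewrite !r13 opprK].
  - by exists o1, o2, o3, 1; split=> //; left.
  - by exists o1, o2, o3, (-1); split=> //; [right|rewrite opprK].
move=> [i [j [l [mu [ijl mu1 jl ->]]]]]; move: ijl jl.
elim/ord3_ind: i; elim/ord3_ind: j; elim/ord3_ind: l => // _ _;
  by case: mu1 => ->; rewrite ?opprK -?r12 -?r13 ?eqxx ?orbT.
Qed.

Lemma lines4_6P t : t \in lines4_6 k <-> exists (i j l : 'I_3) (mu : k), [/\ uniq [:: i; j; l],
  mu = 1 \/ mu = -1, (j < l)%N
  & t = (coordv i j l (- (2%:R * mu)) 0 0 1, coordv i j l 0 1 (- mu) 0)].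
Proof.
have r12 a b c d : coordv o1 o2 o3 a b c d = coordv o3 o1 o2 c a b d by rewrite -coordv_perm1.
have r13 a b c d : coordv o1 o2 o3 a b c d = coordv o2 o1 o3 b a c d.
  by apply: (@coordvP k o1 o2 o3) => //; rewrite !mxE.
rewrite /lines4_6 !vec4E !inE; split.
  do 5? [case/orP]; move/eqP->.
  - by exists o3, o1, o2, 1; split=> //; [left|rewrite !r12 mulr1].
  - by exists o3, o1, o2, (-1); split=> //; [right|rewrite !r12 mulrN1 !opprK].
  - by exists o2, o1, o3, 1; split=> //; [left|rewrite !r13 mulr1].
  - by exists o2, o1, o3, (-1); split=> //; [right|rewrite !r13 mulrN1 !opprK].
  - by exists o1, o2, o3, 1; split=> //; [left|rewrite mulr1].
  - by exists o1, o2, o3, (-1); split=> //; [right|rewrite mulrN1 !opprK].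
move=> [i [j [l [mu [ijl mu1 jl ->]]]]]; move: ijl jl.
elim/ord3_ind: i; elim/ord3_ind: j; elim/ord3_ind: l => // _ _;
  by case: mu1 => ->; rewrite ?mulr1 ?mulrN1 ?opprK -?r12 -?r13 ?eqxx ?orbT.
Qed.

Lemma independent_form (u v w : 'rV[k]_4) : free [:: u; v] ->
  exists2 w', w' \in [:: u; v] & forall a, w' <> a *: w.
Proof.
rewrite free_cons span_seq1 seq1_free => /andP[uv v0].
have [[a ua]|nu] := pselect (exists a, u = a *: w); last first.
  by exists u; rewrite ?mem_head // => a ua; apply: nu; exists a.
exists v => [|b vb]; first by rewrite !inE eqxx orbT.
have b0 : b != 0 by apply: contraNneq v0 => b0; rewrite vb b0 scale0r.
case/negP: uv; apply/vlineP; exists (a / b).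
by rewrite ua vb scalerA divfK.
Qed.

End Lines.

(** * The two correspondences *)

Section Correspondences.
Variable k : fieldType.
Hypothesis two_neq0 : 2%:R != 0 :> k.
Local Notation H := (Hg k).
Local Notation z := (ha k ord_max).
Local Notation a_ t := (ha k (emb t)).
Local Notation coordv := (@coordv k).

Lemma scale_ann (N : lmodType H) (e : N) (s : k) (y : H) :
  s != 0 -> (s *: y) *: e = 0 -> y *: e = 0.
Proof. by move=> s0 sy; rewrite -[y](scalerK s0) algZ sy scaler0. Qed.

Lemma line_rel_a (N : lmodType H) (e : N) i j l c mu :
  line_rel i j l c mu 0 e <-> (a_ i - c *: z) *: e = 0 /\ (a_ j + mu *: a_ l) *: e = 0.
Proof.
rewrite /line_rel scalerBl scalerDl [in X in _ <-> (X /\ _)]algZ [in X in _ <-> (_ /\ X)]algZ.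
rewrite (scale0r (1 : H)) scale0r sub0r; split=> -[ei ej].
  by rewrite ei ej subrr addNr.
split; apply/eqP; first by rewrite -subr_eq0 ei.
by rewrite -addr_eq0 ej.
Qed.

Lemma line_rel_b (N : lmodType H) (e : N) i j l mu gam : mu ^+ 2 = 1 ->
  line_rel i j l (mu / 2%:R) mu gam e <-> (z - (2%:R * mu) *: a_ i) *: e = 0 /\
    (a_ j + mu *: a_ l - gam *: z) *: e = 0.
Proof.
move=> mu2; have mu0 : mu != 0.
  by apply: contraTneq (oner_neq0 k) => m0; rewrite -mu2 m0 expr0n negbK.
have -> : z - (2%:R * mu) *: a_ i = - (2%:R * mu) *: (a_ i - (mu / 2%:R) *: z).
  rewrite scalerBr scalerA !scaleNr mulNr.
  have -> : 2%:R * mu * (mu / 2%:R) = 1 by rewrite mulrC mulrA divfK // -expr2.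
  by rewrite scaleN1r opprK addrC.
rewrite /line_rel; split=> -[ei ej]; split.
- by rewrite algZ scalerBl ei [in X in _ - X]algZ subrr scaler0.
- rewrite scalerBl scalerDl ej [in X in _ - X]algZ [in X in (_ - _ + X) - _]algZ.
  by rewrite subrK subrr.
- have n0 : - (2%:R * mu) != 0 by rewrite oppr_eq0 mulf_neq0.
  apply/eqP; rewrite -subr_eq0 -[X in _ - X]algZ -scalerBl; apply/eqP.
  exact: scale_ann n0 ei.
apply/eqP; rewrite eq_sym subr_eq eq_sym -subr_eq0 -[X in _ + X - _]algZ -[X in _ - X]algZ.
by rewrite -scalerDl -scalerBl ej.
Qed.

Lemma lq1_u (u v : H) : u *: lq1 u v = 0.
Proof. by apply/lq1_ann; exists 1, 0; rewrite mul1r mul0r addr0. Qed.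

Lemma lq1_v (u v : H) : v *: lq1 u v = 0.
Proof. by apply/lq1_ann; exists 0, 1; rewrite mul1r mul0r add0r. Qed.

Lemma sign_sqr (mu : k) : mu = 1 \/ mu = -1 -> mu ^+ 2 = 1.
Proof. by case=> ->; rewrite ?sqrrN expr1n. Qed.

Lemma pair_a_compat i j l mu (p : hpair k) : pair_a i j l mu p ->
  ev p (ga k j + mu *: ga k l) * (2%:R * ev p (ga k i) - mu) = 0.
Proof. by move=> [_ ->]; rewrite mul0r. Qed.

Lemma pair_b_compat i j l mu (p : hpair k) : pair_b i j l mu p ->
  ev p (ga k j + mu *: ga k l) * (2%:R * ev p (ga k i) - mu) = 0.
Proof. by move=> [_ ->]; rewrite mulrC [2%:R * _]mulrC divfK // subrr mul0r. Qed.

Section PairIso.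
Variables (i j l : 'I_3) (mu : k) (p : hpair k) (D : defines_module (projT2 p)).

Lemma pair_a_iso : pair_a i j l mu p -> gr_iso (homogenization D)
  (line_quotient (a_ i - ev p (ga k i) *: z) (a_ j + mu *: a_ l)).
Proof.
move=> pa; have compat := pair_a_compat pa; have [[ijl /sign_sqr mu2 pE] gam0] := pa.
have := hom1_rel pE D; rewrite gam0 => /line_rel_a[ei ej].
apply: (hom_lq_iso two_neq0 ijl mu2 pE compat) => //.
by rewrite gam0; apply/line_rel_a; split; [exact: lq1_u | exact: lq1_v].
Qed.

Lemma pair_b_iso : pair_b i j l mu p -> gr_iso (homogenization D)
  (line_quotient (z - (2%:R * mu) *: a_ i)
     (a_ j + mu *: a_ l - ev p (ga k j + mu *: ga k l) *: z)).
Proof.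
move=> pb; have compat := pair_b_compat pb; have [[ijl /sign_sqr mu2 pE] cE] := pb.
have := hom1_rel pE D; rewrite cE => /(line_rel_b _ _ _ _ _ mu2)[ei ej].
apply: (hom_lq_iso two_neq0 ijl mu2 pE compat) => //.
by rewrite cE; apply/line_rel_b => //; split; [exact: lq1_u | exact: lq1_v].
Qed.
End PairIso.

Lemma hspace_swap i j l (mu : k) : mu ^+ 2 = 1 -> hspace i j l mu = hspace i l j mu.
Proof.
move=> mu2; have sub (j' l' : 'I_3) x : x \in hspace i j' l' mu -> x \in hspace i l' j' mu.
  move=> /hspaceP[a [b ->]]; apply/hspaceP; exists a, (b * mu).
  by rewrite scalerDr [in RHS]scalerDr !scalerA -mulrA -expr2 mu2 mulr1 [X in _ = _ + X]addrC.
by apply/vspaceP => x; apply/idP/idP; exact: sub.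
Qed.

Lemma pair_shape_swap i j l mu (p : hpair k) : pair_shape i j l mu p -> pair_shape i l j mu p.
Proof.
move=> [ijl mu1 pE]; have [ilj _ _] := uniq3_perm ijl; split=> //.
by rewrite pE hspace_swap // sign_sqr.
Qed.

(** Exchanging j and l leaves h unchanged, as a_l + mu a_j = mu (a_j + mu a_l). *)
Lemma pair_shape_lt i j l mu (p : hpair k) : pair_shape i j l mu p ->
  (j < l)%N \/ [/\ (l < j)%N, pair_shape i l j mu p &
    ev p (ga k l + mu *: ga k j) = mu * ev p (ga k j + mu *: ga k l)].
Proof.
move=> ps; have [ijl /sign_sqr mu2 _] := ps.
have jl : j != l :> nat.
  by move: ijl; rewrite /= !inE => /andP[_ /andP[]].
case: (ltngtP j l) => [|lj|E]; [by left| |by rewrite E eqxx in jl].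
right; split=> //; first exact: pair_shape_swap.
have -> : ga k l + mu *: ga k j = mu *: (ga k j + mu *: ga k l).
  by rewrite scalerDr scalerA -expr2 mu2 scale1r addrC.
by rewrite /ev !linearZ.
Qed.

Lemma pair_a_lt i j l mu (p : hpair k) : pair_a i j l mu p ->
  exists j' l' : 'I_3, (j' < l')%N /\ pair_a i j' l' mu p.
Proof.
move=> [ps g0]; case: (pair_shape_lt ps) => [jl|[lj ps' E]]; first by exists j, l.
by exists l, j; split=> //; split=> //; rewrite E g0 mulr0.
Qed.

Lemma pair_b_lt i j l mu (p : hpair k) : pair_b i j l mu p ->
  exists j' l' : 'I_3, (j' < l')%N /\ pair_b i j' l' mu p.
Proof.
move=> [ps g0]; case: (pair_shape_lt ps) => [jl|[lj ps' E]]; first by exists j, l.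
by exists l, j.
Qed.

Lemma free_coordv (u v : 'rV[k]_4) t s : u 0 t != 0 -> v 0 t = 0 -> v 0 s = 1 -> free [:: u; v].
Proof.
move=> ut vt vs; rewrite free_cons span_seq1 seq1_free; apply/andP; split.
  apply/negP => /vlineP[a /rowP/(_ t)]; rewrite mxE vt mulr0 => /eqP.
  by rewrite (negPf ut).
by apply/eqP => v0; move: vs; rewrite v0 mxE => /eqP; rewrite eq_sym oner_eq0.
Qed.

Lemma pair_a_type i j l mu (p : hpair k) (D : defines_module (projT2 p)) :
  pair_a i j l mu p -> line_module_of_type (lines1_3 k) (homogenization D).
Proof.
move=> /pair_a_lt[j' [l' [jl pa]]] {j l}; have compat := pair_a_compat pa.
have [[ijl mu1 pE] _] := pa; have mu2 := sign_sqr mu1.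
split; first exact: (hom_line two_neq0 ijl mu2 pE compat D).
exists (coordv i j' l' 1 0 0 (- ev p (ga k i))), (coordv i j' l' 0 1 mu 0); split.
- by apply: (@free_coordv _ _ (emb i) (emb j')); rewrite !coordvE ?oner_neq0.
- exists (coordv i j' l' 0 1 mu 0, coordv i j' l' 0 1 (- mu) 0).
    by apply/lines1_3P; exists i, j', l', mu.
  split=> //=; split; apply/(vanishesE ijl); rewrite !(coordvE _ ijl).
    by rewrite !mul0r !mulr0 !addr0.
  by rewrite mulrN -[mu * mu]expr2 mu2; ring.
have := pair_a_iso D pa; rewrite !(formE ijl) !(coordvE _ ijl).
by rewrite !scale0r !addr0 !add0r !scale1r scaleNr [- _ + _]addrC.
Qed.

Lemma pair_b_type i j l mu (p : hpair k) (D : defines_module (projT2 p)) :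
  pair_b i j l mu p -> line_module_of_type (lines4_6 k) (homogenization D).
Proof.
move=> /pair_b_lt[j' [l' [jl pb]]] {j l}; have compat := pair_b_compat pb.
have [[ijl mu1 pE] _] := pb; have mu2 := sign_sqr mu1.
split; first exact: (hom_line two_neq0 ijl mu2 pE compat D).
exists (coordv i j' l' (- (2%:R * mu)) 0 0 1),
  (coordv i j' l' 0 1 mu (- ev p (ga k j' + mu *: ga k l'))); split.
- apply: (@free_coordv _ _ (emb i) (emb j')); rewrite !coordvE // oppr_eq0 mulf_neq0 //.
  by apply: contraTneq (oner_neq0 k) => m0; rewrite -mu2 m0 expr0n negbK.
- exists (coordv i j' l' (- (2%:R * mu)) 0 0 1, coordv i j' l' 0 1 (- mu) 0).
    by apply/lines4_6P; exists i, j', l', mu.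
  split=> //=; split; apply/(vanishesE ijl); rewrite !(coordvE _ ijl).
    by rewrite !mul0r !mulr0 !addr0.
  by rewrite mulrN -[mu * mu]expr2 mu2; ring.
have := pair_b_iso D pb; rewrite !(formE ijl) !(coordvE _ ijl).
by rewrite !scale0r !addr0 !add0r !scale1r !scaleNr [- _ + _]addrC.
Qed.

Lemma line_rel_iso (N : grmod k) (e : N) i j l c mu gam :
  line_module N -> generates e -> uniq [:: i; j; l] -> mu = 1 \/ mu = -1 ->
  gam * (2%:R * c - mu) = 0 -> line_rel i j l c mu gam e ->
  exists (p : hpair k) (D : defines_module (projT2 p)),
    [/\ pair_shape i j l mu p, ev p (ga k i) = c,
        ev p (ga k j + mu *: ga k l) = gam & gr_iso N (homogenization D)].
Proof.
move=> Nl ge ijl mu1 compat er; have mu2 := sign_sqr mu1.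
have [p [pE pc pg]] := pair_exists c mu gam ijl.
rewrite -pc -pg in compat er.
exists p, (pair_defines_module two_neq0 ijl mu2 pE compat); split=> //.
apply: (hom_line_iso two_neq0 ijl mu2 pE compat _ Nl ge er).
Qed.

Lemma form_split i j l mu (w : 'rV[k]_4) : uniq [:: i; j; l] -> mu ^+ 2 = 1 ->
  w 0 (emb j) = mu * w 0 (emb l) ->
  form w = w 0 ord_max *: z + w 0 (emb i) *: a_ i
    + (mu * w 0 (emb l)) *: (a_ j + mu *: a_ l).
Proof.
move=> ijl mu2 wj; rewrite (formE ijl) wj [in RHS]scalerDr scalerA.
by rewrite [mu * _ * mu]mulrAC -expr2 mu2 mul1r !addrA.
Qed.

Section Types.
Variables (N : grmod k).
Hypothesis Nl : line_module N.
Hypothesis Nt : ~ torsion ord_max N.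

Lemma z_free (e : N) (d : k) : e != 0 -> (d *: z) *: e = 0 -> d = 0.
Proof.
move=> en0 dz; have [//|d0] := eqVneq d 0; case: Nt; exists e => //.
exact: scale_ann d0 dz.
Qed.

(** Of the two forms that define the line, at least one is not a multiple of the
    equation w of the plane; both vanish at p because the line passes through it. *)
Lemma type_forms T : line_module_of_type T N ->
  exists (e : N) (w w' p : 'rV[k]_4), [/\ generates e, (w, p) \in T,
    form w *: e = 0, form w' *: e = 0 & vanishes w' p /\ forall a, w' <> a *: w].
Proof.
move=> [_ [u [v [uv [[w p] tT line] iso]]]].
have [e ge ann] := generates_transport iso (generates_lq1 _ _).
have ue : form u *: e = 0 by apply/ann; exact: lq1_u.
have ve : form v *: e = 0 by apply/ann; exact: lq1_v.
have [w' w'uv nw'] := independent_form w uv.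
have [a [b /= wE]] := line_through_span line.
have [_ /= [up vp]] := line.
exists e, w, w', p; split=> //.
- have form0 : form 0 = 0 :> H by rewrite /Defs.form big1 // => t _; rewrite mxE scale0r.
  rewrite wE formZD -[b *: v]addr0 formZD form0 addr0 scalerDl algZ ue scaler0.
  by rewrite algZ ve scaler0 addr0.
- by move: w'uv; rewrite !inE => /orP[]/eqP->.
by split=> //; move: w'uv; rewrite !inE => /orP[]/eqP->.
Qed.

(** A form that vanishes at the point is, up to a multiple of a_j + mu a_l, a
    combination of a_i and a_4; a_i occurs in it because a_4 e is not 0. *)
Lemma type_a_pair : line_module_of_type (lines1_3 k) N ->
  exists (p : hpair k) (D : defines_module (projT2 p)),
    (exists i j l mu, pair_a i j l mu p) /\ gr_iso N (homogenization D).
Proof.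
move=> /type_forms[e [w [w' [p0 [ge]]]]].
move=> /lines1_3P[i [j [l [mu [ijl mu1 _ [-> ->]]]]]] {w p0} we w'e [w'p nw'].
have mu2 := sign_sqr mu1; have en0 := generates_neq0 Nl ge.
have w'j : w' 0 (emb j) = mu * w' 0 (emb l).
  move/(vanishesE ijl): w'p; rewrite !(coordvE _ ijl) !mulr0 mulr1 !add0r mulrN.
  by move/eqP; rewrite subr_eq0 mulrC => /eqP.
have {}we : (a_ j + mu *: a_ l) *: e = 0.
  by rewrite -we (formE ijl) !(coordvE _ ijl) !scale0r !add0r scale1r.
have w'E : (w' 0 ord_max *: z + w' 0 (emb i) *: a_ i) *: e = 0.
  rewrite -w'e (form_split ijl mu2 w'j) [in RHS]scalerDl.
  by rewrite [X in _ = _ + X]algZ we scaler0 addr0.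
have x0 : w' 0 (emb i) != 0.
  apply/eqP => x0; rewrite x0 scale0r addr0 in w'E.
  apply: (nw' (mu * w' 0 (emb l))); apply: (coordvP ijl); rewrite [RHS]mxE !(coordvE _ ijl).
  - by rewrite x0 mulr0.
  - by rewrite mulr1.
  - by rewrite mulrAC -expr2 mu2 mul1r.
  by rewrite mulr0; exact: z_free w'E.
set c := - (w' 0 ord_max / w' 0 (emb i)).
have er : line_rel i j l c mu 0 e.
  apply/line_rel_a; split=> //.
  have -> : a_ i - c *: z = (w' 0 (emb i))^-1 *: (w' 0 ord_max *: z + w' 0 (emb i) *: a_ i).
    by rewrite scalerDr !scalerA mulVf // scale1r addrC /c scaleNr opprK mulrC.
  by rewrite algZ w'E scaler0.
have [p [D [ps _ pg iso]]] := line_rel_iso Nl ge ijl mu1 (mul0r _) er.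
by exists p, D; split=> //; exists i, j, l, mu.
Qed.

(** A form that vanishes at the point is a combination of a_i, a_4 and a_j + mu a_l.
    Eliminating a_i by means of the plane leaves a_j + mu a_l, with a nonzero
    coefficient because a_4 e is not 0, and a multiple of a_4. *)
Lemma type_b_pair : line_module_of_type (lines4_6 k) N ->
  exists (p : hpair k) (D : defines_module (projT2 p)),
    (exists i j l mu, pair_b i j l mu p) /\ gr_iso N (homogenization D).
Proof.
move=> /type_forms[e [w [w' [p0 [ge]]]]].
move=> /lines4_6P[i [j [l [mu [ijl mu1 _ [-> ->]]]]]] {w p0} we w'e [w'p nw'].
have mu2 := sign_sqr mu1; have en0 := generates_neq0 Nl ge.
have w'j : w' 0 (emb j) = mu * w' 0 (emb l).
  move/(vanishesE ijl): w'p; rewrite !(coordvE _ ijl) !mulr0 mulr1 !add0r mulrN.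
  by move/eqP; rewrite subr_eq0 mulrC => /eqP.
have {}we : (z - (2%:R * mu) *: a_ i) *: e = 0.
  by rewrite -we (formE ijl) !(coordvE _ ijl) !scale0r !addr0 scale1r scaleNr.
set x := w' 0 (emb i); set y := mu * w' 0 (emb l); set t := w' 0 ord_max.
(* Here a_i is eliminated, using a_4 = 2 mu a_i on the plane and mu^2 = 1. *)
have w'E : ((t + x * (mu / 2%:R)) *: z + y *: (a_ j + mu *: a_ l)) *: e = 0.
  have -> : (t + x * (mu / 2%:R)) *: z + y *: (a_ j + mu *: a_ l) = form w'
      + (x * (mu / 2%:R)) *: (z - (2%:R * mu) *: a_ i).
    rewrite (form_split ijl mu2 w'j) -/x -/t -/y scalerBr scalerA.
    have -> : x * (mu / 2%:R) * (2%:R * mu) = x.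
      by rewrite -mulrA [_ / _ * _]mulrA divfK // -expr2 mu2 mulr1.
    by rewrite scalerDl [RHS]addrAC [X in _ = X + _]addrACA subrr addr0.
  by rewrite scalerDl w'e algZ we scaler0 addr0.
have y0 : y != 0.
  apply/eqP => y0; rewrite y0 scale0r addr0 in w'E.
  have t0 := z_free en0 w'E; have wl0 : w' 0 (emb l) = 0.
    by rewrite -[LHS]mul1r -mu2 expr2 -mulrA -/y y0 mulr0.
  apply: (nw' t); apply: (coordvP ijl); rewrite [RHS]mxE !(coordvE _ ijl) ?mulr0 ?mulr1 //.
    move/eqP: t0; rewrite addr_eq0 => /eqP ->.
    by rewrite mulrNN -mulrA [_ / _ * _]mulrA divfK // -expr2 mu2 mulr1.
  by rewrite w'j.
set gam := - ((t + x * (mu / 2%:R)) / y).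
have er : line_rel i j l (mu / 2%:R) mu gam e.
  apply/line_rel_b => //; split=> //; apply: (scale_ann y0).
  rewrite -w'E scalerBr scalerA /gam mulrN mulrCA divff // mulr1 scaleNr opprK.
  by rewrite addrC.
have compat : gam * (2%:R * (mu / 2%:R) - mu) = 0.
  by rewrite [2%:R * _]mulrC divfK // subrr mulr0.
have [p [D [ps pc _ iso]]] := line_rel_iso Nl ge ijl mu1 compat er.
by exists p, D; split=> //; exists i, j, l, mu.
Qed.

End Types.
End Correspondences.

Theorem theorem3p3 (k : closedFieldType) (char0 : [pchar k] =i pred0) :
  (forall (l : 'I_3) (N : grmod k),
     line_module N -> torsion (emb l) N -> ~ torsion ord_max N ->
     is_homogenization_of_induced N) /\
  (one_to_one
     (fun p : hpair k => exists i j l mu, pair_a i j l mu p)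
     (fun N : grmod k =>
        line_module_of_type (lines1_3 k) N /\ ~ torsion ord_max N) /\
   (forall (i j l : 'I_3) (mu : k) (p : hpair k)
           (D : defines_module (projT2 p)),
      pair_a i j l mu p ->
      gr_iso (homogenization D)
        (line_quotient
           (ha k (emb i) - ev p (ga k i) *: ha k ord_max)
           (ha k (emb j) + mu *: ha k (emb l))))) /\
  (one_to_one
     (fun p : hpair k => exists i j l mu, pair_b i j l mu p)
     (fun N : grmod k =>
        line_module_of_type (lines4_6 k) N /\ ~ torsion ord_max N) /\
   (forall (i j l : 'I_3) (mu : k) (p : hpair k)
           (D : defines_module (projT2 p)),
      pair_b i j l mu p ->
      gr_iso (homogenization D)
        (line_quotient
           (ha k ord_max - (2%:R * mu) *: ha k (emb i))
           (ha k (emb j) + mu *: ha k (emb l)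
              - ev p (ga k j + mu *: ga k l) *: ha k ord_max)))).
Proof.
have two_neq0 : 2%:R != 0 :> k by have := char0 2; rewrite !inE /= => ->.
split; last split; last first.
- split; last by move=> i j l mu p D; exact: pair_b_iso.
  split.
  + move=> p [i [j [l [mu pb]]]]; have [[ijl mu1 pE] _] := pb.
    exact: (pair_inducing two_neq0 ijl (sign_sqr mu1) pE (pair_b_compat two_neq0 pb)).
  + move=> p D [i [j [l [mu pb]]]]; split; last exact: hom_torsionfree.
    exact: (pair_b_type two_neq0 D pb).
  + move=> p p' D D' [i [j [l [mu pb]]]] [i' [j' [l' [mu' pb']]]].
    have [[ijl mu1 pE] _] := pb; have [[ijl' mu1' pE'] _] := pb'.
    exact: (hom_iso_inj two_neq0 ijl (sign_sqr mu1) pE (pair_b_compat two_neq0 pb)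
              ijl' (sign_sqr mu1') pE' (pair_b_compat two_neq0 pb')).
  by move=> N [Nb Nt]; exact: (type_b_pair two_neq0 Nb.1 Nt Nb).
- split; last by move=> i j l mu p D; exact: pair_a_iso.
  split.
  + move=> p [i [j [l [mu pa]]]]; have [[ijl mu1 pE] _] := pa.
    exact: (pair_inducing two_neq0 ijl (sign_sqr mu1) pE (pair_a_compat pa)).
  + move=> p D [i [j [l [mu pa]]]]; split; last exact: hom_torsionfree.
    exact: (pair_a_type two_neq0 D pa).
  + move=> p p' D D' [i [j [l [mu pa]]]] [i' [j' [l' [mu' pa']]]].
    have [[ijl mu1 pE] _] := pa; have [[ijl' mu1' pE'] _] := pa'.
    exact: (hom_iso_inj two_neq0 ijl (sign_sqr mu1) pE (pair_a_compat pa)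
              ijl' (sign_sqr mu1') pE' (pair_a_compat pa')).
  by move=> N [Na Nt]; exact: (type_a_pair two_neq0 Na.1 Nt Na).
move=> t N Nl _ Nt; have [e ge _] := line_generates Nl.
have [i [j [l [c [mu [gam [ijl mu1 compat er]]]]]]] := line_rel_exists two_neq0 Nl Nt ge.
have [p [D [[_ _ pE] pc pg iso]]] := line_rel_iso two_neq0 Nl ge ijl mu1 compat er.
exists p, D; split=> //.
by apply: (pair_inducing two_neq0 ijl (sign_sqr mu1) pE); rewrite pc pg.
Qed.
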